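(* Let $(V,\mathcal Y(z),c,\rho)$ be a graded vertex operator coalgebra with $V_0\nsubseteq\ker c$, $V_2\nsubseteq\ker\rho$ and $\dim C(V)<\infty$, let $(M,\Delta_M)$ be a left $C(V)$-comodule, and let $\mathcal L(M)$ be the associated admissible $V$-comodule defined in the context. Suppose $\dim M$ is countable. Then $\dim\mathcal L(M)$ is countable. Furthermore, $\mathcal L(M)_0=M$.
   Context: Conventions: all vector spaces are over $\mathbb C$; $\otimes=\otimes_{\mathbb C}$; $W^*=\mathrm{Hom}(W,\mathbb C)$ and $(\cdot,\cdot)$ is the natural pairing; $\tau(v\otimes w)=w\otimes v$; $V\otimes\mathbb C=\mathbb C\otimes V=V$; $\mathrm{Res}_z$ is the coefficient of $z^{-1}$; $(z_1+z_2)^n=\sum_{i\ge0}\binom{n}{i}z_1^{n-i}z_2^i$; $\delta(x)=\sum_{n\in\mathbb Z}x^n$. Vertex coalgebra: a triple $(V,\mathcal Y(z),c)$ with $V$ a vector space and linear maps $c:V\to\mathbb C$, $\mathcal Y(z):V\to V\otimes V[[z,z^{-1}]]$, $\mathcal Y(z)v=\sum_{k\in\mathbb Z}\Delta_k(v)z^{-k-1}$, such that for all $v\in V$: (i) each $\Delta_k(v)$ is a finite sum (an element of $V\otimes V$) and $\Delta_k(v)=0$ for $k\ll0$; (ii) $(c\otimes\mathrm{Id}_V)\mathcal Y(z)v=v$, $(\mathrm{Id}_V\otimes c)\mathcal Y(z)v\in V[[z]]$ and $\lim_{z\to0}(\mathrm{Id}_V\otimes c)\mathcal Y(z)v=v$;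 (iii) (Jacobi identity) on $V$, $z_0^{-1}\delta(\frac{z_1-z_2}{z_0})(\mathrm{Id}_V\otimes \mathcal Y(z_2))\mathcal Y(z_1)-z_0^{-1}\delta(\frac{z_2-z_1}{-z_0})(\tau\otimes\mathrm{Id}_V)(\mathrm{Id}_V\otimes \mathcal Y(z_1))\mathcal Y(z_2)=z_1^{-1}\delta(\frac{z_2+z_0}{z_1})(\mathcal Y(z_0)\otimes\mathrm{Id}_V)\mathcal Y(z_2)$. It is graded if $V=\oplus_{s\in\mathbb Z}V_s$ with $\dim V_s<\infty$, $V_s=0$ for $s\ll0$, and $\Delta_k(V_s)\subseteq (V\otimes V)_{s+k+1}$, where $(V\otimes V)_t=\oplus_s V_{t-s}\otimes V_s$. Graded vertex operator coalgebra $(V,\mathcal Y(z),c,\rho)$: a graded vertex coalgebra with a linear map $\rho:V\to\mathbb C$ such that, writing $(\rho\otimes\mathrm{Id}_V)\mathcal Y(z)=\sum_{k\in\mathbb Z}L(k)z^{k-2}$, one has $L(k)\in\mathrm{End}(V)$, $[L(k),L(j)]=(k-j)L(k+j)+\frac{k^3-k}{12}\delta_{k+j,0}d$ for some $d\in\mathbb C$, $V_s$ is the eigenspace of $L(0)$ with eigenvalue $s$, and $(L(1)\otimes\mathrm{Id}_V)\mathcal Y(z)=\frac{d}{dz}\mathcal Y(z)$. Convention for $L(0)$-powers: $z^{L(0)}$ and $(1+z)^{L(0)}$ act on $V_s$ as $z^s$ and $(1+z)^s=\sum_{i\ge0}\binom{s}{i}z^i$. Possibly infinite sums in expressions $\mathrm{Res}_z(\varphi(z)^{L(0)}\cdots\otimes\mathrm{Id})\mathcal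 Y(z)v$ are read componentwise in the bihomogeneous components. Weak $V$-comodule: a vector space $\mathcal M$ with a linear map $\mathcal Y_{\mathcal M}(z)=\sum_{k\in\mathbb Z}\Delta_{\mathcal M,k}z^{-k-1}:\mathcal M\to V\otimes\mathcal M[[z,z^{-1}]]$ such that (i) $\Delta_{\mathcal M,k}(m)$ is a finite sum and vanishes for $k\ll0$; (ii) $(c\otimes\mathrm{Id}_{\mathcal M})\mathcal Y_{\mathcal M}(z)m=m$; (iii) $z_0^{-1}\delta(\frac{z_1-z_2}{z_0})(\mathrm{Id}_V\otimes \mathcal Y_{\mathcal M}(z_2))\mathcal Y_{\mathcal M}(z_1)-z_0^{-1}\delta(\frac{z_2-z_1}{-z_0})(\tau\otimes\mathrm{Id}_{\mathcal M})(\mathrm{Id}_V\otimes \mathcal Y_{\mathcal M}(z_1))\mathcal Y_{\mathcal M}(z_2)=z_1^{-1}\delta(\frac{z_2+z_0}{z_1})(\mathcal Y(z_0)\otimes\mathrm{Id}_{\mathcal M})\mathcal Y_{\mathcal M}(z_2)$; (iv) writing $(\rho\otimes\mathrm{Id}_{\mathcal M})\mathcal Y_{\mathcal M}(z)=\sum_kL(k)z^{k-2}$, the $L(k)\in\mathrm{End}(\mathcal M)$ satisfy the Virasoro relations above; (v) $(L(1)\otimes\mathrm{Id}_{\mathcal M})\mathcal Y_{\mathcal M}(z)=\frac{d}{dz}\mathcal Y_{\mathcal M}(z)=\mathcal Y_{\mathcal M}(z)L(1)-(\mathrm{Id}_V\otimes L(1))\mathcal Y_{\mathcal M}(z)$.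 It is admissible if $\mathcal M=\oplus_{t\in\mathbb N}M_t$ with $\Delta_{\mathcal M,k}(M_t)\subseteq\oplus_{s\in\mathbb N}V_{t+k+1-s}\otimes M_s$. An admissible sub comodule is a subspace that is itself an admissible $V$-comodule under the restricted coaction. $C(V)=\mathrm{Span}\{v\in V\mid \mathrm{Res}_z(\frac{(1+z)^{L(0)}}{z^2}\otimes \mathrm{Id}_V)\mathcal Y(z)v=0\}$; when $\dim C(V)<\infty$ it is a coassociative coalgebra with $\Delta(v)=\mathrm{Res}_z(\frac{(1+z)^{L(0)}}{z}\otimes \mathrm{Id}_V)\mathcal Y(z)v$ and counit $c|_{C(V)}$. Dual vertex operator algebra (known, when $V_0\nsubseteq\ker c$, $V_2\nsubseteq\ker\rho$): $V'=\oplus_sV_s^*$ with $\mathbf 1=c|_{V_0}$, $\omega=\rho|_{V_2}$, $(Y(f,z)g,v)=(f\otimes g,\mathcal Y(z)v)$; $f\in V_s^*$ has weight $\mathrm{wt} f=s$. Its Zhu algebra is $A(V')=V'/O(V')$, $O(V')=\mathrm{Span}\{\mathrm{Res}_z\frac{(1+z)^{\mathrm{wt} f}}{z^2}Y(f,z)g\}$, with product $f*g=\mathrm{Res}_z\frac{(1+z)^{\mathrm{wt} f}}{z}Y(f,z)g$; restriction of functionals to $C(V)$ induces a surjective algebra homomorphism $\Phi:A(V')\to C(V)^*$. Construction of $\mathcal L(M)$: for a left $C(V)$-comodule $(M,\Delta_M)$, $\Delta_M(m)=\sum m'\otimes m''$, $M^*$ is a left $C(V)^*$-module by $(f m^* )(m)=\sum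 f(m')m^*(m'')$, hence an $A(V')$-module via $\Phi$. Let $\widehat{V'}=V'\otimes\mathbb C[t,t^{-1}]/D(V'\otimes\mathbb C[t,t^{-1}])$, $D=L(-1)\otimes1+1\otimes\frac{d}{dt}$, the $\mathbb Z$-graded Lie algebra with $[f\otimes t^m,g\otimes t^n]=\sum_{i\ge0}\binom mi (f_ig)\otimes t^{m+n-i}$, $\deg(f\otimes t^m)=\mathrm{wt} f-m-1$, decomposed as $\widehat{V'}(-)\oplus\widehat{V'}(0)\oplus\widehat{V'}(+)$ (negative, zero, positive degree). $f\otimes t^{\mathrm{wt} f-1}\mapsto f+O(V')$ is a Lie algebra epimorphism $\widehat{V'}(0)\to A(V')$, so $M^*$ is a $\widehat{V'}(0)$-module; let $\widehat{V'}(-)$ act by $0$. Set $U(M^* )=\mathcal U(\widehat{V'})\otimes_{\mathcal U(\widehat{V'}(0)+\widehat{V'}(-))}M^*$, $J=\{x\in U(M^* )\mid\langle m^{**},fx\rangle=0\ \forall m^{**}\in M^{**},f\in\mathcal U(\widehat{V'})\}$ (elements of $M^{**}$ are extended to $U(M^* )$ by zero in positive degrees), and $L(M^* )=U(M^* )/J$, an admissible $V'$-module with $Y_{M^*}(f,z)=\sum_k(f\otimes t^k)z^{-k-1}$ and $L(M^* )_0=M^*$. Its restricted dual $L(M^* )'=\oplus_s(L(M^* )_s)^*$ is a $V$-comodule with $(\mathcal Y(z)n^*,f\otimes n)=(n^*,Y_{M^*}(f,z)n)$, and $M\subseteq M^{**}=L(M^* )_0^*\subseteq L(M^* )'$. Let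 $\mathcal W(M)$ be the smallest sub comodule of $L(M^* )'$ containing $M$, $\mathcal J$ the maximal sub comodule of $\mathcal W(M)$ intersecting $M$ trivially, and $\mathcal L(M)=\mathcal W(M)/\mathcal J$. $\mathcal L(M)_0$ is its degree-$0$ component, with $M$ identified with its image. *)

(* Defs.v *)
From HB Require Import structures.
From mathcomp Require Import all_boot all_order all_algebra.
From mathcomp Require Import finmap.
From mathcomp Require Import boolp classical_sets functions cardinality fsbigop.

Set Implicit Arguments.
Unset Strict Implicit.
Unset Printing Implicit Defensive.

Import GRing.Theory.
Local Open Scope classical_set_scope.
Local Open Scope ring_scope.
Local Open Scope quotient_scope.

Section Span.
Variables (K : fieldType) (V : lmodType K).

Definition lspan_pred (A : set V) : V -> bool := fun v =>
  `[< exists2 s : seq (K * V), (forall p, p \in s -> A p.2)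
      & v = \sum_(p <- s) p.1 *: p.2 >].

Lemma lspan_closed (A : set V) : submod_closed (lspan_pred A).
Proof.
split; first by apply/asboolP; exists [::]; [move=> p; rewrite in_nil|rewrite big_nil].
move=> a u v /asboolP[s sA ->] /asboolP[t tA ->]; apply/asboolP.
exists ([seq (a * p.1, p.2) | p <- s] ++ t).
  by move=> p; rewrite mem_cat => /orP[/mapP[q qs ->]|/tA//]; exact: (sA q).
rewrite big_cat big_map scaler_sumr; congr (_ + _).
by apply: eq_bigr => p _; rewrite scalerA.
Qed.

HB.instance Definition _ (A : set V) :=
  GRing.isSubmodClosed.Build K V (lspan_pred A)
    (GRing.submod_closed_semi (lspan_closed A)).

Definition lspan (A : set V) : submodClosed V :=
  GRing.SubmodClosed.clone K V (lspan_pred A) _.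

Lemma mem_lspan (A : set V) v : A v -> v \in lspan A.
Proof.
move=> Av; apply/asboolP; exists [:: (1, v)]; last by rewrite big_seq1 scale1r.
by move=> p; rewrite inE => /eqP->.
Qed.

Lemma lspan_ind (A : set V) (S : submodClosed V) :
  (forall v, A v -> v \in S) -> forall v, v \in lspan A -> v \in S.
Proof.
move=> AS v /asboolP[s sA ->]; rewrite big_seq.
by apply: rpred_sum => p ps; apply/rpredZ/AS/sA.
Qed.

Definition findim (S : submodClosed V) : Prop :=
  exists s : seq V, S =i lspan [set v | v \in s].

Definition lin_indep (B : set V) : Prop :=
  forall (s : seq V) (a : V -> K), uniq s -> (forall v, v \in s -> B v) ->
    \sum_(v <- s) a v *: v = 0 -> forall v, v \in s -> a v = 0.

Definition basis (B : set V) : Prop :=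
  lin_indep B /\ forall v, v \in lspan B.

Definition countable_dim : Prop := exists2 B : set V, basis B & countable B.

(* V is the internal direct sum of the subspaces gr i. *)
Definition direct_sum (I : Type) (gr : I -> submodClosed V) : Prop :=
  (forall v, v \in lspan [set x | exists i, x \in gr i]) /\
  (forall i x, x \in gr i ->
     x \in lspan [set y | exists2 j, j <> i & y \in gr j] -> x = 0).

(* The component of v in gr i, meaningful when direct_sum gr. *)
Definition hcomp (I : Type) (gr : I -> submodClosed V) (i : I) (v : V) : V :=
  xget 0 [set x | x \in gr i /\
    v - x \in lspan [set y | exists2 j, j <> i & y \in gr j]].

Lemma hcompP (I : Type) (gr : I -> submodClosed V) i v : direct_sum gr ->
  hcomp gr i v \in gr i /\
  v - hcomp gr i v \in lspan [set y | exists2 j, j <> i & y \in gr j].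
Proof.
move=> [gen _]; pose P (w x : V) := x \in gr i /\
  w - x \in lspan [set y | exists2 j, j <> i & y \in gr j].
suff [x Px] : exists x, P v x by exact: (xgetI 0 Px).
have /asboolP[s sA ->] := gen v.
elim: s sA => [|p s IH] sA.
  by exists 0; rewrite /P big_nil subr0; split; exact: rpred0.
have [x [xi xj]] := IH (fun q qs => sA q (mem_behead (s := p :: s) qs)).
have [j pj] := sA p (mem_head p s); rewrite big_cons.
have [ji|ji] := pselect (j = i).
  exists (p.1 *: p.2 + x); split; first by rewrite rpredD // rpredZ // -ji.
  by rewrite opprD addrACA subrr add0r.
exists x; split=> //; rewrite -addrA rpredD // rpredZ //.
by apply: mem_lspan; exists j.
Qed.

Lemma lspan_rpredB (S : submodClosed V) u v : u \in S -> v \in S -> u - v \in S.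
Proof. by move=> uS vS; rewrite rpredD // -scaleN1r rpredZ. Qed.

Lemma hcomp_unique (I : Type) (gr : I -> submodClosed V) i v x : direct_sum gr ->
  x \in gr i -> v - x \in lspan [set y | exists2 j, j <> i & y \in gr j] ->
  hcomp gr i v = x.
Proof.
move=> ds xi vx; have [hi vh] := hcompP i v ds; apply/eqP; rewrite -subr_eq0.
apply/eqP; apply: ds.2 (lspan_rpredB hi xi) _.
by have := lspan_rpredB vx vh; rewrite opprB addrC addrA subrK.
Qed.

Lemma hcomp_linear (I : Type) (gr : I -> submodClosed V) i :
  direct_sum gr -> linear (hcomp gr i).
Proof.
move=> ds a u v; have [ui uj] := hcompP i u ds; have [vi vj] := hcompP i v ds.
apply: hcomp_unique => //; first by rewrite rpredD // rpredZ.
by rewrite opprD addrACA -scalerBr rpredD // rpredZ.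
Qed.

Lemma hcomp_id (I : Type) (gr : I -> submodClosed V) i v :
  direct_sum gr -> v \in gr i -> hcomp gr i v = v.
Proof. by move=> ds vi; apply: hcomp_unique; rewrite ?subrr ?rpred0. Qed.

Lemma hcomp_other (I : Type) (gr : I -> submodClosed V) i j v :
  direct_sum gr -> j <> i -> v \in gr j -> hcomp gr i v = 0.
Proof.
move=> ds ji vj; apply: hcomp_unique; rewrite ?subr0 ?rpred0 //.
by apply: mem_lspan; exists j.
Qed.

End Span.

Section Subspace.
Variables (K : fieldType) (V : lmodType K) (S : submodClosed V).

Record subsp := Subsp { subsp_val : V; _ : subsp_val \in S }.

HB.instance Definition _ := [isSub for subsp_val].
HB.instance Definition _ := [Choice of subsp by <:].
HB.instance Definition _ := [SubChoice_isSubLmodule of subsp by <:].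

Definition zsub : V -> bool := fun v => v \in S.

Lemma zsub_closed : zmod_closed zsub.
Proof. exact: (GRing.submod_closedB (GRing.submodClosedP S)). Qed.

HB.instance Definition _ := GRing.isZmodClosed.Build V zsub zsub_closed.

Definition zclosed : zmodClosed V := GRing.ZmodClosed.clone V zsub _.

Definition quotsp := Quotient.quot zclosed.

HB.instance Definition _ := GRing.Zmodule.on quotsp.

Definition qpi (v : V) : quotsp := \pi_(Quotient.quot zclosed) v.
Definition qrepr (x : Quotient.quot zclosed) : V := repr (x : Quotient.quot zclosed).

Lemma qpi_eq v w : qpi v = qpi w <-> v - w \in S.
Proof.
have -> : (v - w \in S) = (v - w \in zclosed) by [].
by rewrite Quotient.idealrBE; split=> /eqP.
Qed.

Lemma qreprK x : qpi (qrepr x) = x.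
Proof. exact: reprK. Qed.

Lemma qpiD v w : qpi (v + w) = qpi v + qpi w.
Proof. by rewrite /qpi piE. Qed.

Definition qscale (a : K) (x : quotsp) : quotsp := qpi (a *: qrepr x).

Lemma qpiZ a v : qpi (a *: v) = qscale a (qpi v).
Proof. by apply/qpi_eq; rewrite -scalerBr rpredZ//; apply/qpi_eq; rewrite qreprK. Qed.

Lemma qscalerA a b x : qscale a (qscale b x) = qscale (a * b) x.
Proof. by rewrite -[x]qreprK -!qpiZ scalerA. Qed.
Lemma qscale1r : left_id 1 qscale.
Proof. by move=> x; rewrite -[x]qreprK -!qpiZ scale1r. Qed.
Lemma qscalerDr : right_distributive qscale +%R.
Proof. by move=> a x y; rewrite -[x]qreprK -[y]qreprK -!(qpiZ, qpiD) scalerDr. Qed.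
Lemma qscalerDl x : {morph qscale^~ x : a b / a + b}.
Proof. by move=> a b; rewrite -[x]qreprK -!(qpiZ, qpiD) scalerDl. Qed.

HB.instance Definition _ := GRing.Zmodule_isLmodule.Build K quotsp
  qscalerA qscale1r qscalerDr qscalerDl.

Lemma qpi_linear : linear qpi.
Proof. by move=> a u v; rewrite qpiD qpiZ. Qed.

HB.instance Definition _ := GRing.isLinear.Build K V quotsp *:%R qpi qpi_linear.

End Subspace.
Arguments qpi {K V} S v.

Section FreeModule.
Variables (K : fieldType) (T : choiceType).

Definition finsupp_pred : (T -> K^o) -> bool := fun f =>
  `[< finite_set [set t | f t != 0] >].

Lemma finsupp_closed : submod_closed finsupp_pred.
Proof.
split; first by apply/asboolP; rewrite (_ : mkset _ = set0) //;
  apply/seteqP; split=> t //=; rewrite eqxx.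
move=> a f g /asboolP ff /asboolP fg; apply/asboolP.
apply: (@sub_finite_set _ _ ([set t | f t != 0] `|` [set t | g t != 0])).
  move=> t; rewrite /mkset (_ : (a *: f + g) t = a * f t + g t)//.
  case: (eqVneq (f t) 0) => [->|]; last by left.
  by rewrite mulr0 add0r; right.
by rewrite finite_setU.
Qed.

HB.instance Definition _ := GRing.isSubmodClosed.Build K (T -> K^o)
  finsupp_pred (GRing.submod_closed_semi finsupp_closed).

Definition finsupp : submodClosed (T -> K^o) :=
  GRing.SubmodClosed.clone K (T -> K^o) finsupp_pred _.

Definition freemod := subsp finsupp.

HB.instance Definition _ := GRing.Lmodule.on freemod.

Lemma fbasis_subproof (t : T) :
  (fun u => if u == t then 1 : K^o else 0) \in finsupp.
Proof.
apply/asboolP; apply: (@sub_finite_set _ _ [set t]); last exact: finite_set1.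
by move=> u /=; case: (eqVneq u t) => // _; rewrite eqxx.
Qed.

Definition fbasis (t : T) : freemod := Subsp (fbasis_subproof t).

Definition fext (X : lmodType K) (b : T -> X) (x : freemod) : X :=
  \sum_(t \in [set: T]) subsp_val x t *: b t.

Lemma fextE (X : lmodType K) (b : T -> X) (x : freemod) (A : {fset T}) :
  [set t | subsp_val x t != 0] `<=` [set` A] ->
  fext b x = \sum_(t <- A) subsp_val x t *: b t.
Proof.
move=> xA; rewrite /fext.
have x0 t : ~ (t \in A) -> subsp_val x t *: b t = 0.
  by move=> tA; case: (eqVneq (subsp_val x t) 0) => [->|/xA//]; rewrite scale0r.
rewrite -(@fsbig_widen _ _ _ _ [set` A] [set: T])//.
  by rewrite -fsbig_seq//.
by move=> t /= [_ tA]; exact: x0.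
Qed.

Lemma fext_linear (X : lmodType K) (b : T -> X) : linear (fext b).
Proof.
have finx (x : freemod) : exists A : {fset T},
    [set t | subsp_val x t != 0] `<=` [set` A].
  case: x => f /= /asboolP/finite_fsetP[A eA]; exists A; rewrite eA; exact: subset_refl.
move=> a x y; have [A xA] := finx x; have [B yB] := finx y.
have sx : [set t | subsp_val x t != 0] `<=` [set` (A `|` B)%fset].
  by move=> t /xA /= tA; rewrite inE tA.
have sy : [set t | subsp_val y t != 0] `<=` [set` (A `|` B)%fset].
  by move=> t /yB /= tA; rewrite inE tA orbT.
have sxy : [set t | subsp_val (a *: x + y) t != 0] `<=` [set` (A `|` B)%fset].
  move=> t /= n0; have [x0|/sx//] := eqVneq (subsp_val x t) 0.
  apply: sy => /=; apply: contra_neq n0 => y0.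
  transitivity (a *: (subsp_val x t : K^o) + subsp_val y t); first by [].
  by rewrite x0 y0 scaler0 addr0.
rewrite (fextE b sx) (fextE b sy) (fextE b sxy) scaler_sumr -big_split /=.
by apply: eq_bigr => t _; rewrite scalerA -scalerDl.
Qed.

HB.instance Definition _ (X : lmodType K) (b : T -> X) :=
  GRing.isLinear.Build K freemod X *:%R (fext b) (fext_linear b).

Lemma fext_basis (X : lmodType K) (b : T -> X) t : fext b (fbasis t) = b t.
Proof.
rewrite (@fextE _ b _ [fset t]%fset) ?big_seq_fset1 /= ?eqxx ?scale1r//.
by move=> u /=; rewrite inE; case: (eqVneq u t) => // _; rewrite eqxx.
Qed.

End FreeModule.

Section Tensor.
Variable K : fieldType.

Definition bilin (V W X : lmodType K) (b : V -> W -> X) : Prop :=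
  (forall w, linear (b^~ w)) /\ (forall v, linear (b v)).

Definition tensor_rel (V W : lmodType K) : set (freemod K (V * W)%type) :=
  [set r | (exists (a : K) v v' w, r = fbasis K (a *: v + v', w)
                       - (a *: fbasis K (v, w) + fbasis K (v', w))) \/
           (exists (a : K) v w w', r = fbasis K (v, a *: w + w')
                       - (a *: fbasis K (v, w) + fbasis K (v, w')))].

Definition tensor (V W : lmodType K) := quotsp (lspan (@tensor_rel V W)).

HB.instance Definition _ V W := GRing.Lmodule.on (tensor V W).

Definition pure (V W : lmodType K) (v : V) (w : W) : tensor V W :=
  qpi (lspan (@tensor_rel V W)) (fbasis K (v, w)).

(* The map on V ⊗ W induced by b; only meaningful when b is bilinear. *)
Definition tlift (V W X : lmodType K) (b : V -> W -> X) (t : tensor V W) : X :=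
  fext (fun p => b p.1 p.2) (qrepr t).

Lemma tlift_qpi (V W X : lmodType K) (b : V -> W -> X) x : bilin b ->
  tlift b (qpi (lspan (@tensor_rel V W)) x) = fext (fun p => b p.1 p.2) x.
Proof.
move=> [bl br]; apply/eqP; rewrite -subr_eq0 -linearB /=; apply/eqP.
have /asboolP[s sA ->] : qrepr (qpi (lspan (@tensor_rel V W)) x) - x \in lspan (@tensor_rel V W).
  by apply/qpi_eq; rewrite qreprK.
rewrite linear_sum big_seq big1 // => -[a r] /sA /= rel; rewrite linearZ_LR.
case: rel => -[c [u [v [w ->]]]]; rewrite linearB linearD linearZ_LR /= !fext_basis /=.
  by rewrite bl subrr scaler0.
by rewrite br subrr scaler0.
Qed.

Lemma tlift_pure (V W X : lmodType K) (b : V -> W -> X) v w : bilin b ->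
  tlift b (pure v w) = b v w.
Proof. by move=> hb; rewrite tlift_qpi // fext_basis. Qed.

Lemma tlift_linear (V W X : lmodType K) (b : V -> W -> X) : bilin b ->
  linear (tlift b).
Proof.
move=> hb a t u; rewrite -[t]qreprK -[u]qreprK -linearP !tlift_qpi //.
exact: linearP.
Qed.

Lemma bilin_pure (V W : lmodType K) : bilin (@pure V W).
Proof.
by split=> [w a v v'|v a w w']; rewrite /pure -linearP; apply/qpi_eq/mem_lspan;
  [left; exists a, v, v', w | right; exists a, v, w, w'].
Qed.

Definition tmap (V W V' W' : lmodType K) (f : V -> V') (g : W -> W') :
  tensor V W -> tensor V' W' := tlift (fun v w => pure (f v) (g w)).

Definition tswap (V W : lmodType K) : tensor V W -> tensor W V :=
  tlift (fun v w => pure w v).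

Definition tassoc (U V W : lmodType K) :
  tensor U (tensor V W) -> tensor (tensor U V) W :=
  tlift (fun u => tlift (fun v w => pure (pure u v) w)).

(* f ⊗ Id and Id ⊗ f, followed by K ⊗ W = W and V ⊗ K = V. *)
Definition contrl (V W : lmodType K) (f : V -> K^o) : tensor V W -> W :=
  tlift (fun v w => f v *: w).

Definition contrr (V W : lmodType K) (f : W -> K^o) : tensor V W -> V :=
  tlift (fun v w => f w *: v).

(* (f ⊗ g, t), for functionals f and g. *)
Definition tpair (V W : lmodType K) (f : V -> K^o) (g : W -> K^o) :
  tensor V W -> K^o := tlift (fun v w => f v * g w : K^o).

End Tensor.

Section Series.
Variable K : fieldType.

Definition binz (n : int) (i : nat) : K :=
  (\prod_(j < i) (n - j%:Z)%:~R) / i`!%:R.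

(* Res_z (1 + z)^s z^(-j) F(z), where F(z) = sum_k F_k z^(-k-1). *)
Definition resz (X : lmodType K) (s : int) (j : nat) (F : int -> X) : X :=
  \sum_(i \in [set: nat]) binz s i *: F (i%:Z - j%:Z).

(* sum_s V_(t - s) ⊗ X_s; w embeds the index set of the grading of X in Z. *)
Definition tgr (V X : lmodType K) (I : Type) (w : I -> int)
    (gV : int -> submodClosed V) (gX : I -> submodClosed X) (t : int) :
    submodClosed (tensor V X) :=
  lspan [set p | exists i v x,
    [/\ v \in gV (t - w i), x \in gX i & p = pure v x]].

Definition truncated (X Y : lmodType K) (D : int -> X -> Y) : Prop :=
  forall x, exists N : int, forall k : int, (k < N)%R -> D k x = 0.

(* The coefficient of z0^(-l-1) z1^(-m-1) z2^(-n-1) in the Jacobi identity,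
   with values in (V ⊗ V) ⊗ X; the delta functions are expanded in nonnegative
   powers of the second variable in each numerator. *)
Definition jacobi (V X : lmodType K) (Y : int -> V -> tensor V V)
    (D : int -> X -> tensor V X) : Prop :=
  forall (l m n : int) (x : X),
    \sum_(i \in [set: nat]) ((-1) ^+ i * binz l i) *:
        tassoc (tmap id (D (n + i%:Z)) (D (l + m - i%:Z) x))
    - \sum_(i \in [set: nat]) ((-1) ^ l * (-1) ^+ i * binz l i) *:
        tmap (@tswap K V V) id
          (tassoc (tmap id (D (m + i%:Z)) (D (l + n - i%:Z) x)))
    = \sum_(i \in [set: nat]) binz m i *:
        tmap (Y (l + i%:Z)) id (D (m + n - i%:Z) x).

(* (rho ⊗ Id) D(z) = sum_k L(k) z^(k-2). *)
Definition vir (V X : lmodType K) (rho : V -> K^o)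
    (D : int -> X -> tensor V X) (k : int) : X -> X :=
  fun x => contrl rho (D (1 - k) x).

Definition virasoro (X : lmodType K) (d : K) (L : int -> X -> X) : Prop :=
  forall (k j : int) (x : X),
    L k (L j x) - L j (L k x) = (k - j)%:~R *: L (k + j) x +
      (if k + j == 0 then (k ^+ 3 - k)%:~R / 12%:R * d else 0) *: x.

End Series.

Section VertexCoalgebra.
Variable K : fieldType.

Record vertex_coalgebra (V : lmodType K) (Y : int -> {linear V -> tensor V V})
    (c : {linear V -> K^o}) : Prop := {
  vc_trunc : truncated Y;
  vc_counitl : forall k v,
    contrl c (Y k v) = if k == -1 then v else 0;
  vc_counitr : forall (k : int) v, (0 <= k)%R -> contrr c (Y k v) = 0;
  vc_counitr_lim : forall v, contrr c (Y (-1) v) = v;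
  vc_jacobi : jacobi Y Y
}.

Record graded_coalgebra (V : lmodType K) (Y : int -> {linear V -> tensor V V})
    (gr : int -> submodClosed V) : Prop := {
  gc_sum : direct_sum gr;
  gc_findim : forall s, findim (gr s);
  gc_bounded : exists N : int, forall s v, (s < N)%R -> v \in gr s -> v = 0;
  gc_coact : forall (k s : int) v, v \in gr s ->
    Y k v \in tgr id gr gr (s + k + 1)
}.

Record gvoc := Gvoc {
  gvoc_space :> lmodType K;
  coact : int -> {linear gvoc_space -> tensor gvoc_space gvoc_space};
  counit : {linear gvoc_space -> K^o};
  rho : {linear gvoc_space -> K^o};
  gr : int -> submodClosed gvoc_space;
  rank : K;
  gvoc_vertex : vertex_coalgebra coact counit;
  gvoc_graded : graded_coalgebra coact gr;
  gvoc_vir : virasoro rank (vir rho coact);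
  gvoc_eigen : forall (s : int) v, v \in gr s <-> vir rho coact 0 v = s%:~R *: v;
  gvoc_deriv : forall (k : int) v,
    tmap (vir rho coact 1) id (coact k v) = (- k)%:~R *: coact (k - 1) v
}.

Record weak_comodule (V : gvoc) (X : lmodType K)
    (D : int -> {linear X -> tensor V X}) : Prop := {
  wc_trunc : truncated D;
  wc_counit : forall k x,
    contrl (counit V) (D k x) = if k == -1 then x else 0;
  wc_jacobi : jacobi (coact V) D;
  wc_vir : virasoro (rank V) (vir (rho V) D);
  wc_deriv : forall (k : int) x,
    tmap (vir (rho V) (coact V) 1) id (D k x) = (- k)%:~R *: D (k - 1) x;
  wc_comm : forall (k : int) x,
    (- k)%:~R *: D (k - 1) x =
      D k (vir (rho V) D 1 x) - tmap id (vir (rho V) D 1) (D k x)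
}.

Record admissible_comodule (V : gvoc) (X : lmodType K)
    (D : int -> {linear X -> tensor V X}) (gX : nat -> submodClosed X) : Prop := {
  ac_weak : weak_comodule D;
  ac_sum : direct_sum gX;
  ac_coact : forall (k : int) (t : nat) x, x \in gX t ->
    D k x \in tgr Posz (gr V) gX (t%:Z + k + 1)
}.

End VertexCoalgebra.

Section Dual.
Variables (K : fieldType) (X : lmodType K).

Definition lin_pred : (X -> K^o) -> bool := fun f => `[< linear f >].

Lemma lin_closed : submod_closed lin_pred.
Proof.
split; first by apply/asboolP => a u v; rewrite /= scaler0 addr0.
move=> a f g /asboolP lf /asboolP lg; apply/asboolP => b u v.
transitivity (a *: (f (b *: u + v)) + g (b *: u + v)) => //.
rewrite lf lg; transitivity (b *: (a *: f u + g u) + (a *: f v + g v)) => //.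
by rewrite !scalerDr !scalerA [a * b]mulrC addrACA.
Qed.

HB.instance Definition _ := GRing.isSubmodClosed.Build K (X -> K^o)
  lin_pred (GRing.submod_closed_semi lin_closed).

Definition linear_functionals : submodClosed (X -> K^o) :=
  GRing.SubmodClosed.clone K (X -> K^o) lin_pred _.

Definition dual := subsp linear_functionals.

HB.instance Definition _ := GRing.Lmodule.on dual.

Variables (I : Type) (gX : I -> submodClosed X).

Definition fsupport (f : X -> K^o) : set I :=
  [set i | exists2 x, x \in gX i & f x != 0].

Definition rlin_pred : (X -> K^o) -> bool := fun f =>
  `[< linear f /\ finite_set (fsupport f) >].

Lemma rlin_closed : submod_closed rlin_pred.
Proof.
split.
  apply/asboolP; split=> [a u v|]; first by rewrite /= scaler0 addr0.
  rewrite (_ : fsupport _ = set0) //; apply/seteqP; split=> i //= -[x _].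
  by rewrite eqxx.
move=> a f g /asboolP[lf ff] /asboolP[lg fg]; apply/asboolP; split.
  apply/asboolP; have [_ cl] := lin_closed.
  by apply: cl; exact/asboolP.
apply: (@sub_finite_set _ _ (fsupport f `|` fsupport g)); last first.
  by rewrite finite_setU.
move=> i [x xi]; rewrite (_ : (a *: f + g) x = a *: f x + g x) //.
case: (eqVneq (f x) 0) => [->|fx _]; last by left; exists x.
by rewrite scaler0 add0r => gx; right; exists x.
Qed.

HB.instance Definition _ := GRing.isSubmodClosed.Build K (X -> K^o)
  rlin_pred (GRing.submod_closed_semi rlin_closed).

Definition restricted_functionals : submodClosed (X -> K^o) :=
  GRing.SubmodClosed.clone K (X -> K^o) rlin_pred _.

(* The direct sum of the (gX i)^*, as functionals vanishing on all but finitely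
   many gX i. *)
Definition rdual := subsp restricted_functionals.

HB.instance Definition _ := GRing.Lmodule.on rdual.

(* (gX i)^* inside rdual: the functionals vanishing on gX j for all j <> i. *)
Definition rdual_gr_pred (i : I) : rdual -> bool := fun f =>
  `[< forall j x, j <> i -> x \in gX j -> subsp_val f x = 0 >].

Lemma rdual_gr_closed i : submod_closed (rdual_gr_pred i).
Proof.
split; first by apply/asboolP.
move=> a f g /asboolP hf /asboolP hg; apply/asboolP => j x ji xj.
transitivity (a *: subsp_val f x + subsp_val g x) => //.
by rewrite (hf j) // (hg j) // scaler0 addr0.
Qed.

HB.instance Definition _ i := GRing.isSubmodClosed.Build K rdual
  (rdual_gr_pred i) (GRing.submod_closed_semi (rdual_gr_closed i)).

Definition rdual_gr (i : I) : submodClosed rdual :=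
  GRing.SubmodClosed.clone K rdual (rdual_gr_pred i) _.

End Dual.

Section DualVOA.
Variables (K : fieldType) (V : gvoc K).

Definition dvoa : lmodType K := rdual (gr V).
Definition dvoa_gr (s : int) : submodClosed dvoa := rdual_gr (gr V) s.

Lemma dvoa_linear (f : dvoa) : linear (subsp_val f).
Proof. by case: f => f /= /asboolP[]. Qed.

Lemma bilin_pair (X Y : lmodType K) (f : X -> K^o) (g : Y -> K^o) :
  linear f -> linear g -> bilin (fun v w => f v * g w : K^o).
Proof.
move=> lf lg; split=> [w a v v'|v a w w'] /=.
  by rewrite lf mulrDl -scalerAl.
by rewrite lg mulrDr scalerAr.
Qed.

Lemma tpair_linear (X Y : lmodType K) (f : X -> K^o) (g : Y -> K^o) :
  linear f -> linear g -> linear (tpair f g).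
Proof. by move=> lf lg; exact/tlift_linear/bilin_pair. Qed.

Lemma dmode_subproof (k : int) (f g : dvoa) :
  (fun v => tpair (subsp_val f) (subsp_val g) (coact V k v))
    \in restricted_functionals (gr V).
Proof.
have lf := dvoa_linear f; have lg := dvoa_linear g.
have lp := tpair_linear lf lg.
apply/asboolP; split=> [a u v|]; first by rewrite linearP lp.
have /asboolP[_ ff] : subsp_val f \in restricted_functionals (gr V) by case: f {lf lp}.
have /asboolP[_ fg] : subsp_val g \in restricted_functionals (gr V) by case: g {lg lp}.
pose h (st : int * int) := st.1 + st.2 - k - 1.
apply: (@sub_finite_set _ _
  (h @` (fsupport (gr V) (subsp_val f) `*` fsupport (gr V) (subsp_val g)))).
  move=> r [v vr /eqP nz].
  have /asboolP[s sA e] := gc_coact (gvoc_graded V) k vr.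
  rewrite /= e in nz.
  have [p ps pn] : exists2 p, p \in s & tpair (subsp_val f) (subsp_val g) p.2 != 0.
    apply/not_exists2P => H; apply: nz.
    pose F : {linear tensor V V -> K^o} := HB.pack (tpair (subsp_val f) (subsp_val g))
      (GRing.isLinear.Build K (tensor V V) K^o *:%R _ lp).
    rewrite -[tpair _ _]/(F : _ -> _) linear_sum big_seq big1 // => p ps.
    rewrite linearZ_LR /=; case: (H p) => // /negP; rewrite negbK => /eqP ->.
    by rewrite scaler0.
  have [i [x [y [xi yi ep]]]] := sA p ps.
  move: pn; rewrite ep /tpair tlift_pure; last exact: bilin_pair.
  rewrite mulf_eq0 negb_or => /andP[fx gy].
  exists (r + k + 1 - i, i); last by rewrite /h /= subrK addrAC addrK addrK.
  by split; [exists x | exists y].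
exact/finite_image/finite_setX.
Qed.

(* (f_k g, v) = (f ⊗ g, Y_k v), i.e. Y(f, z) g = sum_k (f_k g) z^(-k-1). *)
Definition dmode (k : int) (f g : dvoa) : dvoa := Subsp (dmode_subproof k f g).

Lemma omega_subproof :
  (fun v => rho V (hcomp (gr V) 2 v)) \in restricted_functionals (gr V).
Proof.
have ds := gc_sum (gvoc_graded V); apply/asboolP; split.
  by move=> a u v; rewrite hcomp_linear // linearP.
apply: (@sub_finite_set _ _ [set 2]); last exact: finite_set1.
move=> i [x xi] /=; have [//|/eqP i2] := eqVneq i 2.
by rewrite (hcomp_other ds i2 xi) linear0 eqxx.
Qed.

(* rho restricted to V_2, extended by zero to the other V_s. *)
Definition omega : dvoa := Subsp omega_subproof.

(* The bihomogeneous (s, t)-component of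
   Res_z ((1 + z)^L(0) z^(-j) ⊗ Id) Y(z) v. *)
Definition zhu_res (j : nat) (v : V) (s t : int) : tensor V V :=
  resz s j (fun k => tmap (hcomp (gr V) s) (hcomp (gr V) t) (coact V k v)).

Definition zhu_sub : submodClosed V :=
  lspan [set v | forall s t, zhu_res 2 v s t = 0].

Definition zhuC : lmodType K := subsp zhu_sub.

(* Left C(V)-comodules. Delta(v) is the family of bihomogeneous components
   zhu_res 1 v s t, and coassociativity is
   (Delta ⊗ Id) o DM = (Id ⊗ DM) o DM compared in each component V_s ⊗ V_t ⊗ M. *)
Record zhu_comodule (M : lmodType K) (DM : {linear M -> tensor zhuC M}) : Prop := {
  zm_counit : forall m,
    contrl (fun v : zhuC => counit V (subsp_val v)) (DM m) = m;
  zm_coassoc : forall m (s t : int),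
    tmap (fun v : zhuC => zhu_res 1 (subsp_val v) s t) id (DM m) =
    tmap (tmap (fun v : zhuC => hcomp (gr V) s (subsp_val v))
               (fun v : zhuC => hcomp (gr V) t (subsp_val v))) id
         (tassoc (tmap id DM (DM m)))
}.

(* O(V'), where V' = dvoa; zhuA is A(V'). *)
Definition zhuO : submodClosed dvoa :=
  lspan [set h | exists s f g, f \in dvoa_gr s /\
    h = resz s 2 (fun k => dmode k f g)].

Definition zhuA : lmodType K := quotsp zhuO.

Lemma restr_subproof (f : dvoa) :
  (fun v : zhuC => subsp_val f (subsp_val v)) \in linear_functionals zhuC.
Proof. by apply/asboolP => a u v; rewrite -(dvoa_linear f). Qed.

Definition restr (f : dvoa) : dual zhuC := Subsp (restr_subproof f).

(* f + O(V') |-> f restricted to C(V); qrepr picks some representative f. *)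
Definition zhuPhi (a : zhuA) : dual zhuC := restr (qrepr a).

End DualVOA.

Section LieHat.
Variables (K : fieldType) (V : gvoc K).

(* C[t, t^-1] as the space with basis t^m, m in Z. *)
Definition laurent : lmodType K := freemod K int.
Definition tpow (m : int) : laurent := fbasis K m.
Definition ddt : laurent -> laurent := fext (fun m : int => m%:~R *: tpow (m - 1)).

Definition loop : lmodType K := tensor (dvoa V) laurent.

(* L(-1) on V' is the mode omega_0. *)
Definition loopD (x : loop) : loop :=
  tmap (dmode 0 (omega V)) id x + tmap id ddt x.

Definition hat : lmodType K := quotsp (lspan (range loopD)).

Definition hat_elt (f : dvoa V) (m : int) : hat :=
  qpi (lspan (range loopD)) (pure f (tpow m)).

Definition hat_gr (n : int) : submodClosed hat :=
  lspan [set x | exists s f m, [/\ f \in dvoa_gr V s, s - m - 1 = n & x = hat_elt f m]].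

(* (f ⊗ t^m, g ⊗ t^n) |-> sum_i binom(m, i) (f_i g) ⊗ t^(m + n - i). *)
Definition loop_bracket (x y : loop) : loop :=
  tlift (fun f p => tlift (fun g q =>
    fext (fun m : int => fext (fun n : int =>
      \sum_(i \in [set: nat]) binz K m i *:
         pure (dmode i%:Z f g) (tpow (m + n - i%:Z))) q) p) y) x.

(* The bracket of the classes of x and y is the class of loop_bracket x y. *)
Definition hat_bracket (x y : hat) : hat :=
  qpi (lspan (range loopD)) (loop_bracket (qrepr x) (qrepr y)).

End LieHat.

Section Enveloping.
Variables (K : fieldType) (g : lmodType K) (br : g -> g -> g).

(* The free associative algebra on the set g: combinations of words. *)
Definition words : lmodType K := freemod K (seq g).
Definition word (w : seq g) : words := fbasis K w.

Definition uea_rel : set words :=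
  [set r | (exists u w (a : K) x y,
              r = word (u ++ (a *: x + y) :: w)
                  - (a *: word (u ++ x :: w) + word (u ++ y :: w))) \/
           (exists u w x y,
              r = word (u ++ x :: y :: w) - word (u ++ y :: x :: w)
                  - word (u ++ br x y :: w))].

Definition uea : lmodType K := quotsp (lspan uea_rel).
Definition uea_word (w : seq g) : uea := qpi (lspan uea_rel) (word w).

Definition uea_mul (a b : uea) : uea :=
  fext (fun u => fext (fun w => uea_word (u ++ w)) (qrepr b)) (qrepr a).

End Enveloping.

Section LModule.
Variables (K : fieldType) (V : gvoc K) (M : lmodType K).
Variable DM : {linear M -> tensor (zhuC V) M}.

Local Notation Mdual := (dual M).
Local Notation U := (uea (@hat_bracket K V)).
Local Notation umul := (@uea_mul K (hat V) (@hat_bracket K V)).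
Local Notation uword := (@uea_word K (hat V) (@hat_bracket K V)).

Lemma dual_linear (X : lmodType K) (f : dual X) : linear (subsp_val f).
Proof. by case: f => f /= /asboolP. Qed.

Lemma zhu_act_subproof (f : dual (zhuC V)) (n : Mdual) :
  (fun m => tpair (subsp_val f) (subsp_val n) (DM m)) \in linear_functionals M.
Proof.
by apply/asboolP => a u v; rewrite linearP tpair_linear //; exact: dual_linear.
Qed.

(* (f n)(m) = sum f(m') n(m''). *)
Definition zhu_act (f : dual (zhuC V)) (n : Mdual) : Mdual :=
  Subsp (zhu_act_subproof f n).

(* The relations u x ⊗ n = u ⊗ x n defining the tensor product over the
   enveloping algebra of hat(0) + hat(-), for x in the spanning sets: hat(-)
   acts by 0, and f ⊗ t^(s - 1), with f of weight s, through the class of f in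
   A(V'). *)
Definition ind_rel : set (tensor U Mdual) :=
  [set r | (exists u d x n, [/\ (d < 0)%R, x \in hat_gr V d &
              r = pure (umul u (uword [:: x])) n]) \/
           (exists u s f n, f \in dvoa_gr V s /\
              r = pure (umul u (uword [:: hat_elt f (s - 1)])) n
                  - pure u (zhu_act (zhuPhi (qpi (zhuO V) f)) n))].

(* U(M') with M' = Mdual, the algebraic dual of M. *)
Definition indU : lmodType K := quotsp (lspan ind_rel).

Definition ind_elt (u : U) (n : Mdual) : indU := qpi (lspan ind_rel) (pure u n).

Definition ind_act (u : U) (x : indU) : indU :=
  tlift (fun w n => ind_elt (umul u w) n) (qrepr x).

Definition uea_gr (d : int) : submodClosed U :=
  lspan [set u | exists w : seq (int * hat V),
    [/\ forall p, p \in w -> p.2 \in hat_gr V p.1,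
        \sum_(p <- w) p.1 = d & u = uword (map snd w)]].

Definition ind_gr (d : int) : submodClosed indU :=
  lspan [set x | exists u n, u \in uea_gr d /\ x = ind_elt u n].

(* phi extends the functional e on M^* by zero in positive degrees. *)
Definition extends_by_zero (e : dual Mdual) (phi : dual indU) : Prop :=
  (forall n : Mdual, subsp_val phi (ind_elt (uword [::]) n) = subsp_val e n) /\
  (forall d x, (0 < d)%R -> x \in ind_gr d -> subsp_val phi x = 0).

(* The set below is a subspace; lspan only packages it as such. *)
Definition indJ : submodClosed indU :=
  lspan [set x | forall e phi (u : U), extends_by_zero e phi ->
    subsp_val phi (ind_act u x) = 0].

(* L(M') = U(M') / J. *)
Definition Lst : lmodType K := quotsp indJ.

Definition Lst_gr (t : nat) : submodClosed Lst :=
  lspan (qpi indJ @` [set x | x \in ind_gr t%:Z]).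

Definition Lst_mode (k : int) (f : dvoa V) (n : Lst) : Lst :=
  qpi indJ (ind_act (uword [:: hat_elt f k]) (qrepr n)).

Definition Ldual : lmodType K := rdual Lst_gr.
Definition Ldual_gr (t : nat) : submodClosed Ldual := rdual_gr Lst_gr t.

(* (Y_k x, f ⊗ n) = (x, f_k n). *)
Definition Ldual_coact (k : int) (x : Ldual) : tensor V Ldual :=
  xget 0 [set p | forall (f : dvoa V) (n : Lst),
    tpair (subsp_val f) (fun y : Ldual => subsp_val y n) p
    = subsp_val x (Lst_mode k f n)].

(* The embedding of M in (Lst_0)^* = M^**, extended by zero *)
Definition M_embed (m : M) : Ldual :=
  xget 0 [set x | x \in Ldual_gr 0 /\ forall n : Mdual,
    subsp_val x (qpi indJ (ind_elt (uword [::]) n)) = subsp_val n m].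

Definition subgr (S : submodClosed Ldual) (t : nat) : submodClosed (subsp S) :=
  lspan [set y | subsp_val y \in Ldual_gr t].

(* The restriction of the coaction to S takes values in V ⊗ S and makes S, with
   the induced grading, an admissible comodule. *)
Definition subcomodule (S : submodClosed Ldual) : Prop :=
  exists D : int -> {linear subsp S -> tensor V (subsp S)},
    (forall k y, tmap id (@subsp_val K Ldual S) (D k y) =
                 Ldual_coact k (subsp_val y)) /\
    admissible_comodule D (subgr S).

(* W(M): the intersection of all sub comodules containing M. *)
Definition W_pred : Ldual -> bool := fun x =>
  `[< forall S : submodClosed Ldual, subcomodule S ->
        (forall m, M_embed m \in S) -> x \in S >].

Lemma W_closed : submod_closed W_pred.
Proof.
split; first by apply/asboolP => S _ _; exact: rpred0.
move=> a x y /asboolP hx /asboolP hy; apply/asboolP => S cS mS.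
by rewrite rpredD ?rpredZ ?hx ?hy.
Qed.

HB.instance Definition _ := GRing.isSubmodClosed.Build K Ldual
  W_pred (GRing.submod_closed_semi W_closed).

Definition W : submodClosed Ldual := GRing.SubmodClosed.clone K Ldual W_pred _.

(* The sum of all sub comodules of W(M) meeting M trivially, as a subspace of
   W(M). *)
Definition Jmax : submodClosed (subsp W) :=
  lspan [set y | exists S : submodClosed Ldual,
    [/\ subcomodule S, {subset S <= W},
        forall m, M_embed m \in S -> M_embed m = 0 & subsp_val y \in S]].

Definition LM : lmodType K := quotsp Jmax.

Definition LM_gr (t : nat) : submodClosed LM :=
  lspan (qpi Jmax @` [set y | subsp_val y \in Ldual_gr t]).

Lemma M_embedW m : M_embed m \in W.
Proof. by apply/asboolP => S _; exact. Qed.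

Definition LM_incl (m : M) : LM := qpi Jmax (Subsp (M_embedW m)).

End LModule.

(* Main.v *)
From HB Require Import structures.
Require Import Defs.
From mathcomp Require Import all_boot all_order all_algebra.
From mathcomp Require Import finmap boolp classical_sets functions cardinality fsbigop.
From mathcomp Require Import zify ring.
From mathcomp Require Import reals complex.
Set Implicit Arguments.
Unset Strict Implicit.
Unset Printing Implicit Defensive.
Import Order.TTheory GRing.Theory.
Local Open Scope classical_set_scope.
Local Open Scope ring_scope.

Import Num.Theory.

(** Let [N] be the dual of [M], [L = L(N) = U(N)/J], and [f_k] the modes of [V'] on
    [L]. All the spaces involved are generated by words of modes, which makes them
    explicit enough for the two claims.

    The pairing of [V'] with [V] turns the Jacobi identity of the coalgebra into the
    Borcherds identity [borcherds] for the modes on [V'] ([dmode_borcherds]). The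
    modes span a graded Lie algebra acting on the induced module [U(N)]. The
    recursion [project] computes the degree-zero component of a word of modes
    applied to an element of [N]: a letter of positive degree in front contributes
    nothing, one of degree zero acts on [N], and one of negative degree is moved to
    the right by brackets. It is compatible with the bracket ([project_bracket]),
    and [J] is the set of the vectors all of whose descendants project to zero
    ([indJP]).

    On [L] the construction provides the commutator formula, and the full Borcherds
    identity has to be derived. By [borcherds_extension] this can be done from the
    degree-zero part alone, because that part generates and no nonzero vector of [L]
    is invisible from it; what is needed there is that zero modes compose through
    the product of the Zhu algebra, which follows from the coassociativity of [M]
    and the vanishing of [O(V')] on [C(V)] ([zero_mode_mul], [zero_mode_vanish]).

    Consequently every graded subspace of the restricted dual of [L] that is stable
    under the transposed modes is a sub comodule ([stable_subcomodule]): finite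
    bases of the weight spaces provide the coaction, and its axioms are the
    transposes of the module identities. Conversely sub comodules are stable
    ([subcomodule_stable]). Hence [W(M)] is spanned by the words of transposed modes
    applied to [M]. Each weight space of [V'] being finite-dimensional and [M]
    having a countable basis, countably many words suffice, so [W(M)] and its
    quotient by the maximal sub comodule avoiding [M] have countable dimension.

    For the degree-zero component, pair a word of transposed modes applied to an
    element of [M] with the degree-zero part of [L], which is [N]. The result is a
    projected word, and projected words are built by sums and composites from zero
    modes ([project_ind]). A zero mode is the transpose of an operator on [M],
    namely the coaction of [M] followed by a functional on [C(V)], so the word acts
    on [N] as an element of [M] does: in degree zero, [W(M)] is [M] ([W_degree0])
    and not a larger part of the bidual. A sub comodule of [W(M)] that meets [M]
    trivially is graded, so it has no degree-zero component, and the quotient by the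
    sum of all of these leaves [M] intact. *)

(** * Linear maps and finitely supported sums *)

Section LinearFacts.
Variables (K : fieldType) (U V : lmodType K) (f : U -> V).
Hypothesis lf : linear f.

Lemma linD u v : f (u + v) = f u + f v.
Proof. by have := lf 1 u v; rewrite !scale1r. Qed.

Lemma lin0 : f 0 = 0.
Proof. by apply: (@addrI _ (f 0)); rewrite -linD !addr0. Qed.

Lemma linZ a u : f (a *: u) = a *: f u.
Proof. by have := lf a u 0; rewrite lin0 !addr0. Qed.

Lemma linN u : f (- u) = - f u.
Proof. by rewrite -scaleN1r linZ scaleN1r. Qed.

Lemma linB u v : f (u - v) = f u - f v.
Proof. by rewrite linD linN. Qed.

Lemma lin_sum (I : Type) (r : seq I) (P : pred I) (F : I -> U) :
  f (\sum_(i <- r | P i) F i) = \sum_(i <- r | P i) f (F i).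
Proof. exact: (big_morph f linD lin0). Qed.

End LinearFacts.

Section NatSums.
Variable K : fieldType.

Definition eventually0 (X : lmodType K) (F : nat -> X) : Prop :=
  exists N, forall i, (N <= i)%N -> F i = 0.

Definition nsum (X : lmodType K) (F : nat -> X) : X := \sum_(i \in [set: nat]) F i.

Lemma nsumE (X : lmodType K) N (F : nat -> X) :
  (forall i, (N <= i)%N -> F i = 0) -> nsum F = \sum_(i < N) F i.
Proof.
move=> F0; rewrite /nsum -(@fsbig_widen _ _ _ _ [set` iota 0 N] [set: nat]) //.
  by rewrite -fsbig_seq ?iota_uniq// -(big_mkord xpredT) /index_iota subn0.
move=> i /= [_ iN]; apply: F0; rewrite leqNgt; apply/negP => ltiN.
by apply: iN; rewrite /= mem_iota.
Qed.

Variable X : lmodType K.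
Implicit Types F G : nat -> X.

Lemma eventually0_le N F M : (N <= M)%N -> (forall i, (N <= i)%N -> F i = 0) ->
  forall i, (M <= i)%N -> F i = 0.
Proof. by move=> NM H i Mi; apply: H; apply: leq_trans NM Mi. Qed.

Lemma eventually0D F G : eventually0 F -> eventually0 G ->
  eventually0 (fun i => F i + G i).
Proof.
move=> [N HF] [M HG]; exists (maxn N M) => i; rewrite geq_max => /andP[Ni Mi].
by rewrite HF ?HG ?addr0.
Qed.

Lemma eventually0_lin (Y : lmodType K) (f : X -> Y) F : linear f -> eventually0 F ->
  eventually0 (fun i => f (F i)).
Proof. by move=> lf [N HF]; exists N => i Ni; rewrite HF ?(lin0 lf). Qed.

Lemma eventually0Z (a : nat -> K) F : eventually0 F -> eventually0 (fun i => a i *: F i).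
Proof. by move=> [N HF]; exists N => i Ni; rewrite HF // scaler0. Qed.

Lemma eventually0_shift F : eventually0 F -> eventually0 (fun i => F i.+1).
Proof. by move=> [N HF]; exists N => i Ni; rewrite HF // leqW. Qed.

Lemma eq_nsum F G : F =1 G -> nsum F = nsum G.
Proof. by move=> /funext ->. Qed.

Lemma nsum0 : nsum (fun _ => 0 : X) = 0.
Proof. by rewrite (@nsumE _ 0) ?big_ord0. Qed.

Lemma nsumD F G : eventually0 F -> eventually0 G ->
  nsum (fun i => F i + G i) = nsum F + nsum G.
Proof.
move=> [N HF] [M HG].
have lN := leq_maxl N M; have lM := leq_maxr N M.
rewrite !(@nsumE _ (maxn N M)) ?big_split //; do ?exact: (eventually0_le lN);
  do ?exact: (eventually0_le lM).
by move=> i; rewrite geq_max => /andP[Ni Mi]; rewrite HF ?HG ?addr0.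
Qed.

Lemma nsum_lin (Y : lmodType K) (f : X -> Y) F : linear f -> eventually0 F ->
  f (nsum F) = nsum (fun i => f (F i)).
Proof.
move=> lf [N HF]; rewrite !(@nsumE _ N) ?lin_sum // => i Ni.
by rewrite HF // (lin0 lf).
Qed.

Lemma nsumZ a F : eventually0 F -> nsum (fun i => a *: F i) = a *: nsum F.
Proof.
move=> eF; have la : linear (fun x : X => a *: x).
  by move=> b u v; rewrite scalerDr !scalerA mulrC.
by rewrite (nsum_lin la).
Qed.

Lemma nsumN F : eventually0 F -> nsum (fun i => - F i) = - nsum F.
Proof.
by move=> eF; rewrite -scaleN1r -nsumZ //; apply: eq_nsum => i; rewrite scaleN1r.
Qed.

Lemma eventually0N F : eventually0 F -> eventually0 (fun i => - F i).
Proof. by move=> [N HF]; exists N => i /HF ->; rewrite oppr0. Qed.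

Lemma nsumB F G : eventually0 F -> eventually0 G ->
  nsum (fun i => F i - G i) = nsum F - nsum G.
Proof. by move=> eF eG; rewrite nsumD ?nsumN //; apply: eventually0N. Qed.

Lemma nsum_recl F : eventually0 F -> nsum F = F 0%N + nsum (fun i => F i.+1).
Proof.
move=> [N HF]; rewrite (@nsumE _ N.+1); last by apply: eventually0_le HF.
rewrite big_ord_recl (@nsumE _ N) // => i Ni; exact/HF/leqW.
Qed.

Lemma nsum1 F : (forall i, (0 < i)%N -> F i = 0) -> nsum F = F 0%N.
Proof. by move=> F0; rewrite (@nsumE _ 1) // big_ord1. Qed.

Lemma nsum_sum (I : Type) (r : seq I) (F : I -> nat -> X) :
  (forall i, eventually0 (F i)) ->
  nsum (fun k => \sum_(i <- r) F i k) = \sum_(i <- r) nsum (F i).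
Proof.
move=> eF; elim: r => [|i r IH].
  by rewrite big_nil -[RHS]nsum0; apply: eq_nsum => k; rewrite big_nil.
rewrite big_cons -IH -nsumD //; first by apply: eq_nsum => k; rewrite big_cons.
elim: r {IH} => [|j r IH]; first by exists 0%N => k _; rewrite big_nil.
have [N HN] := eventually0D (eF j) IH.
by exists N => k Nk; rewrite big_cons HN.
Qed.

Definition bounded2 (F : nat -> nat -> X) : Prop :=
  exists N, forall i j, (N <= i)%N || (N <= j)%N -> F i j = 0.

Lemma nsum2E N (F : nat -> nat -> X) :
  (forall i j, (N <= i)%N || (N <= j)%N -> F i j = 0) ->
  nsum (fun i => nsum (F i)) = \sum_(i < N) \sum_(j < N) F i j.
Proof.
move=> HF; rewrite (@nsumE _ N) => [|i Ni].
  by apply: eq_bigr => i _; rewrite (@nsumE _ N) // => j Nj; rewrite HF // Nj orbT.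
by rewrite -[RHS]nsum0; apply: eq_nsum => j; rewrite HF // Ni.
Qed.

Lemma exchange_nsum (F : nat -> nat -> X) : bounded2 F ->
  nsum (fun i => nsum (F i)) = nsum (fun j => nsum (fun i => F i j)).
Proof.
move=> [N HF]; rewrite !(@nsum2E N) //; first exact: exchange_big.
by move=> i j ij; apply: HF; rewrite orbC.
Qed.

Lemma bounded2_inner (F : nat -> nat -> X) i : bounded2 F -> eventually0 (F i).
Proof. by move=> [N HN]; exists N => j Nj; rewrite HN // Nj orbT. Qed.

Lemma bounded2_outer (F : nat -> nat -> X) : bounded2 F -> eventually0 (fun i => nsum (F i)).
Proof.
move=> [N HN]; exists N => i Ni; rewrite -[RHS]nsum0.
by apply: eq_nsum => j; rewrite HN // Ni.
Qed.

(** Double sums over two modes are regrouped by the total mode, where the binomial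
    identities apply. *)
Lemma nsum_antidiag (G : nat -> nat -> X) : bounded2 G ->
  nsum (fun r => \sum_(p < r.+1) G p (r - p)%N) = nsum (fun p => nsum (G p)).
Proof.
move=> [N HG]; rewrite (@nsum2E N) // (@nsumE _ (N + N)) => [|r Nr]; last first.
  apply: big1 => p _; apply: HG; case: leqP => //= pN.
  by rewrite leq_subRL ?leq_ord // (leq_trans _ Nr) // leq_add2r ltnW.
pose H p r := if (p <= r)%N then G p (r - p)%N else 0.
transitivity (\sum_(r < N + N) \sum_(p < N + N) H p r).
  apply: eq_bigr => r _; rewrite (big_ord_widen (N + N)%N (fun p => G p (r - p)%N)) //.
  by rewrite big_mkcond; apply: eq_bigr => p _; rewrite /H ltnS.
rewrite exchange_big /= big_split_ord /= [X in _ + X]big1 ?addr0 => [|p _]; last first.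
  by apply: big1 => r _; rewrite /H; case: ifP => // _; apply: HG; rewrite leq_addr.
apply: eq_bigr => p _.
have -> : \sum_(r < N + N) H p r = nsum (H p).
  rewrite (@nsumE _ (N + N)) // => r Nr; rewrite /H; case: ifP => // pr.
  by apply: HG; rewrite leq_subRL // (leq_trans _ Nr) ?orbT // leq_add2r ltnW.
have -> : \sum_(q < N) G p q = nsum (G p).
  by rewrite (@nsumE _ N) // => q Nq; rewrite HG // Nq orbT.
have -> : G p = fun q => H p (p + q)%N.
  by apply/funext => q; rewrite /H leq_addr addKn.
have Hp0 r : (r < p)%N -> H p r = 0 by rewrite /H ltnNge => /negbTE ->.
have eH : eventually0 (H p).
  exists (p + N)%N => r Nr; rewrite /H (leq_trans _ Nr) ?leq_addr //.
  by apply: HG; rewrite leq_subRL ?Nr ?orbT // (leq_trans _ Nr) ?leq_addr.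
clear - Hp0 eH; move: (H p) Hp0 eH => F; move: (nat_of_ord p) => {}p.
elim: p F => [|p IH] F F0 eF //.
rewrite nsum_recl // F0 // add0r (IH (fun r => F r.+1)) //.
  by move=> r rp; apply: F0.
exact: eventually0_shift.
Qed.

End NatSums.

(** * Generalized binomial coefficients *)

Section Binomials.
Variable K : fieldType.
Hypothesis char0 : forall n, n.+1%:R != 0 :> K.
Local Notation binz := (@binz K).

Lemma fact_neq0 n : n`!%:R != 0 :> K.
Proof. by have := fact_gt0 n; case: (n`!). Qed.

Lemma intr_neq0 (n : int) : n != 0 -> n%:~R != 0 :> K.
Proof.
case: n => [[|n]|n] // _; first exact: char0.
by rewrite NegzE rmorphN oppr_eq0; exact: char0.
Qed.

Lemma binz_0 n : binz n 0 = 1.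
Proof. by rewrite /Defs.binz big_ord0 fact0 divr1. Qed.

Lemma binz_step n i : i.+1%:R * binz n i.+1 = (n - i%:Z)%:~R * binz n i.
Proof.
rewrite /Defs.binz big_ord_recr /= factS natrM invfM.
by have i0 := char0 i; have f0 := fact_neq0 i; field; rewrite f0 nat1r i0.
Qed.

Lemma binz_absorb n i : i.+1%:R * binz n i.+1 = n%:~R * binz (n - 1) i.
Proof.
rewrite /Defs.binz big_ord_recl /= factS natrM invfM subr0.
rewrite (eq_bigr (fun j : 'I_i => (n - 1 - j%:Z)%:~R)) => [|j _]; last first.
  by congr (_%:~R); rewrite /bump /=; lia.
by have i0 := char0 i; have f0 := fact_neq0 i; field; rewrite f0 nat1r i0.
Qed.

Lemma binz_pascal n i : binz (n + 1) i.+1 = binz n i.+1 + binz n i.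
Proof.
apply: (mulfI (char0 i)); rewrite binz_absorb addrK mulrDr binz_step.
by rewrite -mulrDl -natr1 !rmorphB !rmorphD /=; ring.
Qed.

Lemma binz0S i : binz 0 i.+1 = 0.
Proof. by rewrite /Defs.binz big_ord_recl /= subr0 mul0r mul0r. Qed.

Lemma binzN1 i : binz (-1) i = (-1) ^+ i.
Proof.
elim: i => [|i IH]; first by rewrite binz_0.
have := binz_pascal (-1) i; rewrite addNr binz0S => /esym/eqP.
by rewrite addr_eq0 IH exprS mulN1r => /eqP.
Qed.

Lemma binz_nat_eq0 (j p : nat) : (j < p)%N -> binz j%:Z p = 0.
Proof.
move=> jp; rewrite /Defs.binz (bigD1 (Ordinal jp)) //= subrr.
by rewrite mulr0z !mul0r.
Qed.

(** Pascal's rule propagates from the row [0] upwards by induction on [n], and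
    downwards by solving it for the lower row. *)
Lemma pascal_unique (F G : int -> nat -> K) :
  (forall n r, F (n + 1) r.+1 = F n r.+1 + F n r) ->
  (forall n r, G (n + 1) r.+1 = G n r.+1 + G n r) ->
  (forall n, F n 0%N = G n 0%N) -> (forall r, F 0 r = G 0 r) ->
  forall n r, F n r = G n r.
Proof.
move=> PF PG F0 FG; case=> n.
  elim: n => [|n IH] [|r] //.
  by rewrite (_ : Posz n.+1 = n%:Z + 1) ?PF ?PG ?IH //; lia.
rewrite NegzE; elim: n => [|n IH]; elim=> [|r IHr] //.
  have := PF (-1) r; rewrite addNr FG IHr => /eqP; rewrite -subr_eq => /eqP <-.
  by rewrite -[X in G X _](addNr 1) PG addrK.
have := PF (- n.+2%:Z) r; rewrite (_ : - n.+2%:Z + 1 = - n.+1%:Z); last lia.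
rewrite IHr IH => /eqP; rewrite -subr_eq => /eqP <-.
by rewrite (_ : - n.+1%:Z = - n.+2%:Z + 1) ?PG ?addrK //; lia.
Qed.

Lemma binz_vandermonde m n r :
  \sum_(j < r.+1) binz m j * binz n (r - j)%N = binz (m + n) r.
Proof.
apply: (@pascal_unique (fun m r => \sum_(j < r.+1) binz m j * binz n (r - j)%N)
  (fun m => binz (m + n))) => [{}m {}r|{}m {}r|{}m|{}r].
- rewrite big_ord_recl [X in _ = X + _]big_ord_recl /= !binz_0 -addrA; congr (_ + _).
  rewrite -big_split /=; apply: eq_bigr => j _; rewrite /bump /= add1n subSS.
  by rewrite binz_pascal mulrDl.
- by rewrite addrAC binz_pascal.
- by rewrite big_ord1 !binz_0 mul1r.
rewrite big_ord_recl big1 ?addr0 ?binz_0 ?mul1r ?add0r ?subn0 // => j _.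
by rewrite /bump /= binz0S mul0r.
Qed.

Lemma binz_neg n i : binz (- n) i = (-1) ^+ i * binz (n + i%:Z - 1) i.
Proof.
rewrite /Defs.binz mulrA; congr (_ / _).
rewrite (reindex_inj rev_ord_inj) /=.
rewrite -[in (-1) ^+ i](card_ord i) -prodr_const -big_split /=.
apply: eq_bigr => j _; rewrite mulN1r -rmorphN; congr (_%:~R).
by have := ltn_ord j; lia.
Qed.

(** Negating the upper index absorbs the signs and turns the sum into a
    Vandermonde sum. It governs the skew-symmetry of the bracket on modes. *)
Lemma binz_alternating n m r :
  \sum_(j < r.+1) (-1) ^+ j * binz n j * binz (m + n - j%:Z) (r - j)%N = binz m r.
Proof.
have -> : \sum_(j < r.+1) (-1) ^+ j * binz n j * binz (m + n - j%:Z) (r - j)%N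
    = (-1) ^+ r * \sum_(j < r.+1) binz n j * binz (r%:Z - 1 - m - n) (r - j)%N.
  rewrite mulr_sumr; apply: eq_bigr => j _.
  have jr : (j <= r)%N by rewrite -ltnS.
  rewrite -[m + n - j%:Z]opprK binz_neg.
  rewrite (_ : - (m + n - j%:Z) + (r - j)%N%:Z - 1 = r%:Z - 1 - m - n); last first.
    by rewrite -subzn //; lia.
  move: (binz _ (r - j)) (binz n j) => A B.
  by rewrite mulrACA mulrA -mulrA -exprD subnKC // mulrA.
rewrite binz_vandermonde (_ : n + _ = - (m - r%:Z + 1)); last lia.
rewrite binz_neg mulrA -expr2 sqrr_sign mul1r; congr (binz _ _); lia.
Qed.

Lemma binz_trinomial k (p q : nat) :
  binz k (p + q)%N * binz (p + q)%N%:Z p = binz k p * binz (k - p%:Z) q.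
Proof.
have Hpq : binz (p + q)%N%:Z p = (p + q)`!%:R / (p`!%:R * q`!%:R).
  rewrite /Defs.binz invfM [RHS]mulrA [RHS]mulrAC; congr (_ / _).
  apply: (mulIf (fact_neq0 q)); rewrite divfK ?fact_neq0 //.
  rewrite -(@ffact_fact (p + q) p) ?leq_addr // addKn natrM; congr (_ * _).
  rewrite ffact_prod natr_prod; apply: eq_bigr => j _.
  by rewrite subzn //; have := ltn_ord j; lia.
rewrite Hpq /Defs.binz big_split_ord /=.
under [X in _ * X / _ * _]eq_bigr do rewrite PoszD opprD addrA.
have := fact_neq0 p; have := fact_neq0 q; have := fact_neq0 (p + q).
by move=> ? ? ?; field; do ?[apply/andP; split].
Qed.

End Binomials.

Section Convolution.
Variable K : fieldType.
Hypothesis char0 : forall n, n.+1%:R != 0 :> K.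
Variable X : lmodType K.

(** The common combinatorial core of the Jacobi identity for modes, of the
    derivation property of modes, and of the stability of the Borcherds identity
    under commutators with modes: rearrange by the trinomial identity, then sum
    along antidiagonals by Vandermonde. *)
Lemma binz_convolution (k m : int) (F : nat -> nat -> X) : bounded2 F ->
  nsum (fun j => binz K k j *: nsum (fun i => binz K m i *:
     nsum (fun p => binz K j%:Z p *: F p (i + (j - p))%N)))
  = nsum (fun p => binz K k p *: nsum (fun r => binz K (k - p%:Z + m) r *: F p r)).
Proof.
move=> [N HF].
have F0 p r : (N <= p)%N || (N <= r)%N -> F p r = 0 by exact: HF.
pose G p q := nsum (fun i => (binz K k p * binz K (k - p%:Z) q * binz K m i) *: F p (i + q)%N).
have eG : bounded2 G.
  exists N => p q pq; rewrite /G -[RHS](@nsum0 K X); apply: eq_nsum => i.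
  by rewrite F0 ?scaler0 //; lia.
transitivity (nsum (fun r => \sum_(p < r.+1) G p (r - p)%N)).
  apply: eq_nsum => j; rewrite -nsumZ; last first.
    exists N => i Ni; rewrite -[nsum _](_ : 0 = _) ?scaler0 //.
    rewrite -[LHS](@nsum0 K X); apply: eq_nsum => p.
    by rewrite F0 ?scaler0 //; lia.
  rewrite -nsum_sum => [|p]; last first.
    by exists N => i Ni; rewrite F0 ?scaler0 //; lia.
  apply: eq_nsum => i; rewrite (@nsumE _ _ j.+1) => [|p jp]; last first.
    by rewrite (binz_nat_eq0 _ jp) scale0r.
  rewrite !scaler_sumr; apply: eq_bigr => p _; rewrite !scalerA; congr (_ *: _).
  have pj : (p <= j)%N by rewrite -ltnS.
  by rewrite -(binz_trinomial char0) subnKC // [RHS]mulrAC -mulrA.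
rewrite nsum_antidiag //; apply: eq_nsum => p; rewrite /G.
have bF : bounded2 (fun q i =>
   (binz K k p * binz K (k - p%:Z) q * binz K m i) *: F p (q + i)%N).
  by exists N => q i qi; rewrite F0 ?scaler0 //; lia.
transitivity (nsum (fun r => binz K k p *: (binz K (k - p%:Z + m) r *: F p r))); last first.
  by apply: nsumZ; exists N => r Nr; rewrite F0 ?scaler0 // Nr orbT.
transitivity (nsum (fun q => nsum (fun i =>
   (binz K k p * binz K (k - p%:Z) q * binz K m i) *: F p (q + i)%N))).
  by apply: eq_nsum => q; apply: eq_nsum => i; rewrite addnC.
rewrite -nsum_antidiag //; apply: eq_nsum => r.
rewrite -(binz_vandermonde char0) scaler_suml scaler_sumr; apply: eq_bigr => q _.
by rewrite scalerA mulrA subnKC // -ltnS.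
Qed.

End Convolution.

(** * Spans and tensor products *)

Section Spans.
Variables (K : fieldType) (V : lmodType K).

Lemma lspan_elim (A : set V) (P : V -> Prop) : P 0 ->
  (forall a u v, A u -> P v -> P (a *: u + v)) -> forall v, v \in lspan A -> P v.
Proof.
move=> P0 PS v /asboolP[s sA ->]; elim: s sA => [|p s IH] sA; first by rewrite big_nil.
rewrite big_cons; apply: PS; first by apply: sA; rewrite mem_head.
by apply: IH => q qs; apply: sA; rewrite inE qs orbT.
Qed.

Lemma lspan_le (A : set V) (S : submodClosed V) :
  (forall v, A v -> v \in S) -> {subset lspan A <= S}.
Proof. by move=> AS v; exact: lspan_ind. Qed.

Lemma lspan_lin (W : lmodType K) (f : V -> W) (A : set V) (B : set W) :
  linear f -> (forall v, A v -> f v \in lspan B) ->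
  forall v, v \in lspan A -> f v \in lspan B.
Proof.
move=> lf AB; apply: lspan_elim => [|a u v /AB fu fv]; first by rewrite (lin0 lf) rpred0.
by rewrite lf rpredD // rpredZ.
Qed.

Lemma lspan_eq0 (W : lmodType K) (f : V -> W) (A : set V) :
  linear f -> (forall v, A v -> f v = 0) -> forall v, v \in lspan A -> f v = 0.
Proof.
move=> lf A0; apply: lspan_elim => [|a u v /A0 fu fv]; first exact: lin0.
by rewrite lf fu fv scaler0 addr0.
Qed.

Lemma lspan_ext (W : lmodType K) (f h : V -> W) (A : set V) : linear f -> linear h ->
  (forall v, A v -> f v = h v) -> forall v, v \in lspan A -> f v = h v.
Proof.
move=> lf lh fh; apply: lspan_elim => [|a u v /fh e IH]; first by rewrite !lin0.
by rewrite lf lh e IH.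
Qed.

Lemma submodB (S : submodClosed V) u v : u \in S -> v \in S -> u - v \in S.
Proof. exact: lspan_rpredB. Qed.

(** Induction on a spanning list: the new vector either lies in the span of the
    others or supplies one more coordinate. The functionals need only be linear on
    the subspace. *)
Lemma findim_dual_basis (S : submodClosed V) : findim S ->
  exists (n : nat) (e : nat -> V) (phi : nat -> V -> K),
  [/\ forall i, (i < n)%N -> e i \in S,
      forall i a u v, u \in S -> v \in S -> phi i (a *: u + v) = a * phi i u + phi i v &
      forall v, v \in S -> v = \sum_(i < n) phi i v *: e i].
Proof.
move=> [s]; elim: s S => [|x s IH] S Ss.
  exists 0%N, (fun _ => 0), (fun _ _ => 0); split=> //.
    by move=> *; rewrite mulr0 addr0.
  move=> v; rewrite Ss big_ord0; by move: v; apply: lspan_elim.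
set S' := lspan [set v | v \in s].
have S'S : {subset S' <= S}.
  apply: lspan_le => v /= vs; rewrite Ss; apply: mem_lspan => /=.
  by rewrite inE vs orbT.
have xS : x \in S by rewrite Ss; apply: mem_lspan => /=; rewrite mem_head.
have [n [e [phi [eS lphi phiE]]]] := IH S' (fun=> erefl).
have decomp v : v \in S -> exists a, v - a *: x \in S'.
  rewrite Ss; move: v; apply: lspan_elim => [|a u v /=].
    by exists 0; rewrite scale0r subr0 rpred0.
  rewrite inE => /orP[/eqP ->|us] [b vb].
    by exists (a + b); rewrite scalerDl opprD addrACA subrr add0r.
  exists b; rewrite -addrA rpredD // rpredZ //; exact: mem_lspan.
have [xS'|xS'] := pselect (x \in S').
  have SS' v : v \in S -> v \in S'.
    by move=> /decomp[a va]; rewrite -(subrK (a *: x) v) rpredD // rpredZ.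
  exists n, e, phi; split=> [i /eS/S'S //|i a u v /SS' uS /SS'|v /SS'] //.
    exact: lphi.
  exact: phiE.
pose alpha v := xget 0 [set a : K | v - a *: x \in S'].
have alphaP v : v \in S -> v - alpha v *: x \in S'.
  by move=> /decomp[a va]; exact: (@xgetI _ 0 [set a : K | v - a *: x \in S'] a va).
have alphaU v a : v \in S -> v - a *: x \in S' -> alpha v = a.
  move=> vS va; apply/eqP; rewrite -subr_eq0; apply/negPn/negP => ne0.
  apply: xS'; rewrite -(scalerK ne0 x) rpredZ //.
  have := submodB va (alphaP v vS).
  by rewrite opprB addrC addrA subrK -scalerBl.
have lalpha a u v : u \in S -> v \in S -> alpha (a *: u + v) = a * alpha u + alpha v.
  move=> uS vS; apply: alphaU; first by rewrite rpredD // rpredZ.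
  rewrite scalerDl -scalerA opprD addrACA -scalerBr rpredD // ?rpredZ //; exact: alphaP.
exists n.+1, (fun i => if (i < n)%N then e i else x),
  (fun i v => if (i < n)%N then phi i (v - alpha v *: x) else alpha v); split.
- by move=> i _; case: ifP => // /eS/S'S.
- move=> i a u v uS vS; case: ifP => _; last exact: lalpha.
  rewrite lalpha // -lphi; try exact: alphaP.
  by rewrite scalerDl -scalerA opprD addrACA -scalerBr.
move=> v vS; rewrite big_ord_recr /= ltnn.
rewrite (eq_bigr (fun i : 'I_n => phi i (v - alpha v *: x) *: e i)) => [|i _].
  by rewrite -phiE ?subrK //; exact: alphaP.
by rewrite ltn_ord.
Qed.

End Spans.

Lemma freemod_span (K : fieldType) (T : choiceType) (x : freemod K T) :
  x \in lspan (range (@fbasis K T)).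
Proof.
have [A xA] : exists A : {fset T}, [set t | subsp_val x t != 0] `<=` [set` A].
  case: x => f /= /asboolP/finite_fsetP[A eA]; exists A; rewrite eA; exact: subset_refl.
have -> : x = fext (@fbasis K T) x.
  rewrite (fextE _ xA); apply: val_inj; apply/funext => t /=.
  have -> : \val (\sum_(u <- A) (subsp_val x u : K) *: fbasis K u) t =
     \sum_(u <- A) subsp_val x u * (if t == u then 1 else 0).
    elim/big_rec2: _ => // u a b _ ab.
    transitivity (subsp_val x u * subsp_val (fbasis K u) t + a) => //.
    by rewrite -ab.
  have [tA|tA] := boolP (t \in A).
    rewrite (big_fsetD1 t) //= eqxx mulr1 big_seq big1 ?addr0 // => u.
    by rewrite !inE => /andP[ut _]; rewrite eq_sym (negbTE ut) mulr0.
  rewrite big_seq big1 => [|u uA]; last first.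
    by case: eqP => [tu|_]; rewrite ?mulr0 // -tu (negbTE tA) in uA *.
  by apply/eqP; apply: contraNT tA => /xA.
rewrite (fextE _ xA); apply: rpred_sum => t _; apply: rpredZ; apply: mem_lspan.
by exists t.
Qed.

Section TensorFacts.
Variable K : fieldType.
Implicit Types U V W X : lmodType K.

Lemma pureDl V W (v v' : V) (w : W) : pure (v + v') w = pure v w + pure v' w.
Proof. by rewrite (linD ((bilin_pure V W).1 w)). Qed.
Lemma pureDr V W (v : V) (w w' : W) : pure v (w + w') = pure v w + pure v w'.
Proof. by rewrite (linD ((bilin_pure V W).2 v)). Qed.
Lemma pureZl V W a (v : V) (w : W) : pure (a *: v) w = a *: pure v w.
Proof. by rewrite (linZ ((bilin_pure V W).1 w)). Qed.
Lemma pureZr V W a (v : V) (w : W) : pure v (a *: w) = a *: pure v w.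
Proof. by rewrite (linZ ((bilin_pure V W).2 v)). Qed.
Lemma pure0l V W (w : W) : pure (0 : V) w = 0.
Proof. by rewrite (lin0 ((bilin_pure V W).1 w)). Qed.
Lemma pure0r V W (v : V) : pure v (0 : W) = 0.
Proof. by rewrite (lin0 ((bilin_pure V W).2 v)). Qed.

Lemma tensor_elim V W (P : tensor V W -> Prop) : P 0 ->
  (forall v w t, P t -> P (pure v w + t)) -> forall t, P t.
Proof.
move=> P0 PS t; rewrite -[t]qreprK; elim/lspan_elim: (freemod_span (qrepr t)).
  by rewrite (lin0 (@qpi_linear _ _ _)).
by move=> a _ y [[v w] _ <-] Py; rewrite qpi_linear -pureZl; apply: PS.
Qed.

Lemma tensor_sum V W (t : tensor V W) :
  exists (n : nat) (v : nat -> V) (w : nat -> W), t = \sum_(i < n) pure (v i) (w i).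
Proof.
elim/tensor_elim: t => [|v w t [n [a [b ->]]]].
  by exists 0%N, (fun=> 0), (fun=> 0); rewrite big_ord0.
exists n.+1, (fun i => if i is i'.+1 then a i' else v),
  (fun i => if i is i'.+1 then b i' else w); rewrite big_ord_recl /=.
by congr (_ + _); apply: eq_bigr.
Qed.

Lemma tensor_ext V W X (f g : tensor V W -> X) : linear f -> linear g ->
  (forall v w, f (pure v w) = g (pure v w)) -> f =1 g.
Proof.
move=> lf lg fg; elim/tensor_elim => [|v w t IH]; first by rewrite !lin0.
by rewrite (linD lf) (linD lg) fg IH.
Qed.

Lemma lin_comp U V W (g : V -> W) (f : U -> V) : linear g -> linear f ->
  linear (fun x => g (f x)).
Proof. by move=> lg lf a u v; rewrite lf lg. Qed.

Lemma lin_id' V : linear (@id V).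
Proof. by []. Qed.

Lemma lin_linear U V (f : {linear U -> V}) : linear f.
Proof. by move=> a u v; rewrite linearP. Qed.

Lemma bilin_tmap V W X U (f : V -> X) (g : W -> U) : linear f -> linear g ->
  bilin (fun v w => pure (f v) (g w)).
Proof.
move=> lf lg; split=> [w|v] a x y.
  by rewrite lf pureDl pureZl.
by rewrite lg pureDr pureZr.
Qed.

Lemma tmap_linear V W X U (f : V -> X) (g : W -> U) : linear f -> linear g ->
  linear (tmap f g).
Proof. by move=> lf lg; apply/tlift_linear/bilin_tmap. Qed.

Lemma tmap_pure V W X U (f : V -> X) (g : W -> U) v w : linear f -> linear g ->
  tmap f g (pure v w) = pure (f v) (g w).
Proof. by move=> lf lg; rewrite /tmap tlift_pure //; exact: bilin_tmap. Qed.

Lemma bilin_swap V W : bilin (fun (v : V) (w : W) => pure w v).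
Proof.
by split=> [w|v] a x y; rewrite ?pureDl ?pureZl ?pureDr ?pureZr.
Qed.

Lemma tswap_linear V W : linear (@tswap K V W).
Proof. by apply/tlift_linear/bilin_swap. Qed.

Lemma tswap_pure V W (v : V) (w : W) : tswap (pure v w) = pure w v.
Proof. by rewrite /tswap tlift_pure //; exact: bilin_swap. Qed.

Lemma bilin_assoc_in U V W (u : U) : bilin (fun (v : V) (w : W) => pure (pure u v) w).
Proof.
by split=> [w|v] a x y; rewrite ?(pureDl, pureZl, pureDr, pureZr).
Qed.

Lemma bilin_assoc U V W :
  bilin (fun (u : U) => tlift (fun (v : V) (w : W) => pure (pure u v) w)).
Proof.
have h := @bilin_assoc_in U V W.
split=> [t a x y|u]; last exact: tlift_linear.
elim/tensor_elim: t => [|v w t IH]; first by rewrite !(lin0 (tlift_linear _)) // scaler0 addr0.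
rewrite !(linD (tlift_linear _)) // IH !tlift_pure //.
by rewrite !(pureDl, pureZl) scalerDr addrACA.
Qed.

Lemma tassoc_linear U V W : linear (@tassoc K U V W).
Proof. by apply/tlift_linear/bilin_assoc. Qed.

Lemma tassoc_pure U V W (u : U) (v : V) (w : W) :
  tassoc (pure u (pure v w)) = pure (pure u v) w.
Proof.
rewrite /tassoc tlift_pure; last exact: bilin_assoc.
by rewrite tlift_pure //; exact: bilin_assoc_in.
Qed.

Lemma bilin_contrl V W (f : V -> K^o) : linear f -> bilin (fun (v : V) (w : W) => f v *: w).
Proof.
move=> lf; split=> [w|v] a x y; first by rewrite lf scalerDl scalerA.
by rewrite scalerDr !scalerA mulrC.
Qed.

Lemma contrl_linear V W (f : V -> K^o) : linear f -> linear (@contrl K V W f).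
Proof. by move=> lf; apply/tlift_linear/bilin_contrl. Qed.

Lemma contrl_pure V W (f : V -> K^o) (v : V) (w : W) : linear f ->
  contrl f (pure v w) = f v *: w.
Proof. by move=> lf; rewrite /contrl tlift_pure //; exact: bilin_contrl. Qed.

Lemma bilin_contrr V W (f : W -> K^o) : linear f -> bilin (fun (v : V) (w : W) => f w *: v).
Proof.
move=> lf; split=> [w|v] a x y; last by rewrite lf scalerDl scalerA.
by rewrite scalerDr !scalerA mulrC.
Qed.

Lemma contrr_linear V W (f : W -> K^o) : linear f -> linear (@contrr K V W f).
Proof. by move=> lf; apply/tlift_linear/bilin_contrr. Qed.

Lemma contrr_pure V W (f : W -> K^o) (v : V) (w : W) : linear f ->
  contrr f (pure v w) = f w *: v.
Proof. by move=> lf; rewrite /contrr tlift_pure //; exact: bilin_contrr. Qed.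

Lemma tpair_pure V W (f : V -> K^o) (g : W -> K^o) v w : linear f -> linear g ->
  tpair f g (pure v w) = f v * g w.
Proof. by move=> lf lg; rewrite /tpair tlift_pure //; exact: bilin_pair. Qed.

Lemma tpair_contrl V W (f : V -> K^o) (g : W -> K^o) t : linear f -> linear g ->
  tpair f g t = g (contrl f t).
Proof.
move=> lf lg; move: t; apply: tensor_ext => [||v w].
- exact: tpair_linear.
- exact/lin_comp/contrl_linear.
by rewrite tpair_pure // contrl_pure // (linZ lg).
Qed.

Lemma tpair_contrr V W (f : V -> K^o) (g : W -> K^o) t : linear f -> linear g ->
  tpair f g t = f (contrr g t).
Proof.
move=> lf lg; move: t; apply: tensor_ext => [||v w].
- exact: tpair_linear.
- exact/lin_comp/contrr_linear.
by rewrite tpair_pure // contrr_pure // (linZ lf) mulrC.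
Qed.

Lemma tpair_linl V W (f f' : V -> K^o) (g : W -> K^o) a t :
  linear f -> linear f' -> linear g ->
  tpair (fun v => a *: f v + f' v) g t = a *: tpair f g t + tpair f' g t.
Proof.
move=> lf lf' lg; have lff' : linear (fun v => a *: f v + f' v).
  by move=> b u v; rewrite lf lf' !scalerDr !scalerA mulrC addrACA.
move: t; apply: tensor_ext; first exact: tpair_linear.
  move=> b u v; rewrite !tpair_linear // !scalerDr !scalerA mulrC.
  by rewrite addrACA.
by move=> v w; rewrite !tpair_pure // mulrDl -scalerAl.
Qed.

Lemma tpair_linr V W (f : V -> K^o) (g g' : W -> K^o) a t :
  linear f -> linear g -> linear g' ->
  tpair f (fun w => a *: g w + g' w) t = a *: tpair f g t + tpair f g' t.
Proof.
move=> lf lg lg'; have lgg' : linear (fun v => a *: g v + g' v).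
  by move=> b u v; rewrite lg lg' !scalerDr !scalerA mulrC addrACA.
by rewrite !tpair_contrl.
Qed.

Lemma tpair_tmap V W X U (f : X -> K^o) (g : U -> K^o) (p : V -> X) (q : W -> U) t :
  linear f -> linear g -> linear p -> linear q ->
  tpair f g (tmap p q t) = tpair (fun v => f (p v)) (fun w => g (q w)) t.
Proof.
move=> lf lg lp lq; have lfp := lin_comp lf lp; have lgq := lin_comp lg lq.
move: t; apply: tensor_ext.
- exact: lin_comp (tpair_linear lf lg) (tmap_linear lp lq).
- exact: tpair_linear.
by move=> v w; rewrite tmap_pure // !tpair_pure.
Qed.

(** Functionals separating the points of [V] and of [W] separate, through their
    products, the points of the tensor product.  In a sum of pure tensors, either
    the last right factor depends on the others, and the sum can be shortened, or
    every functional kills the last left factor. *)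
Lemma tensor_separation V W (F : set (V -> K^o)) (G : set (W -> K^o)) :
  (forall f, F f -> linear f) -> (forall g, G g -> linear g) ->
  (forall v, (forall f, F f -> f v = 0) -> v = 0) ->
  (forall w, (forall g, G g -> g w = 0) -> w = 0) ->
  forall t, (forall f g, F f -> G g -> tpair f g t = 0) -> t = 0.
Proof.
move=> lF lG sF sG t; have [n [v [w ->]]] := tensor_sum t.
elim: n v {t} => [|n IH] v t0; first by rewrite big_ord0.
have [[c wn]|indep] := pselect (exists c : nat -> K, w n = \sum_(i < n) c i *: w i).
  have e : \sum_(i < n.+1) pure (v i) (w i) = \sum_(i < n) pure (v i + c i *: v n) (w i).
    rewrite big_ord_recr /= wn (lin_sum ((bilin_pure V W).2 _)) -big_split /=.
    by apply: eq_bigr => i _; rewrite pureDl pureZl pureZr.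
  by rewrite e; apply: (IH (fun i => v i + c i *: v n)) => f g Ff Gg; rewrite -e; exact: t0.
have vn0 : v n = 0.
  apply: sF => f Ff; apply: contrapT => fvn; apply: indep.
  have {}fvn : f (v n) != 0 by apply/eqP.
  exists (fun i => - (f (v n))^-1 * f (v i)).
  apply: (scalerI fvn); apply/eqP; rewrite -subr_eq0; apply/eqP.
  apply: sG => g Gg; rewrite -(t0 f g Ff Gg).
  have [lf lg] := (lF _ Ff, lG _ Gg).
  rewrite (lin_sum (tpair_linear lf lg)) big_ord_recr /= tpair_pure // (linB lg).
  rewrite (linZ lg) addrC; congr (_ + _); rewrite (linZ lg) (lin_sum lg).
  rewrite scaler_sumr -sumrN; apply: eq_bigr => i _.
  rewrite tpair_pure // (linZ lg) scalerA -scaleNr mulrA mulrN divff //.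
  by rewrite mulN1r opprK.
rewrite big_ord_recr /= vn0 pure0l addr0; apply: IH => f g Ff Gg.
by rewrite -(t0 f g Ff Gg) big_ord_recr /= vn0 pure0l addr0.
Qed.

(** This lemma and [tpair_swap_assoc] evaluate the three kinds of terms of the
    Jacobi identity on products of functionals, where it becomes the Borcherds
    identity. *)
Lemma tpair_assoc U V W X (f : U -> K^o) (g : V -> K^o) (h : W -> K^o)
    (D : X -> tensor V W) t : linear f -> linear g -> linear h -> linear D ->
  tpair (tpair f g) h (tassoc (tmap id D t)) = tpair f (fun x => tpair g h (D x)) t.
Proof.
move=> lf lg lh lD; have lfg := tpair_linear lf lg; have lgh := tpair_linear lg lh.
have lghD := lin_comp lgh lD.
move: t; apply: tensor_ext.
- apply: lin_comp (tpair_linear lfg lh) _; apply: lin_comp (@tassoc_linear _ _ _) _.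
  exact: tmap_linear.
- exact: tpair_linear.
move=> u x; rewrite tmap_pure // tpair_pure //.
elim/tensor_elim: (D x) => [|v w s IH].
  by rewrite pure0r (lin0 (@tassoc_linear _ _ _)) (lin0 (tpair_linear lfg lh)) (lin0 lgh) mulr0.
rewrite pureDr (linD (@tassoc_linear _ _ _)) (linD (tpair_linear lfg lh)) IH.
rewrite (linD lgh) mulrDr; congr (_ + _).
by rewrite tassoc_pure !tpair_pure // mulrA.
Qed.

Lemma tpair_swap V W (f : W -> K^o) (g : V -> K^o) t : linear f -> linear g ->
  tpair f g (tswap t) = tpair g f t.
Proof.
move=> lf lg; move: t; apply: tensor_ext => [||v w].
- exact: lin_comp (tpair_linear lf lg) (@tswap_linear _ _).
- exact: tpair_linear.
by rewrite tswap_pure !tpair_pure // mulrC.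
Qed.

Lemma tpair_swap_assoc U V W X (f : V -> K^o) (g : U -> K^o) (h : W -> K^o)
    (D : X -> tensor V W) t : linear f -> linear g -> linear h -> linear D ->
  tpair (tpair f g) h (tmap (@tswap K U V) id (tassoc (tmap id D t)))
  = tpair g (fun x => tpair f h (D x)) t.
Proof.
move=> lf lg lh lD; have lfg := tpair_linear lf lg.
rewrite tpair_tmap //; last exact: tswap_linear.
rewrite -tpair_assoc //; congr (tpair _ _ _); apply/funext => s.
by rewrite tpair_swap.
Qed.

End TensorFacts.

(** * Gradings and the dual vertex algebra *)

Section Grading.
Variables (K : fieldType) (V : lmodType K) (I : eqType) (gV : I -> submodClosed V).
Hypothesis ds : direct_sum gV.

Lemma graded_elim (P : V -> Prop) : P 0 ->
  (forall i u v, u \in gV i -> P v -> P (u + v)) -> forall v, P v.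
Proof.
move=> P0 PS v; move: v (ds.1 v); apply: lspan_elim => // a u v [i ui] Pv.
by apply: PS => //; exact: rpredZ ui.
Qed.

Lemma graded_sum v : exists2 A : seq I, uniq A &
  forall B, uniq B -> {subset A <= B} -> v = \sum_(i <- B) hcomp gV i v.
Proof.
elim/graded_elim: v => [|i u v ui [A uA vA]].
  by exists [::] => // B uB _; rewrite big1 // => i _; rewrite (lin0 (hcomp_linear _ ds)).
exists (undup (i :: A)); first exact: undup_uniq.
move=> B uB AB; under eq_bigr do rewrite (linD (hcomp_linear _ ds)).
rewrite big_split /= -(vA B) // => [|j jA]; last by apply: AB; rewrite mem_undup inE jA orbT.
congr (_ + _); rewrite (bigD1_seq i) //= ?hcomp_id //.
  rewrite big1 ?addr0 // => j ji; rewrite (hcomp_other ds _ ui) // => e.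
  by rewrite e eqxx in ji.
by apply: AB; rewrite mem_undup mem_head.
Qed.

Lemma hcomp_mem i v : hcomp gV i v \in gV i.
Proof. by case: (hcompP i v ds). Qed.

Lemma graded_ext (W : lmodType K) (f g : V -> W) : linear f -> linear g ->
  (forall i v, v \in gV i -> f v = g v) -> f =1 g.
Proof.
move=> lf lg fg; elim/graded_elim => [|i u v ui IH]; first by rewrite !lin0.
by rewrite (linD lf) (linD lg) IH (fg i).
Qed.

Lemma hcompE i j v : v \in gV j -> hcomp gV i v = if i == j then v else 0.
Proof.
move=> vj; case: eqP => [->|ij]; first exact: hcomp_id.
by apply: (hcomp_other ds _ vj) => e; exact: ij.
Qed.

End Grading.

Lemma subsp_inj (K : fieldType) (V : lmodType K) (S : submodClosed V) (x y : subsp S) :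
  subsp_val x = subsp_val y -> x = y.
Proof. exact: val_inj. Qed.

Lemma subsp_val_linear (K : fieldType) (V : lmodType K) (S : submodClosed V) :
  linear (@subsp_val K V S).
Proof. by []. Qed.

Section RestrictedDuals.
Variables (K : fieldType) (X : lmodType K) (I : eqType) (gX : I -> submodClosed X).

Lemma rdual_linear (f : rdual gX) : linear (subsp_val f).
Proof. by case: f => f /= /asboolP[]. Qed.

Lemma rdual_support (f : rdual gX) : finite_set (fsupport gX (subsp_val f)).
Proof. by case: f => f /= /asboolP[]. Qed.

Lemma rdual_ext (f g : rdual gX) : subsp_val f =1 subsp_val g -> f = g.
Proof. by move=> fg; apply: subsp_inj; exact/funext. Qed.

Lemma rdual_eval_linear (x : X) : linear (fun f : rdual gX => subsp_val f x : K^o).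
Proof. by []. Qed.

Lemma rdual_grP i (f : rdual gX) :
  reflect (forall j x, j <> i -> x \in gX j -> subsp_val f x = 0) (f \in rdual_gr gX i).
Proof. exact: asboolP. Qed.

End RestrictedDuals.

Section DualGrading.
Variables (K : fieldType) (X : lmodType K) (I : eqType) (gX : I -> submodClosed X).
Hypothesis ds : direct_sum gX.

Lemma rdual_comp_subproof i (f : X -> K^o) : linear f ->
  (fun x => f (hcomp gX i x)) \in restricted_functionals gX.
Proof.
move=> lf; have lh := hcomp_linear i ds; apply/asboolP; split.
  by move=> a u v; rewrite lh lf.
apply: (@sub_finite_set _ _ [set i]); last exact: finite_set1.
move=> j [x xj] /=; rewrite (hcompE ds _ xj); case: (eqVneq i j) => [-> //|_].
by rewrite (lin0 lf) eqxx.
Qed.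

Definition rdual_comp i (f : rdual gX) : rdual gX :=
  Subsp (rdual_comp_subproof i (rdual_linear f)).

Lemma rdual_compP i f : rdual_comp i f \in rdual_gr gX i.
Proof.
apply/rdual_grP => j x ji xj /=; rewrite (hcomp_other ds ji xj).
exact: lin0 (rdual_linear f).
Qed.

Lemma rdual_comp_linear i : linear (rdual_comp i).
Proof. by move=> a f g; apply: subsp_inj. Qed.

Lemma rdual_comp_id i j f : f \in rdual_gr gX j ->
  rdual_comp i f = if i == j then f else 0.
Proof.
move=> /rdual_grP fj; apply: rdual_ext; apply: (graded_ext ds (rdual_linear _)).
  exact: rdual_linear.
move=> k x xk /=; rewrite (hcompE ds _ xk).
have [ij|/eqP ij] := eqVneq i j.
  case: eqP => // ik; rewrite (lin0 (rdual_linear f)) (fj k x) //.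
  by move=> kj; apply: ik; rewrite kj.
case: eqP => [ik|_]; last exact: (lin0 (rdual_linear f)).
by rewrite (fj k x) // -ik.
Qed.

Lemma rdual_elim (P : rdual gX -> Prop) : P 0 ->
  (forall i f g, f \in rdual_gr gX i -> P g -> P (f + g)) -> forall f, P f.
Proof.
move=> P0 PS f; have /finite_seqP[A0 eA] := rdual_support f.
pose A := undup A0.
have memA i x : x \in gX i -> i \notin A -> subsp_val f x = 0.
  move=> xi; rewrite mem_undup => iA; apply/eqP; apply: contraNT iA => fx.
  have : fsupport gX (subsp_val f) i by exists x.
  by rewrite eA.
have -> : f = \sum_(i <- A) rdual_comp i f.
  apply: rdual_ext; apply: (graded_ext ds (rdual_linear _) (rdual_linear _)) => j x xj.
  rewrite (lin_sum (rdual_eval_linear x)) /=.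
  have [jA|jA] := boolP (j \in A).
    rewrite (bigD1_seq j) ?undup_uniq //= (hcompE ds _ xj) eqxx big1 ?addr0 // => i ij.
    by rewrite (hcompE ds _ xj) (negbTE ij) (lin0 (rdual_linear f)).
  rewrite (memA j x) // big_seq big1 // => i iA.
  rewrite (hcompE ds _ xj); case: eqP => [ij|_]; last exact: (lin0 (rdual_linear f)).
  by rewrite -ij iA in jA.
elim: A {memA} => [|i A IH]; first by rewrite big_nil.
by rewrite big_cons; apply: PS => //; exact: rdual_compP.
Qed.

Lemma rdual_extg (W : lmodType K) (p q : rdual gX -> W) : linear p -> linear q ->
  (forall i f, f \in rdual_gr gX i -> p f = q f) -> p =1 q.
Proof.
move=> lp lq pq; elim/rdual_elim => [|i f g fi IH]; first by rewrite !lin0.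
by rewrite (linD lp) (linD lq) IH (pq i).
Qed.

End DualGrading.

Lemma eventually0_int (K : fieldType) (X : lmodType K) (F : int -> X) (N m : int) :
  (forall k, (N <= k)%R -> F k = 0) -> eventually0 (fun i => F (m + i%:Z)).
Proof. by move=> F0; exists `|N - m|%N => i Ni; apply: F0; lia. Qed.

Section Borcherds.
Variables (K : fieldType) (A X : lmodType K).
Variables (md : int -> A -> A -> A) (act : int -> A -> X -> X).

(** The difference of the two sides of the Borcherds identity, the component form
    of the Jacobi identity. *)
Definition borcherds (l m n : int) (a b : A) (x : X) : X :=
  nsum (fun i => ((-1) ^+ i * binz K l i) *: act (l + m - i%:Z) a (act (n + i%:Z) b x))
  - nsum (fun i => ((-1) ^ l * (-1) ^+ i * binz K l i) *:
        act (l + n - i%:Z) b (act (m + i%:Z) a x))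
  - nsum (fun i => binz K m i *: act (m + n - i%:Z) (md (l + i%:Z) a b) x).

Lemma borcherds_commutator m n a b x : borcherds 0 m n a b x =
  act m a (act n b x) - act n b (act m a x)
  - nsum (fun i => binz K m i *: act (m + n - i%:Z) (md i%:Z a b) x).
Proof.
rewrite /borcherds; congr (_ - _ - _).
- rewrite nsum1 => [|[|i] // _]; last by rewrite binz0S mulr0 scale0r.
  by rewrite binz_0 expr0 mulr1 scale1r add0r subr0 addr0.
- rewrite nsum1 => [|[|i] // _]; last by rewrite binz0S mulr0 scale0r.
  by rewrite binz_0 expr0z !mulr1 scale1r add0r subr0 addr0.
Qed.

End Borcherds.

Section DualVertexAlgebra.
Variables (K : fieldType) (V : gvoc K).
Hypothesis char0 : forall n, n.+1%:R != 0 :> K.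

Local Notation L k := (vir (rho V) (coact V) k).
Local Notation ds := (gc_sum (gvoc_graded V)).

Lemma coact_linear k : linear (coact V k). Proof. exact: lin_linear. Qed.
Lemma counit_linear : linear (counit V). Proof. exact: lin_linear. Qed.
Lemma rho_linear : linear (rho V). Proof. exact: lin_linear. Qed.

Lemma vir_linear k : linear (L k).
Proof. exact: lin_comp (contrl_linear rho_linear) (coact_linear _). Qed.

(** [L k] contracts the left factor by [rho]; applying the counit to the right
    factor first, only the modes that the creation property annihilates are
    involved. *)
Lemma counit_vir k v : (k <= 1)%R -> counit V (L k v) = 0.
Proof.
move=> k1; rewrite /vir -tpair_contrl; [|exact: rho_linear|exact: counit_linear].
rewrite tpair_contrr; [|exact: rho_linear|exact: counit_linear].
by rewrite (vc_counitr (gvoc_vertex V)) ?(lin0 rho_linear) //; lia.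
Qed.

(** For [s != 0] the vector is a multiple of its image under [L 0], which the
    counit kills. *)
Lemma counit_homogeneous s v : s != 0 -> v \in gr V s -> counit V v = 0.
Proof.
move=> s0 /gvoc_eigen e; apply: (scalerI (intr_neq0 char0 s0)).
by rewrite scaler0 -(linZ counit_linear) -e counit_vir.
Qed.

Lemma vir_homogeneous k s v : v \in gr V s -> L k v \in gr V (s - k).
Proof.
move=> vs; apply/gvoc_eigen; have /gvoc_eigen e := vs.
have := @gvoc_vir K V k 0 v; rewrite e subr0 (linZ (vir_linear k)).
rewrite (_ : (if _ then _ else _) = 0) ?scale0r ?addr0; last first.
  by case: eqP => // ->; rewrite expr0n /= subr0 mul0r mul0r.
move=> /eqP; rewrite subr_eq addrC -subr_eq => /eqP <-.
by rewrite -scalerBl rmorphB.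
Qed.

(** Right creation at the mode [-1]. Since [L 2] lowers weights by 2, [rho] lives
    in weight 2, so that [omega V] is [rho] itself. *)
Lemma rho_counit v : rho V v = counit V (L 2 v).
Proof.
rewrite -[in LHS](vc_counitr_lim (gvoc_vertex V) v) /vir.
rewrite -tpair_contrr; [|exact: rho_linear|exact: counit_linear].
by rewrite tpair_contrl; [|exact: rho_linear|exact: counit_linear].
Qed.

Lemma rho_homogeneous s v : s != 2 -> v \in gr V s -> rho V v = 0.
Proof.
move=> s2 vs; rewrite rho_counit; apply: (@counit_homogeneous (s - 2)).
  by rewrite subr_eq0.
exact: vir_homogeneous.
Qed.

Lemma one_subproof : (counit V : V -> K^o) \in restricted_functionals (gr V).
Proof.
apply/asboolP; split; first exact: counit_linear.
apply: (@sub_finite_set _ _ [set 0]); last exact: finite_set1.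
move=> s [v vs] /=; case: (eqVneq s 0) => // s0.
by rewrite (counit_homogeneous s0 vs) eqxx.
Qed.

Definition one : dvoa V := Subsp one_subproof.

Lemma omegaE v : subsp_val (omega V) v = rho V v.
Proof.
move: v; apply: (graded_ext ds) => [||s v vs].
- exact: rdual_linear (omega V).
- exact: rho_linear.
rewrite /= (hcompE ds _ vs); case: eqP => // /eqP s2.
by rewrite (rho_homogeneous _ vs) ?(lin0 rho_linear) // eq_sym.
Qed.

Lemma dvoa_gr0P s (f : dvoa V) : reflect (forall j v, j <> s -> v \in gr V j -> subsp_val f v = 0)
  (f \in dvoa_gr V s).
Proof. exact: rdual_grP. Qed.

Lemma one_gr : one \in dvoa_gr V 0.
Proof. by apply/dvoa_gr0P => j v /eqP j0 vj; exact: (counit_homogeneous j0 vj). Qed.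

Lemma omega_gr : omega V \in dvoa_gr V 2.
Proof. by apply/dvoa_gr0P => j v /eqP j2 vj; rewrite omegaE (rho_homogeneous j2 vj). Qed.

Lemma dmode_linl k (g : dvoa V) : linear (fun f => dmode k f g).
Proof.
move=> a f f'; apply: rdual_ext => v /=.
exact: (tpair_linl _ _ (dvoa_linear f) (dvoa_linear f') (dvoa_linear g)).
Qed.

Lemma dmode_linr k (f : dvoa V) : linear (dmode k f).
Proof.
move=> a g g'; apply: rdual_ext => v /=.
exact: (tpair_linr _ _ (dvoa_linear f) (dvoa_linear g) (dvoa_linear g')).
Qed.

Lemma tpair_homogeneous (f g : dvoa V) s t r p : f \in dvoa_gr V s -> g \in dvoa_gr V t ->
  p \in tgr id (gr V) (gr V) r -> r <> s + t ->
  tpair (subsp_val f) (subsp_val g) p = 0.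
Proof.
move=> /dvoa_gr0P fs /dvoa_gr0P gt pr rst; have lf := dvoa_linear f; have lg := dvoa_linear g.
move: p pr; apply: lspan_eq0; first exact: tpair_linear.
move=> _ [i [x [y [xi yi ->]]]]; rewrite tpair_pure //.
have [it|it] := eqVneq i t; last by rewrite (gt i) ?mulr0 //; exact/eqP.
by rewrite (fs (r - i)) ?mul0r //; move: rst; lia.
Qed.

Lemma dmode_gr k s t (f g : dvoa V) : f \in dvoa_gr V s -> g \in dvoa_gr V t ->
  dmode k f g \in dvoa_gr V (s + t - k - 1).
Proof.
move=> fs gt; apply/dvoa_gr0P => j v jk vj /=.
apply: (tpair_homogeneous fs gt (gc_coact (gvoc_graded V) k vj)); lia.
Qed.

Lemma gr_lower_bound : exists N : int, forall s (f : dvoa V),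
  (s < N)%R -> f \in dvoa_gr V s -> f = 0.
Proof.
have [N HN] := gc_bounded (gvoc_graded V); exists N => s f sN /dvoa_gr0P fs.
apply: rdual_ext; apply: (graded_ext ds (rdual_linear f) (rdual_linear 0)) => j v vj.
have [js|/eqP js] := eqVneq j s; last by rewrite (fs j).
by rewrite (HN j v) // ?(lin0 (rdual_linear _)) // js.
Qed.

Lemma dvoa_elim (P : dvoa V -> Prop) : P 0 ->
  (forall s f g, f \in dvoa_gr V s -> P g -> P (f + g)) -> forall f, P f.
Proof. exact: (rdual_elim ds). Qed.

Lemma dmode_trunc (f g : dvoa V) :
  exists N : int, forall k, (N <= k)%R -> dmode k f g = 0.
Proof.
have [N HN] := gr_lower_bound.
elim/dvoa_elim: f => [|s f f' fs [M HM]].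
  by exists 0 => k _; rewrite (lin0 (dmode_linl k g)).
have [M' HM'] : exists M' : int, forall k, (M' <= k)%R -> dmode k f g = 0.
  elim/dvoa_elim: g {HM} => [|t g g' gt [M' HM']].
    by exists 0 => k _; rewrite (lin0 (dmode_linr k _)).
  exists (Num.max M' (s + t - N)) => k; rewrite ge_max => /andP[kM' kN].
  rewrite (linD (dmode_linr k f)) HM' // addr0.
  by apply: HN (dmode_gr k fs gt); lia.
exists (Num.max M M') => k; rewrite ge_max => /andP[kM kM'].
by rewrite (linD (dmode_linl k g)) HM ?HM' ?addr0.
Qed.

Lemma eventually0_dmode (f g : dvoa V) m : eventually0 (fun i => dmode (m + i%:Z) f g).
Proof.
have [N HN] := dmode_trunc f g.
exact: (@eventually0_int _ _ (fun k => dmode k f g) N).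
Qed.

(** The Jacobi identity of the coaction evaluated on products of three
    functionals. *)
Lemma dmode_borcherds l m n (f g h : dvoa V) :
  borcherds (@dmode K V) (@dmode K V) l m n f g h = 0.
Proof.
have [[lf lg] lh] := (dvoa_linear f, dvoa_linear g, dvoa_linear h).
have lfg := tpair_linear lf lg; have lP := tpair_linear lfg lh.
have e1 : eventually0 (fun i => ((-1) ^+ i * binz K l i) *:
     dmode (l + m - i%:Z) f (dmode (n + i%:Z) g h)).
  apply: eventually0Z; have [N HN] := eventually0_dmode g h n.
  by exists N => i Ni; rewrite HN // (lin0 (dmode_linr _ _)).
have e2 : eventually0 (fun i => ((-1) ^ l * (-1) ^+ i * binz K l i) *:
        dmode (l + n - i%:Z) g (dmode (m + i%:Z) f h)).
  apply: eventually0Z; have [N HN] := eventually0_dmode f h m.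
  by exists N => i Ni; rewrite HN // (lin0 (dmode_linr _ _)).
have e3 : eventually0 (fun i => binz K m i *: dmode (m + n - i%:Z) (dmode (l + i%:Z) f g) h).
  apply: eventually0Z; have [N HN] := eventually0_dmode f g l.
  by exists N => i Ni; rewrite HN // (lin0 (dmode_linl _ _)).
apply: rdual_ext => v; have lv := @rdual_eval_linear _ _ _ (gr V) v.
rewrite /borcherds (linB lv) (linB lv) !(nsum_lin lv) //.
have [N HN] := vc_trunc (gvoc_vertex V) v.
have := congr1 (tpair (tpair (subsp_val f) (subsp_val g)) (subsp_val h))
  (vc_jacobi (gvoc_vertex V) l m n v).
rewrite (linB lP) -!/(nsum _) !(nsum_lin lP).
- move=> E; apply/eqP; rewrite -[X in _ == X]/(0 : K) subr_eq0; apply/eqP.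
  transitivity (nsum (fun i => tpair (tpair (subsp_val f) (subsp_val g)) (subsp_val h)
   (binz K m i *: tmap (coact V (l + i%:Z)) id (coact V (m + n - i%:Z) v)))).
    rewrite -E; congr (_ - _); apply: eq_nsum => i; rewrite (linZ lP).
      by rewrite tpair_assoc //; exact: coact_linear.
    by rewrite tpair_swap_assoc //; exact: coact_linear.
  apply: eq_nsum => i; rewrite (linZ lP) tpair_tmap //; exact: coact_linear.
- apply: eventually0Z; exists (`|(l + m - N)%R|%N).+1 => i Ni; rewrite HN; last lia.
  by rewrite (lin0 (tmap_linear (@lin_id' _ _) (coact_linear _))) (lin0 (@tassoc_linear _ _ _ _)).
- apply: eventually0Z; exists (`|(m + n - N)%R|%N).+1 => i Ni; rewrite HN; last lia.
  by rewrite (lin0 (tmap_linear (coact_linear _) (@lin_id' _ _))).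
- apply: eventually0Z; exists (`|(l + n - N)%R|%N).+1 => i Ni; rewrite HN; last lia.
  rewrite (lin0 (tmap_linear (@lin_id' _ _) (coact_linear _))) (lin0 (@tassoc_linear _ _ _ _)).
  by rewrite (lin0 (tmap_linear (@tswap_linear _ _ _) (@lin_id' _ _))).
Qed.

End DualVertexAlgebra.

(** * Vacuum, translation and conformal vector *)

Section DualVertexAlgebraConsequences.
Variables (K : fieldType) (V : gvoc K).
Hypothesis char0 : forall n, n.+1%:R != 0 :> K.

Local Notation L k := (vir (rho V) (coact V) k).
Local Notation ds := (gc_sum (gvoc_graded V)).
Local Notation one := (one V char0).
Implicit Types f g h : dvoa V.

Lemma dmode_one k f : (0 <= k)%R -> dmode k f one = 0.
Proof.
move=> k0; apply: rdual_ext => v /=.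
rewrite tpair_contrr; [|exact: dvoa_linear|exact: counit_linear].
by rewrite (vc_counitr (gvoc_vertex V)) // (lin0 (dvoa_linear f)).
Qed.

Lemma dmodeN1_one f : dmode (-1) f one = f.
Proof.
apply: rdual_ext => v /=.
rewrite tpair_contrr; [|exact: dvoa_linear|exact: counit_linear].
by rewrite (vc_counitr_lim (gvoc_vertex V)).
Qed.

Lemma one_dmode k f : dmode k one f = if k == -1 then f else 0.
Proof.
apply: rdual_ext => v /=.
rewrite tpair_contrl; [|exact: counit_linear|exact: dvoa_linear].
rewrite (vc_counitl (gvoc_vertex V)); case: eqP => // _.
exact: (lin0 (dvoa_linear f)).
Qed.

Lemma dmode_commutator m n f g h :
  dmode m f (dmode n g h) - dmode n g (dmode m f h) =
  nsum (fun i => binz K m i *: dmode (m + n - i%:Z) (dmode i%:Z f g) h).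
Proof.
apply/eqP; rewrite -subr_eq0; apply/eqP.
by rewrite -borcherds_commutator dmode_borcherds.
Qed.

(** Skew-symmetry: the Borcherds identity applied to the vacuum. *)
Lemma dmode_skew l f g : dmode l g f =
  - nsum (fun i => ((-1) ^ l * (-1) ^+ i) *: dmode (-1 - i%:Z) (dmode (l + i%:Z) f g) one).
Proof.
have := dmode_borcherds l (-1) 0 f g one; rewrite /borcherds.
rewrite [X in X - _ - _](_ : _ = 0); last first.
  rewrite -[RHS]nsum0; apply: eq_nsum => i.
  by rewrite dmode_one ?(lin0 (dmode_linr _ _)) ?scaler0 //; lia.
rewrite [X in _ - X - _](_ : _ = (-1) ^ l *: dmode l g f); last first.
  rewrite nsum1 => [|i i0]; last first.
    by rewrite (dmode_one f) ?(lin0 (dmode_linr _ _)) ?scaler0 //; lia.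
  by rewrite binz_0 expr0 !mulr1 addr0 subr0 addr0 dmodeN1_one.
rewrite sub0r => /eqP; rewrite subr_eq0 eqr_oppLR => /eqP E.
have s2 : (-1 : K) ^ l * (-1) ^ l = 1 by rewrite -expfzMl mulrNN mulr1 exp1rz.
have -> : dmode l g f = (-1) ^ l *: ((-1) ^ l *: dmode l g f) by rewrite scalerA s2 scale1r.
rewrite E scalerN; congr (- _).
rewrite -nsumZ; last first.
  have [N HN] := eventually0_dmode f g l; exists N => i Ni.
  by rewrite HN // (lin0 (dmode_linl _ _)) scaler0.
by apply: eq_nsum => i; rewrite addr0 scalerA binzN1.
Qed.

Definition dT f : dvoa V := dmode 0 (omega V) f.

Lemma omega_val : subsp_val (omega V) = rho V.
Proof. by apply/funext => u; exact: (omegaE char0). Qed.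

Lemma dTE f v : subsp_val (dT f) v = subsp_val f (L 1 v).
Proof.
transitivity (tpair (subsp_val (omega V)) (subsp_val f) (coact V 0 v)) => //.
rewrite omega_val tpair_contrl; [|exact: rho_linear|exact: dvoa_linear].
by rewrite /vir subrr.
Qed.

Lemma dT_linear : linear dT. Proof. exact: dmode_linr. Qed.

Lemma dT_gr s f : f \in dvoa_gr V s -> dT f \in dvoa_gr V (s + 1).
Proof.
move=> fs; have := dmode_gr 0 (omega_gr V char0) fs.
by rewrite (_ : 2 + s - 0 - 1 = s + 1) //; lia.
Qed.

Lemma dT_dmode k f g : dmode k (dT f) g = (- k)%:~R *: dmode (k - 1) f g.
Proof.
apply: rdual_ext => v.
have lP := tpair_linear (dvoa_linear f) (dvoa_linear g).
transitivity (tpair (subsp_val f) (subsp_val g) ((- k)%:~R *: coact V (k - 1) v)).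
  have eT : subsp_val (dT f) = (fun u => subsp_val f (L 1 u)) by apply/funext => u; exact: dTE.
  transitivity (tpair (subsp_val (dT f)) (subsp_val g) (coact V k v)) => //.
  rewrite eT -gvoc_deriv tpair_tmap; [|exact: dvoa_linear|exact: dvoa_linear
    |exact: vir_linear|exact: lin_id'].
  by [].
exact: linZ lP _ _.
Qed.

Lemma dmode_dT k f g : dT (dmode k f g) = dmode k (dT f) g + dmode k f (dT g).
Proof.
have := dmode_commutator 0 k (omega V) f g.
rewrite nsum1 => [|[|i] // _]; last by rewrite binz0S scale0r.
rewrite binz_0 scale1r add0r subr0 -/(dT _) => <-.
by rewrite subrK.
Qed.

(** The divided powers of the translation operator: [dTpow i] acts as the [i]-th
    power of [dT] divided by the factorial of [i]. *)
Definition dTpow (i : nat) f : dvoa V := dmode (-1 - i%:Z) f one.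

Lemma dTpow_linear i : linear (dTpow i).
Proof. exact: dmode_linl. Qed.

Lemma dTpow0 f : dTpow 0 f = f.
Proof. by rewrite /dTpow subr0 dmodeN1_one. Qed.

Lemma dTpowS i f : i.+1%:R *: dTpow i.+1 f = dTpow i (dT f).
Proof.
rewrite /dTpow dT_dmode (_ : -1 - i%:Z - 1 = -1 - i.+1%:Z); last lia.
by rewrite (_ : - (-1 - i%:Z) = i.+1%:Z) //; lia.
Qed.

Lemma dmode_skewT l f g : dmode l g f =
  - nsum (fun i => ((-1) ^ l * (-1) ^+ i) *: dTpow i (dmode (l + i%:Z) f g)).
Proof. exact: dmode_skew. Qed.

Lemma dT_one : dT one = 0.
Proof. exact: dmode_one. Qed.

(** As [rho] is the counit composed with [L 2], these products are the counit
    applied to [L 2 (L k v)]; commuting [L 2] to the right leaves the Virasoro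
    bracket. *)
Lemma omega_omega (i : nat) : (0 < i)%N -> dmode i%:Z (omega V) (omega V) =
  if i == 1%N then 2%:R *: omega V
  else if i == 3%N then (rank V / 2%:R) *: one else 0.
Proof.
move=> i0; apply: rdual_ext => v.
have lo := omega_val.
transitivity (tpair (subsp_val (omega V)) (subsp_val (omega V)) (coact V i%:Z v)) => //.
rewrite lo tpair_contrl; [|exact: rho_linear|exact: rho_linear].
have -> : contrl (rho V) (coact V i%:Z v) = L (1 - i%:Z) v by rewrite /vir opprB addrC subrK.
rewrite rho_counit.
have lc := @counit_linear K V.
have /eqP := @gvoc_vir K V 2 (1 - i%:Z) v.
rewrite subr_eq => /eqP ->; rewrite !(linD lc) !(linZ lc).
rewrite [X in _ + X](counit_vir (k := 1 - i%:Z)) ?addr0; last lia.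
have [->|i1] := eqVneq i 1%N.
  have -> : (2 + (1 - 1%:Z) == 0) = false by [].
  rewrite [X in _ + X]scale0r addr0 subrr subr0 ?addr0.
  by rewrite -rho_counit -lo.
rewrite [counit V (L _ v)](counit_vir (k := 2 + (1 - i%:Z))) ?scaler0 ?add0r; last lia.
have [->|i3] := eqVneq i 3%N.
  have -> : (2 + (1 - 3%:Z) == 0) = true by [].
  transitivity (rank V / 2%:R * counit V v) => //; congr (_ * _).
  have -> : (2 ^+ 3 - 2 : int)%:~R = 6%:R :> K by [].
  have /eqP -> : 12%:R == 6%:R * 2%:R :> K by rewrite -natrM.
  by rewrite invfM mulrA mulrAC divff ?mul1r 1?mulrC //; exact: char0.
rewrite ifF ?scale0r //; apply/negbTE; move: i1 i3; lia.
Qed.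

(** A dual basis of [V_s], with the functionals extended by zero to the other
    weights. *)
Lemma dvoa_dual_basis s : exists (n : nat) (e : nat -> V) (f : nat -> dvoa V),
  [/\ forall i, (i < n)%N -> e i \in gr V s, forall i, f i \in dvoa_gr V s &
      forall v, v \in gr V s -> v = \sum_(i < n) subsp_val (f i) v *: e i].
Proof.
have [n [e [phi [es lphi phiE]]]] := findim_dual_basis (gc_findim (gvoc_graded V) s).
have hm v : hcomp (gr V) s v \in gr V s by exact: (hcomp_mem ds).
pose psi i v : K^o := phi i (hcomp (gr V) s v).
have lpsi i : linear (psi i).
  by move=> a u v; rewrite /psi (hcomp_linear s ds) lphi.
have psiP i : psi i \in restricted_functionals (gr V).
  apply/asboolP; split=> //; apply: (@sub_finite_set _ _ [set s]); last exact: finite_set1.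
  move=> j [x xj] /=; rewrite /psi (hcompE ds _ xj); case: (eqVneq s j) => [sj _|_] /=; first by rewrite sj.
  have /= := lphi i 0 0 0 (rpred0 _) (rpred0 _); rewrite scale0r addr0 mul0r add0r => _.
  have /= := lphi i (-1) 0 0 (rpred0 _) (rpred0 _).
  by rewrite scaler0 addr0 mulN1r addNr => ->; rewrite eqxx.
exists n, e, (fun i => Subsp (psiP i)); split=> // [i|v vs].
  apply/dvoa_gr0P => j v /eqP js vj /=; rewrite /psi (hcompE ds _ vj) eq_sym (negbTE js).
  have /= := lphi i (-1) 0 0 (rpred0 _) (rpred0 _).
  by rewrite scaler0 addr0 mulN1r addNr.
rewrite [LHS]phiE //; apply: eq_bigr => i _.
by rewrite /= /psi (hcomp_id ds vs).
Qed.

Lemma dvoa_separates (v : V) : (forall f : dvoa V, subsp_val f v = 0) -> v = 0.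
Proof.
move=> v0; have [A uA vA] := graded_sum ds v; rewrite (vA A) // big1 // => s _.
have [n [e [f [es fs ef]]]] := dvoa_dual_basis s.
rewrite (ef (hcomp (gr V) s v)) ?(hcomp_mem ds) // big1 // => i _.
have -> : subsp_val (f i) (hcomp (gr V) s v) = subsp_val (rdual_comp ds s (f i)) v by [].
by rewrite v0 scale0r.
Qed.

End DualVertexAlgebraConsequences.

(** * Calculus of the Borcherds identity *)

Section BorcherdsCalculus.
Variables (K : fieldType) (A X : lmodType K).
Hypothesis char0 : forall n, n.+1%:R != 0 :> K.
Variables (md : int -> A -> A -> A) (act : int -> A -> X -> X).
Hypothesis md_linl : forall k b, linear (fun a => md k a b).
Hypothesis md_linr : forall k a, linear (md k a).
Hypothesis md_ev0 : forall m a b, eventually0 (fun i => md (m + i%:Z) a b).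
Hypothesis md_comm : forall m n a b c, md m a (md n b c) - md n b (md m a c) =
  nsum (fun i => binz K m i *: md (m + n - i%:Z) (md i%:Z a b) c).
Hypothesis act_linl : forall k x, linear (fun a => act k a x).
Hypothesis act_linr : forall k a, linear (act k a).
Hypothesis act_ev0 : forall m a x, eventually0 (fun i => act (m + i%:Z) a x).
Hypothesis act_comm : forall m n a b x, act m a (act n b x) - act n b (act m a x) =
  nsum (fun i => binz K m i *: act (m + n - i%:Z) (md i%:Z a b) x).

Local Notation B := (borcherds md act).

Lemma bounded2I (Y : lmodType K) (F : nat -> nat -> Y) N :
  (forall p r, (N <= p)%N -> F p r = 0) -> (forall p, eventually0 (F p)) -> bounded2 F.
Proof.
move=> F0 eF.
have [M HM] : exists M, forall p r, (p < N)%N -> (M <= r)%N -> F p r = 0.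
  elim: N {F0} => [|N [M HM]]; first by exists 0%N.
  have [M' HM'] := eF N; exists (maxn M M') => p r; rewrite geq_max ltnS leq_eqVlt.
  by case/predU1P => [-> /andP[_ /HM' //]|pN /andP[/(HM p r pN) ->]].
exists (maxn N M) => p r; have [pN|Np] := ltnP p N; last by rewrite F0.
by move=> pr; apply: HM => //; lia.
Qed.

Lemma bounded2_swap (Y : lmodType K) (F : nat -> nat -> Y) :
  bounded2 F -> bounded2 (fun i j => F j i).
Proof. by move=> [N HN]; exists N => i j ij; apply: HN; rewrite orbC. Qed.

Lemma bounded2Z (Y : lmodType K) (s : nat -> nat -> K) (F : nat -> nat -> Y) :
  bounded2 F -> bounded2 (fun i j => s i j *: F i j).
Proof. by move=> [N HN]; exists N => i j ij; rewrite HN ?scaler0. Qed.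

Lemma md0_ev0 a b : eventually0 (fun i => md i%:Z a b).
Proof.
by have [N HN] := md_ev0 0 a b; exists N => i Ni; rewrite -(HN i Ni) add0r.
Qed.

Lemma actC m n a b x : act m a (act n b x) = act n b (act m a x) +
  nsum (fun i => binz K m i *: act (m + n - i%:Z) (md i%:Z a b) x).
Proof. by rewrite -act_comm addrC subrK. Qed.

Lemma act_comm_ev0 m (F : nat -> int) a b x :
  eventually0 (fun i => binz K m i *: act (F i) (md i%:Z a b) x).
Proof.
apply: eventually0Z; have [N HN] := md0_ev0 a b.
by exists N => i Ni; rewrite HN // (lin0 (act_linl _ _)).
Qed.

Section Sums.
Variable l : int.

(** The two halves of the left-hand side of the Borcherds identity are instances,
    for different coefficients, of the same expression. *)
Definition act_sum (al : nat -> K) m n a b x :=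
  nsum (fun i => al i *: act (l + m - i%:Z) a (act (n + i%:Z) b x)).

Definition md_sum m n a b x :=
  nsum (fun i => binz K m i *: act (m + n - i%:Z) (md (l + i%:Z) a b) x).

Definition alpha i : K := (-1) ^+ i * binz K l i.
Definition beta i : K := (-1) ^ l * (-1) ^+ i * binz K l i.

Lemma borcherdsE m n a b x :
  B l m n a b x = act_sum alpha m n a b x - act_sum beta n m b a x - md_sum m n a b x.
Proof. by []. Qed.

Lemma act_sum_ev0 al m n a b x :
  eventually0 (fun i => al i *: act (l + m - i%:Z) a (act (n + i%:Z) b x)).
Proof.
apply: eventually0Z; have [N HN] := act_ev0 n b x.
by exists N => i Ni; rewrite HN // (lin0 (act_linr _ _)).
Qed.

Lemma md_sum_ev0 m n a b x :
  eventually0 (fun i => binz K m i *: act (m + n - i%:Z) (md (l + i%:Z) a b) x).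
Proof.
apply: eventually0Z; have [N HN] := md_ev0 l a b.
by exists N => i Ni; rewrite HN // (lin0 (act_linl _ _)).
Qed.

Lemma act_sum_linl al m n b x : linear (fun a => act_sum al m n a b x).
Proof.
move=> c a a'; rewrite /act_sum -nsumZ -?nsumD; try exact: act_sum_ev0.
  by apply: eq_nsum => i; rewrite act_linl scalerDr !scalerA mulrC.
exact/eventually0Z/act_sum_ev0.
Qed.

Lemma act_sum_linm al m n a x : linear (fun b => act_sum al m n a b x).
Proof.
move=> c b b'; rewrite /act_sum -nsumZ -?nsumD; try exact: act_sum_ev0.
  by apply: eq_nsum => i; rewrite act_linl act_linr scalerDr !scalerA mulrC.
exact/eventually0Z/act_sum_ev0.
Qed.

Lemma act_sum_linr al m n a b : linear (act_sum al m n a b).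
Proof.
move=> c x x'; rewrite /act_sum -nsumZ -?nsumD; try exact: act_sum_ev0.
  by apply: eq_nsum => i; rewrite !act_linr scalerDr !scalerA mulrC.
exact/eventually0Z/act_sum_ev0.
Qed.

Lemma md_sum_linl m n b x : linear (fun a => md_sum m n a b x).
Proof.
move=> c a a'; rewrite /md_sum -nsumZ -?nsumD; try exact: md_sum_ev0.
  by apply: eq_nsum => i; rewrite md_linl act_linl scalerDr !scalerA mulrC.
exact/eventually0Z/md_sum_ev0.
Qed.

Lemma md_sum_linm m n a x : linear (fun b => md_sum m n a b x).
Proof.
move=> c b b'; rewrite /md_sum -nsumZ -?nsumD; try exact: md_sum_ev0.
  by apply: eq_nsum => i; rewrite md_linr act_linl scalerDr !scalerA mulrC.
exact/eventually0Z/md_sum_ev0.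
Qed.

Lemma md_sum_linr m n a b : linear (md_sum m n a b).
Proof.
move=> c x x'; rewrite /md_sum -nsumZ -?nsumD; try exact: md_sum_ev0.
  by apply: eq_nsum => i; rewrite act_linr scalerDr !scalerA mulrC.
exact/eventually0Z/md_sum_ev0.
Qed.

Lemma lin_subsub (U W : lmodType K) (f g h : U -> W) : linear f -> linear g -> linear h ->
  linear (fun u => f u - g u - h u).
Proof.
move=> lf lg lh c u v; rewrite lf lg lh !scalerBr !opprD !addrA.
by rewrite (ACl (1 * 3 * 5 * 2 * 4 * 6))%AC.
Qed.

Lemma borcherds_linl m n b x : linear (fun a => B l m n a b x).
Proof. exact: lin_subsub (act_sum_linl _ _ _ _ _) (act_sum_linm _ _ _ _ _) (md_sum_linl _ _ _ _). Qed.

Lemma borcherds_linm m n a x : linear (fun b => B l m n a b x).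
Proof. exact: lin_subsub (act_sum_linm _ _ _ _ _) (act_sum_linl _ _ _ _ _) (md_sum_linm _ _ _ _). Qed.

Lemma borcherds_linr m n a b : linear (B l m n a b).
Proof. exact: lin_subsub (act_sum_linr _ _ _ _ _) (act_sum_linr _ _ _ _ _) (md_sum_linr _ _ _ _). Qed.

Lemma act_sum_act al k m n a b c x :
  act k c (act_sum al m n a b x) = act_sum al m n a b (act k c x)
  + nsum (fun p => binz K k p *: (act_sum al (m + k - p%:Z) n (md p%:Z c a) b x
                                  + act_sum al m (n + k - p%:Z) a (md p%:Z c b) x)).
Proof.
have [Nb Hb] := act_ev0 n b x.
have [Na Ha] := md0_ev0 c a; have [Nc Hc] := md0_ev0 c b.
pose F1 i p := (al i * binz K k p) *:
  act (l + (m + k - p%:Z) - i%:Z) (md p%:Z c a) (act (n + i%:Z) b x).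
pose F2 i p := (al i * binz K k p) *:
  act (l + m - i%:Z) a (act (n + k - p%:Z + i%:Z) (md p%:Z c b) x).
have bF1 : bounded2 F1.
  apply: bounded2Z; apply: (@bounded2I _ _ Nb) => [i p Ni|i].
    by rewrite Hb // (lin0 (act_linr _ _)).
  by exists Na => p Np; rewrite Ha // (lin0 (act_linl _ _)).
have bF2 : bounded2 F2.
  apply: bounded2Z; apply: bounded2_swap; apply: (@bounded2I _ _ Nc) => [p i Np|p].
    by rewrite Hc // (lin0 (act_linl _ _)) (lin0 (act_linr _ _)).
  have [M HM] := act_ev0 (n + k - p%:Z) (md p%:Z c b) x.
  by exists M => i Mi; rewrite HM // (lin0 (act_linr _ _)).
transitivity (act_sum al m n a b (act k c x)
   + (nsum (fun i => nsum (F1 i)) + nsum (fun i => nsum (F2 i)))).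
  have := bounded2_outer bF1; have := bounded2_outer bF2 => o2 o1.
  rewrite -nsumD // /act_sum (nsum_lin (act_linr k c)); last exact: act_sum_ev0.
  rewrite -nsumD; [|exact: act_sum_ev0|exact: eventually0D].
  apply: eq_nsum => i; rewrite (linZ (act_linr k c)) actC (actC k (n + i%:Z)).
  rewrite (linD (act_linr _ _)) !scalerDr -addrA; congr (_ + _).
  rewrite (nsum_lin (act_linr _ _)); last exact: act_comm_ev0.
  have e1 := act_comm_ev0 k (fun j => k + (l + m - i%:Z) - j%:Z) c a (act (n + i%:Z) b x).
  have e2 := eventually0_lin (act_linr (l + m - i%:Z) a)
    (act_comm_ev0 k (fun j => k + (n + i%:Z) - j%:Z) c b x).
  rewrite -!nsumZ //.
  rewrite addrC; congr (_ + _); apply: eq_nsum => p; rewrite /F1 /F2.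
    rewrite scalerA; congr (_ *: act _ _ _); lia.
  by rewrite (linZ (act_linr _ _)) scalerA; congr (_ *: act _ _ (act _ _ _)); lia.
congr (_ + _); rewrite (exchange_nsum bF1) (exchange_nsum bF2) -nsumD; first last.
- exact/bounded2_outer/bounded2_swap.
- exact/bounded2_outer/bounded2_swap.
apply: eq_nsum => p; rewrite scalerDr /act_sum -!nsumZ; try exact: act_sum_ev0.
by congr (_ + _); apply: eq_nsum => i; rewrite /F1 /F2 scalerA mulrC.
Qed.

Lemma md_sum_act k m n a b c x :
  act k c (md_sum m n a b x) = md_sum m n a b (act k c x)
  + nsum (fun p => binz K k p *: (md_sum (m + k - p%:Z) n (md p%:Z c a) b x
                                  + md_sum m (n + k - p%:Z) a (md p%:Z c b) x)).
Proof.
have [Nab Hab] := md_ev0 l a b.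
have [Na Ha] := md0_ev0 c a; have [Nc Hc] := md0_ev0 c b.
pose y i j (d : A) := act (k + (m + n) - i%:Z - j%:Z) d x.
have ly i j : linear (y i j) by move=> s u v; exact: act_linl.
pose G j i := y i j (md j%:Z c (md (l + i%:Z) a b)).
pose F2 j i := y i j (md (l + i%:Z) a (md j%:Z c b)).
pose F1 p r := act (k + (m + n) - p%:Z - r%:Z) (md (l + r%:Z) (md p%:Z c a) b) x.
have bG : bounded2 G.
  apply: bounded2_swap; apply: (@bounded2I _ _ Nab) => [i j Ni|i].
    by rewrite /G Hab // (lin0 (md_linr _ _)) (lin0 (ly _ _)).
  have [M HM] := md0_ev0 c (md (l + i%:Z) a b).
  by exists M => j Mj; rewrite /G HM // (lin0 (ly _ _)).
have bF2 : bounded2 F2.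
  apply: (@bounded2I _ _ Nc) => [j i Nj|j].
    by rewrite /F2 Hc // (lin0 (md_linr _ _)) (lin0 (ly _ _)).
  have [M HM] := md_ev0 l a (md j%:Z c b).
  by exists M => i Mi; rewrite /F2 HM // (lin0 (ly _ _)).
have bF1 : bounded2 F1.
  apply: (@bounded2I _ _ Na) => [p r Np|p].
    by rewrite /F1 Ha // (lin0 (md_linl _ _)) (lin0 (act_linl _ _)).
  have [M HM] := md_ev0 l (md p%:Z c a) b.
  by exists M => i Mi; rewrite /F1 HM // (lin0 (act_linl _ _)).
transitivity (md_sum m n a b (act k c x)
   + nsum (fun j => nsum (fun i => (binz K k j * binz K m i) *: G j i))).
  rewrite -exchange_nsum; last exact/bounded2_swap/bounded2Z.
  rewrite /md_sum (nsum_lin (act_linr k c)); last exact: md_sum_ev0.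
  rewrite -nsumD; [|exact: md_sum_ev0|]; last first.
    by apply: bounded2_outer; apply: bounded2_swap; apply: bounded2Z.
  apply: eq_nsum => i; rewrite (linZ (act_linr k c)) actC scalerDr; congr (_ + _).
  rewrite -nsumZ; last exact: act_comm_ev0.
  apply: eq_nsum => j; rewrite scalerA mulrC /G /y.
  by congr (_ *: act _ _ _); lia.
congr (_ + _).
have GE j i : G j i = F2 j i + nsum (fun p => binz K j%:Z p *: F1 p (i + (j - p))%N).
  rewrite /G /F2 -[md j%:Z c _](subrK (md (l + i%:Z) a (md j%:Z c b))) md_comm.
  rewrite (linD (ly _ _)) addrC; congr (_ + _); rewrite (nsum_lin (ly _ _)); last first.
    apply: eventually0Z; exists Na => p Np; rewrite Ha // (lin0 (md_linl _ _)) //.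
  apply: eq_nsum => p; rewrite (linZ (ly _ _)).
  have [jp|pj] := ltnP j p; first by rewrite (binz_nat_eq0 _ jp) !scale0r.
  by congr (_ *: _); rewrite /y /F1; congr (act _ (md _ _ _) _); lia.
have e1 j i : eventually0 (fun p => binz K j%:Z p *: F1 p (i + (j - p))%N).
  by apply: eventually0Z; case: bF1 => N HN; exists N => p Np; rewrite HN // Np.
have bH : bounded2 (fun j i => nsum (fun p => binz K j%:Z p *: F1 p (i + (j - p))%N)).
  case: bF1 => N HN; exists (N + N)%N => j i ji; rewrite -[RHS]nsum0; apply: eq_nsum => p.
  by rewrite HN ?scaler0 //; lia.
transitivity (nsum (fun j => nsum (fun i => (binz K k j * binz K m i) *:
      nsum (fun p => binz K j%:Z p *: F1 p (i + (j - p))%N)))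
   + nsum (fun j => nsum (fun i => (binz K k j * binz K m i) *: F2 j i))).
  rewrite -nsumD; try exact/bounded2_outer/bounded2Z.
  apply: eq_nsum => j.
  have eH := bounded2_inner j (bounded2Z (fun j i => binz K k j * binz K m i) bH).
  have eF := bounded2_inner j (bounded2Z (fun j i => binz K k j * binz K m i) bF2).
  rewrite -nsumD //.
  by apply: eq_nsum => i; rewrite GE scalerDr addrC.
transitivity (nsum (fun p => binz K k p *: nsum (fun r => binz K (k - p%:Z + m) r *: F1 p r))
   + nsum (fun j => binz K k j *: md_sum m (n + k - j%:Z) a (md j%:Z c b) x)).
  congr (_ + _).
    rewrite -(binz_convolution char0) //; apply: eq_nsum => j; rewrite -nsumZ.
      by apply: eq_nsum => i; rewrite scalerA.
    exact: eventually0Z (bounded2_inner _ bH).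
  apply: eq_nsum => j; rewrite /md_sum -nsumZ; last exact: md_sum_ev0.
  apply: eq_nsum => i; rewrite scalerA /F2 /y; congr (_ *: act _ _ _); lia.
rewrite -nsumD; first last.
- apply: eventually0Z; exists Nc => p Np; rewrite Hc // -[RHS]nsum0; apply: eq_nsum => i.
  by rewrite (lin0 (md_linr _ _)) (lin0 (act_linl _ _)) scaler0.
- apply: eventually0Z; apply: bounded2_outer.
  exact: (bounded2Z (fun p r => binz K (k - p%:Z + m) r) bF1).
apply: eq_nsum => p; rewrite scalerDr; congr (_ *: _ + _).
apply: eq_nsum => r; rewrite /F1; congr (binz K _ _ *: act _ _ _); lia.
Qed.

(** Both sides of the Borcherds identity transform by the commutator formula in
    each argument, and the binomial coefficients recombine by [binz_convolution].
    A defect that vanishes on a vector therefore vanishes on its images under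
    modes. *)
Lemma borcherds_act k m n a b c x :
  act k c (B l m n a b x) = B l m n a b (act k c x)
  + nsum (fun p => binz K k p *: (B l (m + k - p%:Z) n (md p%:Z c a) b x
                                  + B l m (n + k - p%:Z) a (md p%:Z c b) x)).
Proof.
have lk := act_linr k c.
have [Na Ha] := md0_ev0 c a; have [Nc Hc] := md0_ev0 c b.
have ev (f g : nat -> A -> X) : (forall p, linear (f p)) -> (forall p, linear (g p)) ->
    eventually0 (fun p => binz K k p *: (f p (md p%:Z c a) + g p (md p%:Z c b))).
  move=> lf lg; apply: eventually0Z; exists (maxn Na Nc) => p; rewrite geq_max => /andP[Np Mp].
  by rewrite Ha // Hc // (lin0 (lf p)) (lin0 (lg p)) addr0.
rewrite (borcherdsE m n a b x) (borcherdsE m n a b (act k c x)) 2!(linB lk).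
rewrite (act_sum_act _ k m) (act_sum_act _ k n) md_sum_act.
set S1 := nsum _; set S2 := nsum _; set S3 := nsum _.
suff -> : nsum (fun p => binz K k p *: (B l (m + k - p%:Z) n (md p%:Z c a) b x
                + B l m (n + k - p%:Z) a (md p%:Z c b) x)) = S1 - S2 - S3.
  by rewrite !opprD !addrA (ACl (1 * 3 * 5 * 2 * 4 * 6))%AC.
have e1 := ev (fun p u => act_sum alpha (m + k - p%:Z) n u b x)
              (fun p u => act_sum alpha m (n + k - p%:Z) a u x)
              (fun p => act_sum_linl _ _ _ _ _) (fun p => act_sum_linm _ _ _ _ _).
have e2 := ev (fun p u => act_sum beta n (m + k - p%:Z) b u x)
              (fun p u => act_sum beta (n + k - p%:Z) m u a x)
              (fun p => act_sum_linm _ _ _ _ _) (fun p => act_sum_linl _ _ _ _ _).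
have e3 := ev (fun p u => md_sum (m + k - p%:Z) n u b x)
              (fun p u => md_sum m (n + k - p%:Z) a u x)
              (fun p => md_sum_linl _ _ _ _) (fun p => md_sum_linm _ _ _ _).
have -> : S2 = nsum (fun p => binz K k p *: (act_sum beta n (m + k - p%:Z) b (md p%:Z c a) x
   + act_sum beta (n + k - p%:Z) m (md p%:Z c b) a x)).
  by apply: eq_nsum => p; rewrite addrC.
rewrite -nsumB // -nsumB //; last exact/eventually0D/eventually0N.
apply: eq_nsum => p; rewrite -!scalerBr !borcherdsE; congr (_ *: _).
by rewrite !opprD !addrA (ACl (1 * 4 * 2 * 5 * 3 * 6))%AC.
Qed.

End Sums.

Lemma act_sum_split l al be ga m n a b x :
  (forall i, ga i.+1 = al i.+1 + be i) -> ga 0%N = al 0%N ->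
  act_sum (l + 1) ga m n a b x
  = act_sum l al (m + 1) n a b x + act_sum l be m (n + 1) a b x.
Proof.
move=> gaS ga0; rewrite /act_sum nsum_recl; last exact: act_sum_ev0.
rewrite [X in _ = X + _]nsum_recl; last exact: act_sum_ev0.
rewrite -[RHS]addrA ga0 -nsumD.
- congr (_ *: act _ _ _ + _); first lia.
  apply: eq_nsum => i; rewrite gaS scalerDl.
  congr (_ *: act _ _ _ + _ *: act _ _ (act _ _ _)); lia.
- exact: (eventually0_shift (act_sum_ev0 l al (m + 1) n a b x)).
- exact: act_sum_ev0.
Qed.

(** Pascal's rule in each of the three sums relates the defects for [l] and [l +
    1]. *)
Lemma borcherds_recl l m n a b x :
  B (l + 1) m n a b x = B l (m + 1) n a b x - B l m (n + 1) a b x.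
Proof.
rewrite !borcherdsE.
rewrite (@act_sum_split l (alpha l) (fun i => - alpha l i)); first last.
- by rewrite /alpha !binz_0.
- by move=> i; rewrite /alpha binz_pascal // exprS; ring.
rewrite (@act_sum_split l (fun i => - beta l i) (beta l)); first last.
- by rewrite /beta !binz_0 expfzDr ?expr1z ?mulrN1 ?mulN1r ?oppr_eq0 ?oner_eq0 //; ring.
- move=> i; rewrite /beta binz_pascal // exprS expfzDr ?oppr_eq0 ?oner_eq0 //.
  by rewrite expr1z; ring.
have sN al m' n' a' b' : act_sum l (fun i => - al i) m' n' a' b' x = - act_sum l al m' n' a' b' x.
  rewrite /act_sum -nsumN; last exact: act_sum_ev0.
  by apply: eq_nsum => i; rewrite scaleNr.
rewrite !sN.
have -> : md_sum (l + 1) m n a b x = md_sum l (m + 1) n a b x - md_sum l m (n + 1) a b x.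
  apply/eqP; rewrite eq_sym subr_eq; apply/eqP.
  rewrite {1 3}/md_sum nsum_recl; last exact: md_sum_ev0.
  rewrite [X in _ = _ + X]nsum_recl; last exact: md_sum_ev0.
  rewrite addrCA -nsumD; first last.
  - exact: eventually0_shift (md_sum_ev0 l m (n + 1) a b x).
  - exact: md_sum_ev0.
  congr (_ + _); first by rewrite !binz_0; congr (_ *: act _ _ _); lia.
  apply: eq_nsum => i; rewrite binz_pascal // addrC scalerDl.
  by congr (_ *: act _ (md _ _ _) _ + _ *: act _ _ _); lia.
move: (act_sum _ _ _ _ _ _ _) (act_sum _ _ _ _ _ _ _) (act_sum _ _ _ _ _ _ _)
  (act_sum _ _ _ _ _ _ _) (md_sum _ _ _ _ _ _) (md_sum _ _ _ _ _ _) => a1 a2 a3 a4 a5 a6.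
rewrite !opprD !opprK !addrA.
by rewrite (ACl (1 * 4 * 5 * 2 * 3 * 6))%AC.
Qed.

End BorcherdsCalculus.

(** * Extending the Borcherds identity from the degree-zero part *)

Section BorcherdsExtension.
Variables (K : fieldType) (A X N : lmodType K).
Hypothesis char0 : forall n, n.+1%:R != 0 :> K.
Variables (md : int -> A -> A -> A) (act : int -> A -> X -> X).
Hypothesis md_linl : forall k b, linear (fun a => md k a b).
Hypothesis md_linr : forall k a, linear (md k a).
Hypothesis md_ev0 : forall m a b, eventually0 (fun i => md (m + i%:Z) a b).
Hypothesis md_comm : forall m n a b c, md m a (md n b c) - md n b (md m a c) =
  nsum (fun i => binz K m i *: md (m + n - i%:Z) (md i%:Z a b) c).
Hypothesis act_linl : forall k x, linear (fun a => act k a x).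
Hypothesis act_linr : forall k a, linear (act k a).
Hypothesis act_ev0 : forall m a x, eventually0 (fun i => act (m + i%:Z) a x).
Hypothesis act_comm : forall m n a b x, act m a (act n b x) - act n b (act m a x) =
  nsum (fun i => binz K m i *: act (m + n - i%:Z) (md i%:Z a b) x).

Variable gA : int -> submodClosed A.
Hypothesis A_elim : forall P : A -> Prop, P 0 ->
  (forall s a b, a \in gA s -> P b -> P (a + b)) -> forall a, P a.
Hypothesis md_gr : forall k s t a b, a \in gA s -> b \in gA t ->
  md k a b \in gA (s + t - k - 1).

Variables (iota : N -> X) (pi : X -> N) (oz : A -> N -> N).
Hypothesis pi_lin : linear pi.
Hypothesis oz_linr : forall a, linear (oz a).
Hypothesis piK : forall n, pi (iota n) = n.
Hypothesis iota_neg : forall s k a n, a \in gA s -> (s - k - 1 < 0)%R -> act k a (iota n) = 0.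
Hypothesis iota_zero : forall s a n, a \in gA s -> act (s - 1) a (iota n) = iota (oz a n).
Hypothesis pi_pos : forall s k a x, a \in gA s -> (0 < s - k - 1)%R -> pi (act k a x) = 0.
Hypothesis pi_zero : forall s a x, a \in gA s -> pi (act (s - 1) a x) = oz a (pi x).

Hypothesis oz_mul : forall s a b n, a \in gA s ->
  oz a (oz b n) = nsum (fun i => binz K s i *: oz (md (-1 + i%:Z) a b) n).
Hypothesis oz_vanish : forall l s a b n, a \in gA s -> (l <= -2)%R ->
  nsum (fun i => binz K s i *: oz (md (l + i%:Z) a b) n) = 0.

Definition act_word (w : seq (int * A)) (x : X) : X := foldr (fun p => act p.1 p.2) x w.

Hypothesis pi_separates : forall x, (forall w, pi (act_word w x) = 0) -> x = 0.
Hypothesis X_span : forall x, x \in lspan [set y | exists w n, y = act_word w (iota n)].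

Local Notation B := (borcherds md act).

Lemma act_word_lin w : linear (act_word w).
Proof.
elim: w => [|[k a] w IH] c x y //=; rewrite IH; exact: act_linr.
Qed.

(** Modes of positive degree are invisible after [pi], modes of negative degree
    kill the image of [iota], and modes of degree zero preserve it: only total
    degree zero can survive. *)
Lemma pi_two l m s t a b n : a \in gA s -> b \in gA t -> s + t - l - m - 2 != 0 ->
  pi (act l a (act m b (iota n))) = 0.
Proof.
move=> sa tb st0; have lc k c := lin0 (act_linr k c).
case: (ltgtP (t - m - 1) 0) => [bneg|bpos|b0].
- by rewrite (iota_neg _ tb bneg) lc (lin0 pi_lin).
- case: (ltgtP (s - l - 1) 0) => [aneg|apos|a0].
  + rewrite -(subrK (act m b (act l a (iota n))) (act l a _)) act_comm (linD pi_lin).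
    rewrite (iota_neg _ sa aneg) lc (lin0 pi_lin) addr0 (nsum_lin pi_lin); last first.
      apply: eventually0Z; have [M HM] := md_ev0 0 a b.
      exists M => i Mi; rewrite -[i%:Z]add0r HM // (lin0 (act_linl _ _)) //.
    rewrite -[RHS]nsum0; apply: eq_nsum => i; rewrite (linZ pi_lin).
    have dg := md_gr i%:Z sa tb; case: (ltgtP (s + t - l - m - 2) 0) => [neg|pos|e].
    * by rewrite (iota_neg _ dg) ?(lin0 pi_lin) ?scaler0 //; lia.
    * by rewrite (pi_pos _ dg) ?scaler0 //; lia.
    * by rewrite e eqxx in st0.
  + exact: pi_pos sa apos.
  + have -> : l = s - 1 by lia.
    by rewrite (pi_zero _ sa) (pi_pos _ tb bpos) (lin0 (oz_linr a)).
have -> : m = t - 1 by lia.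
rewrite (iota_zero _ tb); case: (ltgtP (s - l - 1) 0) => [aneg|apos|a0].
- by rewrite (iota_neg _ sa aneg) (lin0 pi_lin).
- exact: pi_pos sa apos.
by move: st0; rewrite (_ : s + t - l - m - 2 = 0) ?eqxx //; lia.
Qed.

Section Step.
Variable l : int.
Hypothesis l_neg : (l < 0)%R.
Hypothesis B_next : forall m n a b x, B (l + 1) m n a b x = 0.

(** The defects for [l + 1] being zero, [borcherds_recl] lets the defect for [l]
    depend on [m + n] only. *)
Lemma borcherds_shift j m n a b x : B l m n a b x = B l (m + j) (n - j) a b x.
Proof.
have sh m' n' : B l (m' + 1) n' a b x = B l m' (n' + 1) a b x.
  apply/eqP; rewrite -subr_eq0.
  by rewrite -(borcherds_recl char0 md_ev0 act_linl act_linr act_ev0) B_next.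
case: j => j; rewrite ?NegzE; elim: j => [|j IH].
- by rewrite addr0 subr0.
- rewrite IH (_ : m + j.+1%:Z = m + j%:Z + 1); last lia.
  by rewrite sh (_ : n - j.+1%:Z + 1 = n - j%:Z) //; lia.
- by rewrite (_ : n - - 1%:Z = n + 1) -?sh ?subrK //; lia.
rewrite IH (_ : n - - j.+2%:Z = n - - j.+1%:Z + 1); last lia.
by rewrite -sh (_ : m - j.+2%:Z + 1 = m - j.+1%:Z) //; lia.
Qed.

Lemma pi_borcherds_iota m n a b v : pi (B l m n a b (iota v)) = 0.
Proof.
have lB1 m' n' b' x := borcherds_linl md_linl md_ev0 act_linl act_linr act_ev0 l m' n' b' x.
have lB2 m' n' a' x := borcherds_linm md_linr md_ev0 act_linl act_linr act_ev0 l m' n' a' x.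
elim/A_elim: a => [|s a a' sa IHa]; first by rewrite (lin0 (lB1 _ _ _ _)) (lin0 pi_lin).
rewrite (linD (lB1 _ _ _ _)) (linD pi_lin) IHa addr0 {a' IHa}.
elim/A_elim: b => [|t b b' tb IHb]; first by rewrite (lin0 (lB2 _ _ _ _)) (lin0 pi_lin).
rewrite (linD (lB2 _ _ _ _)) (linD pi_lin) IHb addr0 {b' IHb}.
have e1 := act_sum_ev0 act_linr act_ev0 l (alpha K l).
have e2 := act_sum_ev0 act_linr act_ev0 l (beta K l).
have e3 := md_sum_ev0 md_ev0 act_linl l.
have [deg0|deg] := eqVneq (s + t - l - m - n - 2) 0; last first.
  rewrite (borcherdsE md act) !(linB pi_lin).
  rewrite /act_sum /md_sum !(nsum_lin pi_lin) //.
  rewrite !(eq_nsum (G := fun=> 0)) ?nsum0 ?subr0 // => i; rewrite (linZ pi_lin).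
  - have dg := md_gr (l + i%:Z) sa tb.
    case: (ltgtP (s + t - l - m - n - 2) 0) => [neg|pos|e].
    + by rewrite (iota_neg _ dg) ?(lin0 pi_lin) ?scaler0 //; lia.
    + by rewrite (pi_pos _ dg) ?scaler0 //; lia.
    + by rewrite e eqxx in deg.
  - by rewrite (pi_two _ tb sa) ?scaler0 //; move: deg; lia.
  - by rewrite (pi_two _ sa tb) ?scaler0 //; move: deg; lia.
(* The defect depends on m + n only: the choice m = s makes every mode of a that
   occurs first kill iota v. *)
rewrite (borcherds_shift (s - m)) (_ : m + (s - m) = s); last lia.
rewrite (_ : n - (s - m) = t - l - 2); last by move: deg0; lia.
rewrite (borcherdsE md act) !(linB pi_lin).
have -> : act_sum act l (beta K l) (t - l - 2) s b a (iota v) = 0.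
  rewrite -[RHS]nsum0; apply: eq_nsum => i.
  by rewrite (iota_neg _ sa) ?(lin0 (act_linr _ _)) ?scaler0 //; lia.
rewrite (lin0 pi_lin) subr0.
have -> : pi (md_sum md act l s (t - l - 2) a b (iota v)) =
    nsum (fun i => binz K s i *: oz (md (l + i%:Z) a b) v).
  rewrite (nsum_lin pi_lin) //; apply: eq_nsum => i; rewrite (linZ pi_lin).
  have dg := md_gr (l + i%:Z) sa tb; congr (_ *: _); rewrite -[RHS]piK -(iota_zero _ dg).
  congr (pi (act _ _ _)); lia.
have [l1|l1] := eqVneq l (-1).
  rewrite /act_sum nsum1 => [|i i0]; last first.
    by rewrite (iota_neg _ tb) ?(lin0 (act_linr _ _)) ?scaler0 //; lia.
  rewrite l1 /alpha expr0 mul1r binz_0 scale1r.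
  rewrite (_ : -1 + s - 0%:Z = s - 1); last lia.
  rewrite (_ : t - -1 - 2 + 0%:Z = t - 1); last lia.
  by rewrite (iota_zero _ tb) (iota_zero _ sa) piK (oz_mul _ _ sa) subrr.
rewrite (oz_vanish _ _ sa) ?subr0; last by move: l_neg l1; lia.
have -> : act_sum act l (alpha K l) s (t - l - 2) a b (iota v) = 0.
  rewrite -[RHS]nsum0; apply: eq_nsum => i.
  by rewrite (iota_neg _ tb) ?(lin0 (act_linr _ _)) ?scaler0 //; move: l_neg l1; lia.
exact: lin0.
Qed.

(** Moving the letter past the others produces words of the same length as [w],
    which [phi] kills. *)
Lemma act_word_move (phi : X -> N) k c w y : linear phi ->
  (forall w', size w' = size w -> phi (act_word w' y) = 0) ->
  phi (act k c (act_word w y)) = phi (act_word w (act k c y)).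
Proof.
elim: w phi => [|[j d] w IH] phi lphi H //=.
rewrite (actC (md := md) act_comm) (linD lphi).
have lphi' : linear (fun x => phi (act j d x)) by exact: lin_comp (act_linr _ _).
rewrite (IH (fun x => phi (act j d x))) // => [|w' sw']; last first.
  by apply: (H ((j, d) :: w')); rewrite /= sw'.
rewrite (nsum_lin lphi); last exact: (act_comm_ev0 md_ev0 act_linl k (fun i => k + j - i%:Z)).
rewrite -[RHS]addr0; congr (_ + _); rewrite -[RHS]nsum0; apply: eq_nsum => i.
by rewrite (linZ lphi) (H ((k + j - i%:Z, md i%:Z c d) :: w)) ?scaler0.
Qed.

(** Only letters of negative degree matter; such a letter can be moved inwards
    until it reaches the defect, where it acts as a derivation and kills the image
    of [iota]. *)
Lemma pi_act_word_borcherds w m n a b v : pi (act_word w (B l m n a b (iota v))) = 0.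
Proof.
move: {2}(size w) (erefl (size w)) => d; elim: d w m n a b => [|d IH] [|[k c] w] m n a b //=.
  by move=> _; exact: pi_borcherds_iota.
move=> [sw]; elim/A_elim: c => [|s c c' sc IHc].
  by rewrite (lin0 (act_linl _ _)) (lin0 pi_lin).
rewrite (linD (act_linl _ _)) (linD pi_lin) IHc addr0 {c' IHc}.
case: (ltgtP (s - k - 1) 0) => [neg|pos|e0]; first last.
- have -> : k = s - 1 by lia.
  by rewrite (pi_zero _ sc) IH // (lin0 (oz_linr _)).
- exact: pi_pos sc pos.
rewrite (act_word_move _ _ pi_lin) => [|w' sw']; last by apply: IH; rewrite sw'.
rewrite (borcherds_act char0 md_linl md_linr md_ev0 md_comm act_linl act_linr act_ev0 act_comm).
have lB m' n' a' b' := borcherds_linr md_ev0 act_linl act_linr act_ev0 l m' n' a' b'.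
rewrite (iota_neg _ sc neg) (lin0 (lB _ _ _ _)) add0r.
have lw := lin_comp pi_lin (act_word_lin w).
have lB1 m' n' b' x := borcherds_linl md_linl md_ev0 act_linl act_linr act_ev0 l m' n' b' x.
have lB2 m' n' a' x := borcherds_linm md_linr md_ev0 act_linl act_linr act_ev0 l m' n' a' x.
rewrite (nsum_lin lw); last first.
  apply: eventually0Z; have [Na Ha] := md_ev0 0 c a; have [Nb Hb] := md_ev0 0 c b.
  exists (maxn Na Nb) => p; rewrite geq_max -[p%:Z]add0r => /andP[Np Mp].
  by rewrite Ha // Hb // (lin0 (lB1 _ _ _ _)) (lin0 (lB2 _ _ _ _)) addr0.
rewrite -[RHS]nsum0; apply: eq_nsum => p.
by rewrite (linZ lw) (linD lw) !IH // addr0 scaler0.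
Qed.

(** The vectors [iota n] generate, and modes act as derivations on defects, so it
    is enough to treat [iota n]; there [pi_separates] reduces the claim to
    [pi_act_word_borcherds]. *)
Lemma borcherds_step m n a b x : B l m n a b x = 0.
Proof.
have lB m' n' a' b' := borcherds_linr md_ev0 act_linl act_linr act_ev0 l m' n' a' b'.
have lB1 m' n' b' y := borcherds_linl md_linl md_ev0 act_linl act_linr act_ev0 l m' n' b' y.
have lB2 m' n' a' y := borcherds_linm md_linr md_ev0 act_linl act_linr act_ev0 l m' n' a' y.
move: x (X_span x) m n a b; apply: lspan_elim => [|e _ x [w [v ->]] IHx] m n a b.
  exact: lin0.
rewrite (lB m n a b) IHx addr0 [X in e *: X](_ : _ = 0) ?scaler0 // {e x IHx}.
elim: w m n a b => [|[k c] w IH] m n a b /=.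
  by apply: pi_separates => w; exact: pi_act_word_borcherds.
have := borcherds_act char0 md_linl md_linr md_ev0 md_comm act_linl act_linr act_ev0
  act_comm l k m n a b c (act_word w (iota v)).
rewrite IH (lin0 (act_linr _ _)) [X in _ + X](_ : _ = 0) ?addr0 // -nsum0.
by apply: eq_nsum => p; rewrite !IH addr0 scaler0.
Qed.

End Step.

(** The commutator formula is the case [l = 0]. [borcherds_recl] climbs to
    positive [l] at once; going down, the defect is determined up to the shift
    [borcherds_shift], and its value in degree zero is the difference of the two
    sides of the composition rule [oz_mul], or of [oz_vanish] when [l < -1]. *)
Theorem borcherds_extension l m n a b x : B l m n a b x = 0.
Proof.
have B0 : forall m n a b x, B 0 m n a b x = 0.
  by move=> *; rewrite borcherds_commutator act_comm subrr.
case: l => l; rewrite ?NegzE; elim: l m n a b x => [|l IH] m n a b x //.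
- rewrite (_ : l.+1%:Z = l%:Z + 1); last lia.
  by rewrite (borcherds_recl char0 md_ev0 act_linl act_linr act_ev0) !IH subrr.
- by apply: borcherds_step => // *; rewrite addNr.
apply: borcherds_step => // m' n' a' b' x'.
by rewrite (_ : - l.+2%:Z + 1 = - l.+1%:Z) //; lia.
Qed.

End BorcherdsExtension.

(** * Zhu's relations on [C(V)] *)

Lemma binz_pole_shift (K : fieldType) (l s : int) i : (forall n, n.+1%:R != 0 :> K) ->
  - (l + i.+1%:Z)%:~R * binz K (s + 1) i.+1
  = - l%:~R * binz K s i.+1 - (l + s + 1)%:~R * binz K s i.
Proof.
move=> char0; have A := binz_absorb char0 (s + 1) i; rewrite addrK in A.
rewrite rmorphD /= -[X in - (_ + X)]/(i.+1%:R) opprD mulrDl mulNr (mulNr i.+1%:R) A.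
by rewrite binz_pascal // !rmorphD /=; ring.
Qed.

Section ZhuCoalgebra.
Variables (K : fieldType) (V : gvoc K).
Hypothesis char0 : forall n, n.+1%:R != 0 :> K.
Local Notation ds := (gc_sum (gvoc_graded V)).
Local Notation one := (one V char0).
Implicit Types f g h : dvoa V.
Local Opaque dmode.

Lemma dual_ext (X : lmodType K) (f g : dual X) : subsp_val f =1 subsp_val g -> f = g.
Proof. by move=> fg; apply: subsp_inj; exact/funext. Qed.

Lemma coact_component_ev0 s t (v : V) : exists N : int, forall k, (N <= k)%R ->
  tmap (hcomp (gr V) s) (hcomp (gr V) t) (coact V k v) = 0.
Proof.
have lT := tmap_linear (hcomp_linear s ds) (hcomp_linear t ds).
elim/(graded_elim ds): v => [|r u v ur [N HN]].
  by exists 0 => k _; rewrite (lin0 (@coact_linear _ _ _)) (lin0 lT).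
exists (Num.max N (s + t - r)) => k; rewrite ge_max => /andP[Nk rk].
rewrite (linD (@coact_linear _ _ _)) (linD lT) HN // addr0.
move: (gc_coact (gvoc_graded V) k ur); apply: lspan_eq0 => // _ [i [x [y [xi yi ->]]]].
rewrite tmap_pure; [|exact: (hcomp_linear _ ds)|exact: (hcomp_linear _ ds)].
rewrite (hcompE ds _ xi) (hcompE ds _ yi).
case: (eqVneq t i) => [ti|]; last by rewrite pure0r.
case: (eqVneq s _) => [si|]; last by rewrite pure0l.
by move: si rk; rewrite -ti; lia.
Qed.

Lemma zhu_res_ev0 j s t (v : V) : eventually0 (fun i => binz K s i *:
   tmap (hcomp (gr V) s) (hcomp (gr V) t) (coact V (i%:Z - j%:Z) v)).
Proof.
apply: eventually0Z; have [N HN] := coact_component_ev0 s t v.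
by exists (`|(N + j%:Z)%R|%N) => i Ni; apply: HN; lia.
Qed.

Lemma reszE (X : lmodType K) s j (F : int -> X) :
  resz s j F = nsum (fun i => binz K s i *: F (i%:Z - j%:Z)).
Proof. by []. Qed.

Lemma zhu_resE j s t (v : V) : zhu_res j v s t = nsum (fun i => binz K s i *:
   tmap (hcomp (gr V) s) (hcomp (gr V) t) (coact V (i%:Z - j%:Z) v)).
Proof. by []. Qed.

Lemma zhu_res_linear j s t : linear (fun v : V => zhu_res j v s t).
Proof.
move=> a u v; rewrite !zhu_resE -nsumZ; last exact: zhu_res_ev0.
rewrite -nsumD; [|exact/eventually0Z/zhu_res_ev0|exact: zhu_res_ev0].
apply: eq_nsum => i; rewrite coact_linear.
by rewrite (tmap_linear (hcomp_linear s ds) (hcomp_linear t ds)) scalerDr !scalerA mulrC.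
Qed.

Lemma zhu_sub_res (v : zhuC V) s t : zhu_res 2 (subsp_val v) s t = 0.
Proof.
case: v => v /= vC; move: v vC; apply: lspan_eq0; first exact: zhu_res_linear.
by move=> v; apply.
Qed.

Lemma dvoa_hcomp s f : f \in dvoa_gr V s ->
  (fun v => subsp_val f (hcomp (gr V) s v)) = subsp_val f.
Proof.
move=> fs; have := rdual_comp_id ds s fs; rewrite eqxx => e.
by transitivity (subsp_val (rdual_comp ds s f)); last by rewrite e.
Qed.

Lemma tpair_zhu_res j s t f g v : f \in dvoa_gr V s -> g \in dvoa_gr V t ->
  tpair (subsp_val f) (subsp_val g) (zhu_res j v s t)
  = subsp_val (nsum (fun i => binz K s i *: dmode (i%:Z - j%:Z) f g)) v.
Proof.
move=> fs gt; have lP := tpair_linear (dvoa_linear f) (dvoa_linear g).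
rewrite zhu_resE (nsum_lin lP); last exact: zhu_res_ev0.
rewrite (nsum_lin (@rdual_eval_linear _ _ _ (gr V) v)); last first.
  apply: eventually0Z; have [N HN] := eventually0_dmode f g (- j%:Z).
  by exists N => i Ni; rewrite addrC HN.
apply: eq_nsum => i; rewrite (linZ lP) tpair_tmap; try exact: dvoa_linear; try exact: (hcomp_linear _ ds).
by rewrite (dvoa_hcomp fs) (dvoa_hcomp gt).
Qed.

Lemma restr_linear : linear (@restr K V).
Proof. by move=> a f g; apply: dual_ext. Qed.

Lemma dmode_nsum_ev0 (s l : int) f g : eventually0 (fun i => binz K s i *: dmode (l + i%:Z) f g).
Proof. exact/eventually0Z/eventually0_dmode. Qed.

(** For [l = -2] this is the defining condition of [C(V)]; translation of [f]
    lowers [l], with the binomial coefficients combining as in [binz_pole_shift]. *)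
Lemma restr_zhu_vanish l s f g : (l <= -2)%R -> f \in dvoa_gr V s ->
  restr (nsum (fun i => binz K s i *: dmode (l + i%:Z) f g)) = 0.
Proof.
move=> l2.
have [n ->] : exists n : nat, l = - 2%:Z - n%:Z by exists (`|(l + 2)%R|%N); lia.
clear l l2; elim: n s f => [|n IH] s f fs.
  have lN : linear (fun g => nsum (fun i => binz K s i *: dmode (- 2%:Z - 0%:Z + i%:Z) f g)).
    move=> a u v; rewrite -nsumZ; last exact: dmode_nsum_ev0.
    rewrite -nsumD; [|exact/eventually0Z/dmode_nsum_ev0|exact: dmode_nsum_ev0].
    by apply: eq_nsum => i; rewrite dmode_linr scalerDr !scalerA mulrC.
  elim/dvoa_elim: g => [|t g g' gt IHg]; first by rewrite (lin0 lN) (lin0 restr_linear).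
  rewrite (linD lN) (linD restr_linear) IHg addr0; apply: dual_ext => v.
  have := tpair_zhu_res 2 (subsp_val v) fs gt.
  rewrite zhu_sub_res (lin0 (tpair_linear (dvoa_linear f) (dvoa_linear g))) => e.
  by rewrite [RHS]e.
have := IH _ _ (dT_gr char0 fs); set l := - 2%:Z - n%:Z => E.
pose F i := dmode (l - 1 + i%:Z) f g.
have eF : eventually0 F by exact: eventually0_dmode.
have e1 (c : nat -> K) : eventually0 (fun i => c i *: F i) by exact: eventually0Z.
have e2 (c : nat -> K) : eventually0 (fun i => c i *: F i.+1).
  exact: eventually0Z (eventually0_shift eF).
have D0 : nsum (fun i => binz K (s + 1) i *: dmode (l + i%:Z) (dT f) g) =
    (- l%:~R) *: nsum (fun i => binz K s i *: F i)
    - (l + s + 1)%:~R *: nsum (fun i => binz K s i *: dmode (l + i%:Z) f g).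
  have -> : nsum (fun i => binz K (s + 1) i *: dmode (l + i%:Z) (dT f) g) =
      nsum (fun i => (- (l + i%:Z)%:~R * binz K (s + 1) i) *: F i).
    apply: eq_nsum => i; rewrite dT_dmode // scalerA rmorphN mulrC.
    by rewrite /F (_ : l + i%:Z - 1 = l - 1 + i%:Z) //; lia.
  rewrite nsum_recl // [X in _ = _ *: X - _]nsum_recl // scalerDr -!nsumZ //; last first.
    exact: dmode_nsum_ev0.
  rewrite -[RHS]addrA -nsumB; first last.
  - exact/eventually0Z/dmode_nsum_ev0.
  - exact/eventually0Z/e2.
  congr (_ + _); first by rewrite !binz_0 scale1r addr0 mulr1.
  apply: eq_nsum => i; rewrite (_ : dmode (l + i%:Z) f g = F i.+1); last first.
    by rewrite /F (_ : l - 1 + i.+1%:Z = l + i%:Z) //; lia.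
  by rewrite !scalerA -scalerBl (binz_pole_shift _ _ _ char0).
have l0 : - l%:~R != 0 :> K by rewrite oppr_eq0 (intr_neq0 char0) // /l; lia.
have key (A B C : dvoa V) : A = (- l%:~R) *: B - (l + s + 1)%:~R *: C ->
    restr A = 0 -> restr C = 0 -> restr B = 0.
  move=> -> ; rewrite (linB restr_linear) !(linZ restr_linear) => /[swap] ->.
  by rewrite scaler0 subr0 -[X in _ = X -> _](scaler0 _ (- l%:~R)) => /(scalerI l0).
have := key _ _ _ D0 E (IH _ _ fs).
rewrite (_ : (fun i => binz K s i *: F i)
           = (fun i => binz K s i *: dmode (- 2%:Z - n.+1%:Z + i%:Z) f g)) //.
by apply/funext => i; rewrite /F (_ : l - 1 + i%:Z = - 2%:Z - n.+1%:Z + i%:Z) // /l; lia.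
Qed.

(** The relation [restr_zhu_vanish] against the vacuum: on [C(V)] translation is
    minus the weight. *)
Lemma restr_dT s f : f \in dvoa_gr V s -> restr (dT f) = (- s)%:~R *: restr f.
Proof.
move=> fs; have := restr_zhu_vanish one (lexx _) fs.
have e i : dmode (-2 + i.+2%:Z) f one = 0 by rewrite dmode_one //; lia.
rewrite nsum_recl; last exact: dmode_nsum_ev0.
rewrite nsum1 => [|[|i] // _]; last by rewrite e scaler0.
have b1 : binz K s 1 = s%:~R.
  by have := binz_step char0 s 0; rewrite binz_0 mul1r mulr1 subr0.
rewrite binz_0 scale1r b1 addr0 (_ : -2 + 1%:Z = -1) // dmodeN1_one => H.
have eT : dT f = dmode (-2) f one.
  by have := dT_dmode char0 (-1) f one; rewrite dmodeN1_one opprK scale1r.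
apply/eqP; rewrite -subr_eq0 eT rmorphN scaleNr opprK; apply/eqP.
by rewrite -H (linD restr_linear) (linZ restr_linear).
Qed.

Lemma restr_dTpow i s f : f \in dvoa_gr V s ->
  restr (dTpow char0 i f) = binz K (- s) i *: restr f.
Proof.
elim: i s f => [|i IH] s f fs; first by rewrite dTpow0 binz_0 scale1r.
apply: (scalerI (char0 i)).
rewrite -(linZ restr_linear) dTpowS (IH _ _ (dT_gr char0 fs)) (restr_dT fs).
rewrite !scalerA (binz_absorb char0) mulrC (_ : - (s + 1) = - s - 1) //; lia.
Qed.

Lemma dmode_ev0N1 f g : eventually0 (fun i => dmode (-1 + i%:Z) f g).
Proof. exact: eventually0_dmode. Qed.

(** Skew-symmetry expresses the product of [g] and [f] through translates of the
    modes of [f] on [g], and translation is a scalar on [C(V)]. *)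
Lemma restr_zhu_product_rev s t f g : f \in dvoa_gr V s -> g \in dvoa_gr V t ->
  restr (nsum (fun j => binz K t j *: dmode (-1 + j%:Z) g f))
  = restr (nsum (fun r => binz K (s - 1) r *: dmode (-1 + r%:Z) f g)).
Proof.
move=> fs gt; pose y r := restr (dmode (-1 + r%:Z) f g).
have ey : eventually0 y := eventually0_lin restr_linear (dmode_ev0N1 f g).
have yE r q : restr (dTpow char0 q (dmode (-1 + r%:Z) f g)) =
     binz K (r%:Z - s - t) q *: y r.
  rewrite (restr_dTpow q (dmode_gr _ fs gt)); congr (binz K _ _ *: _); lia.
have skew j : restr (dmode (-1 + j%:Z) g f) =
    nsum (fun q => ((-1) ^+ (j + q) * binz K ((j + q)%N%:Z - s - t) q) *: y (j + q)%N).
  rewrite (dmode_skewT char0) -nsumN; last first.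
    apply: eventually0Z; have [N HN] := eventually0_dmode f g (-1 + j%:Z).
    by exists N => i Ni; rewrite HN // (lin0 (dTpow_linear _ _)).
  rewrite (nsum_lin restr_linear); last first.
    apply: eventually0N; apply: eventually0Z.
    have [N HN] := eventually0_dmode f g (-1 + j%:Z).
    by exists N => i Ni; rewrite HN // (lin0 (dTpow_linear _ _)).
  apply: eq_nsum => q; rewrite (linN restr_linear) (linZ restr_linear).
  rewrite (_ : -1 + j%:Z + q%:Z = -1 + (j + q)%N%:Z); last lia.
  rewrite yE scalerA -scaleNr; congr (_ *: _).
  rewrite expfzDr ?oppr_eq0 ?oner_eq0 // exprN1 invrN1 exprD.
  by rewrite !mulN1r !mulNr opprK.
pose G j q := (binz K t j * ((-1) ^+ (j + q) * binz K ((j + q)%N%:Z - s - t) q)) *: y (j + q)%N.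
have bG : bounded2 G.
  by case: ey => N HN; exists N => j q jq; rewrite /G HN ?scaler0 //; lia.
rewrite (nsum_lin restr_linear); last exact: dmode_nsum_ev0.
rewrite (nsum_lin restr_linear); last exact: dmode_nsum_ev0.
transitivity (nsum (fun j => nsum (G j))).
  apply: eq_nsum => j; rewrite (linZ restr_linear) skew -nsumZ.
    by apply: eq_nsum => q; rewrite scalerA.
  by case: ey => N HN; exists N => q Nq; rewrite HN ?scaler0 //; lia.
rewrite -nsum_antidiag //; apply: eq_nsum => r; rewrite (linZ restr_linear) -/(y r).
transitivity ((\sum_(j < r.+1) (-1) ^+ r * (binz K t j * binz K (r%:Z - s - t) (r - j)%N)) *: y r).
  rewrite scaler_suml; apply: eq_bigr => j _; rewrite /G subnKC; last by rewrite -ltnS.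
  by rewrite mulrCA.
rewrite -mulr_sumr (binz_vandermonde char0) (_ : t + _ = - (s - r%:Z)); last lia.
rewrite binz_neg mulrA -expr2 sqrr_sign mul1r; congr (binz K _ _ *: _); lia.
Qed.

(** By Pascal's rule, the two products differ by modes with nonnegative index, the
    ones that occur in the bracket of degree-zero elements. *)
Lemma restr_zhu_commutator s t f g : f \in dvoa_gr V s -> g \in dvoa_gr V t ->
  restr (nsum (fun i => binz K s i *: dmode (-1 + i%:Z) f g))
  - restr (nsum (fun j => binz K t j *: dmode (-1 + j%:Z) g f))
  = restr (nsum (fun i => binz K (s - 1) i *: dmode i%:Z f g)).
Proof.
move=> fs gt; rewrite (restr_zhu_product_rev fs gt) -(linB restr_linear); congr restr.
rewrite -nsumB; [|exact: dmode_nsum_ev0|exact: dmode_nsum_ev0].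
have ev : eventually0 (fun i => binz K s i *: dmode (-1 + i%:Z) f g
   - binz K (s - 1) i *: dmode (-1 + i%:Z) f g).
  by apply: eventually0D; [|apply: eventually0N]; exact: dmode_nsum_ev0.
rewrite nsum_recl // !binz_0 subrr add0r; apply: eq_nsum => i.
rewrite -scalerBl (_ : -1 + i.+1%:Z = i%:Z); last lia.
by have := binz_pascal char0 (s - 1) i; rewrite subrK => ->; rewrite addrAC subrr add0r.
Qed.

Lemma restr_zhuO f : f \in zhuO V -> restr f = 0.
Proof.
move: f; apply: lspan_eq0; first exact: restr_linear.
move=> _ [s [f [g [fs ->]]]]; rewrite reszE -(restr_zhu_vanish g (lexx _) fs).
congr restr; apply: eq_nsum => i; rewrite (_ : i%:Z - 2%:Z = -2 + i%:Z) //; lia.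
Qed.

(** The choice of a representative in [zhuPhi] is harmless, because [O(V')]
    vanishes on [C(V)]. *)
Lemma zhuPhi_qpi f : zhuPhi (qpi (zhuO V) f) = restr f.
Proof.
apply/eqP; rewrite -subr_eq0 -(linB restr_linear); apply/eqP/restr_zhuO.
by apply/qpi_eq; rewrite qreprK.
Qed.

End ZhuCoalgebra.

Section ZhuModule.
Variables (K : fieldType) (V : gvoc K) (M : lmodType K).
Hypothesis char0 : forall n, n.+1%:R != 0 :> K.
Variable DM : {linear M -> tensor (zhuC V) M}.
Hypothesis hDM : zhu_comodule DM.
Local Notation ds := (gc_sum (gvoc_graded V)).
Implicit Types (f g h : dvoa V) (n : dual M).
Local Opaque dmode.

Definition zero_mode f n : dual M := zhu_act DM (restr f) n.

Lemma zhu_act_linl n : linear (fun p : dual (zhuC V) => zhu_act DM p n).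
Proof.
move=> a p q; apply: dual_ext => m.
exact: (tpair_linl _ _ (dual_linear p) (dual_linear q) (dual_linear n)).
Qed.

Lemma zhu_act_linr p : linear (zhu_act DM p).
Proof.
move=> a n n'; apply: dual_ext => m.
exact: (tpair_linr _ _ (dual_linear p) (dual_linear n) (dual_linear n')).
Qed.

Lemma zero_mode_linl n : linear (fun f => zero_mode f n).
Proof. exact: lin_comp (zhu_act_linl n) (@restr_linear _ _). Qed.

Lemma zero_mode_linr f : linear (zero_mode f).
Proof. exact: zhu_act_linr. Qed.

Lemma zero_mode_one n : zero_mode (one V char0) n = n.
Proof.
apply: dual_ext => m.
have lc : linear (fun v : zhuC V => counit V (subsp_val v) : K^o).
  exact: lin_comp (@counit_linear _ _) (@subsp_val_linear _ _ _).
rewrite -[in RHS](zm_counit hDM m) -tpair_contrl //; exact: dual_linear.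
Qed.

(** By coassociativity, acting twice on [M] is acting once through the
    comultiplication of [C(V)], which is dual to the product of the Zhu algebra. *)
Lemma zero_mode_mul s f g n : f \in dvoa_gr V s ->
  zero_mode f (zero_mode g n) = nsum (fun i => binz K s i *: zero_mode (dmode (-1 + i%:Z) f g) n).
Proof.
move=> fs.
have lz := zero_mode_linl.
have eN g' : eventually0 (fun i => binz K s i *: zero_mode (dmode (-1 + i%:Z) f g') n).
  exact/eventually0Z/(eventually0_lin (lz n))/eventually0_dmode.
have lR : linear (fun g => nsum (fun i => binz K s i *: zero_mode (dmode (-1 + i%:Z) f g) n)).
  move=> a u v; rewrite -nsumZ // -nsumD //; last exact/eventually0Z/eN.
  by apply: eq_nsum => i; rewrite dmode_linr lz scalerDr !scalerA mulrC.
have lL : linear (fun g => zero_mode f (zero_mode g n)).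
  exact: lin_comp (zero_mode_linr f) (lz n).
move: g; apply: (rdual_extg ds lL lR) => t g gt.
rewrite (eq_nsum (G := fun i => zero_mode (binz K s i *: dmode (-1 + i%:Z) f g) n)); last first.
  by move=> i; rewrite (linZ (lz n)).
rewrite -(nsum_lin (lz n)); last exact: dmode_nsum_ev0.
apply: dual_ext => m.
have lf := dvoa_linear f; have lg := dvoa_linear g; have ln := dual_linear n.
have lhs := hcomp_linear s ds; have lht := hcomp_linear t ds.
have lv : linear (@subsp_val K V (zhu_sub V)) by [].
have lrf := dual_linear (restr f); have lrg := dual_linear (restr g).
have lDM : linear DM by exact: lin_linear.
have lhsv : linear (fun v : zhuC V => hcomp (gr V) s (subsp_val v)) by exact: (lin_comp lhs lv).
have lhtv : linear (fun v : zhuC V => hcomp (gr V) t (subsp_val v)) by exact: (lin_comp lht lv).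
have lfg := tpair_linear lf lg.
have lz1 : linear (fun v : zhuC V => zhu_res 1 (subsp_val v) s t).
  exact: (lin_comp (zhu_res_linear 1 s t) lv).
have ef : subsp_val (restr f) = (fun v => subsp_val f (hcomp (gr V) s (subsp_val v))).
  apply/funext => v; exact: (esym (congr1 (fun q => q (subsp_val v)) (dvoa_hcomp fs))).
have eg : subsp_val (restr g) = (fun v => subsp_val g (hcomp (gr V) t (subsp_val v))).
  apply/funext => v; exact: (esym (congr1 (fun q => q (subsp_val v)) (dvoa_hcomp gt))).
have eR : subsp_val (restr (nsum (fun i => binz K s i *: dmode (-1 + i%:Z) f g)))
    = (fun v => tpair (subsp_val f) (subsp_val g) (zhu_res 1 (subsp_val v) s t)).
  apply/funext => v; rewrite (tpair_zhu_res 1 _ fs gt).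
  by rewrite -(eq_nsum (F := fun i => binz K s i *: dmode (-1 + i%:Z) f g)).
change (tpair (subsp_val (restr f))
  (fun x => tpair (subsp_val (restr g)) (subsp_val n) (DM x)) (DM m) =
  tpair (subsp_val (restr (nsum (fun i => binz K s i *: dmode (-1 + i%:Z) f g))))
    (subsp_val n) (DM m)).
rewrite -tpair_assoc // ef eg eR.
have -> : tpair (fun v : zhuC V => subsp_val f (hcomp (gr V) s (subsp_val v)))
  (fun v => subsp_val g (hcomp (gr V) t (subsp_val v))) =
  (fun p => tpair (subsp_val f) (subsp_val g)
    (tmap (fun v : zhuC V => hcomp (gr V) s (subsp_val v))
          (fun v : zhuC V => hcomp (gr V) t (subsp_val v)) p)).
  by apply/funext => p; rewrite tpair_tmap.
rewrite -[LHS](tpair_tmap _ lfg ln (tmap_linear lhsv lhtv) (@lin_id' _ _)).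
by rewrite -(zm_coassoc hDM) tpair_tmap.
Qed.

Lemma zero_mode_nsum (F : nat -> dvoa V) n : eventually0 F ->
  zero_mode (nsum F) n = nsum (fun i => zero_mode (F i) n).
Proof. exact: nsum_lin (zero_mode_linl n). Qed.

Lemma zero_mode_vanish l s f g n : f \in dvoa_gr V s -> (l <= -2)%R ->
  nsum (fun i => binz K s i *: zero_mode (dmode (l + i%:Z) f g) n) = 0.
Proof.
move=> fs l2.
rewrite (eq_nsum (G := fun i => zero_mode (binz K s i *: dmode (l + i%:Z) f g) n)).
  rewrite -zero_mode_nsum; last exact: dmode_nsum_ev0.
  by rewrite /zero_mode (restr_zhu_vanish char0) // (lin0 (zhu_act_linl n)).
by move=> i; rewrite (linZ (zero_mode_linl n)).
Qed.

Lemma zero_mode_commutator s t f g n : f \in dvoa_gr V s -> g \in dvoa_gr V t ->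
  zero_mode f (zero_mode g n) - zero_mode g (zero_mode f n)
  = nsum (fun i => binz K (s - 1) i *: zero_mode (dmode i%:Z f g) n).
Proof.
move=> fs gt; rewrite (zero_mode_mul _ _ fs) (zero_mode_mul _ _ gt).
have E (c : nat -> K) (F : nat -> dvoa V) : eventually0 F ->
    nsum (fun i => c i *: zero_mode (F i) n) = zhu_act DM (restr (nsum (fun i => c i *: F i))) n.
  move=> eF; rewrite -/(zero_mode _ n) zero_mode_nsum; last exact: eventually0Z.
  by apply: eq_nsum => i; rewrite (linZ (zero_mode_linl n)).
have e0 : eventually0 (fun i => dmode i%:Z f g).
  have [N HN] := eventually0_dmode f g 0.
  by exists N => i Ni; rewrite -[i%:Z]add0r HN.
rewrite !E //; try exact: eventually0_dmode.
by rewrite -(linB (zhu_act_linl n)) (restr_zhu_commutator char0 fs gt).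
Qed.

End ZhuModule.

(** * The bracket on modes *)

Section FreeModuleFacts.
Variables (K : fieldType) (T : choiceType) (X : lmodType K).

Lemma freemod_elim (P : freemod K T -> Prop) : P 0 ->
  (forall a t x, P x -> P (a *: fbasis K t + x)) -> forall x, P x.
Proof.
move=> P0 PS x; move: x (freemod_span x); apply: lspan_elim => // a _ y [t _ <-].
exact: PS.
Qed.

Lemma fext_lin (b : T -> X) : linear (fext b).
Proof. exact: fext_linear. Qed.

Lemma fext_comb (b b' b'' : T -> X) a x : (forall t, b'' t = a *: b t + b' t) ->
  fext b'' x = a *: fext b x + fext b' x.
Proof.
move=> bE; elim/freemod_elim: x => [|c t x IH].
  by rewrite !(lin0 (fext_lin _)) scaler0 addr0.
rewrite !(linD (fext_lin _)) !(linZ (fext_lin _)) !fext_basis IH bE.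
rewrite !scalerDr !scalerA [c * a]mulrC -!addrA; congr (_ + _).
by rewrite addrCA.
Qed.

End FreeModuleFacts.

Lemma nsum_mem (K : fieldType) (X : lmodType K) (S : submodClosed X) (F : nat -> X) :
  eventually0 F -> (forall i, F i \in S) -> nsum F \in S.
Proof. by move=> [N HN] FS; rewrite (nsumE HN) rpred_sum. Qed.

Section LoopLie.
Variables (K : fieldType) (V : gvoc K).
Hypothesis char0 : forall n, n.+1%:R != 0 :> K.
Implicit Types (f g h : dvoa V) (m n : int).
Local Opaque dmode.

Lemma loop_elim (P : loop V -> Prop) : P 0 ->
  (forall f m x, P x -> P (pure f (tpow K m) + x)) -> forall x, P x.
Proof.
move=> P0 PS; apply: tensor_elim => // f q t Pt.
elim/freemod_elim: q => [|a m q IH]; first by rewrite pure0r add0r.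
rewrite pureDr pureZr -pureZl -addrA; exact: PS.
Qed.

Lemma loop_ext (X : lmodType K) (F G : loop V -> X) : linear F -> linear G ->
  (forall f m, F (pure f (tpow K m)) = G (pure f (tpow K m))) -> F =1 G.
Proof.
move=> lF lG FG; elim/loop_elim => [|f m x IH]; first by rewrite !lin0.
by rewrite (linD lF) (linD lG) FG IH.
Qed.

Lemma ddt_linear : linear (@ddt K).
Proof. exact: fext_lin. Qed.

Lemma ddt_tpow m : ddt (tpow K m) = m%:~R *: tpow K (m - 1).
Proof. exact: fext_basis. Qed.

Lemma loopD_linear : linear (@loopD K V).
Proof.
move=> a x y; rewrite /loopD.
rewrite (tmap_linear (dmode_linr 0 (omega V)) (@lin_id' _ _)).
by rewrite (tmap_linear (@lin_id' _ _) ddt_linear) scalerDr addrACA.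
Qed.

Lemma loopD_pure f m :
  loopD (pure f (tpow K m)) = pure (dT f) (tpow K m) + m%:~R *: pure f (tpow K (m - 1)).
Proof.
rewrite /loopD (tmap_pure _ _ (dmode_linr 0 (omega V)) (@lin_id' _ _)).
by rewrite (tmap_pure _ _ (@lin_id' _ _) ddt_linear) ddt_tpow pureZr.
Qed.

Lemma loopD_span x : x \in lspan (range (@loopD K V)) -> exists y, x = loopD y.
Proof.
move: x; apply: lspan_elim; first by exists 0; rewrite (lin0 loopD_linear).
by move=> a _ _ [y _ <-] [z ->]; exists (a *: y + z); rewrite loopD_linear.
Qed.

Lemma qhat_linear : linear (qpi (lspan (range (@loopD K V)))).
Proof. exact: qpi_linear. Qed.

Lemma qhat_loopD x : qpi (lspan (range (@loopD K V))) (loopD x) = 0.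
Proof.
rewrite -(lin0 qhat_linear); apply/qpi_eq; rewrite subr0; apply: mem_lspan.
by exists x.
Qed.

Lemma hat_elt_linear m : linear (fun f => hat_elt f m).
Proof. by move=> a f g; rewrite /hat_elt pureDl pureZl qhat_linear. Qed.

Lemma hat_elt_dT f m : hat_elt (dT f) m = (- m)%:~R *: hat_elt f (m - 1).
Proof.
apply/eqP; rewrite rmorphN scaleNr -addr_eq0 /hat_elt -(linZ qhat_linear).
by rewrite -(linD qhat_linear) -loopD_pure qhat_loopD.
Qed.

Lemma hat_elt_dTpow q f m : hat_elt (dTpow char0 q f) m =
  ((-1) ^+ q * binz K m q) *: hat_elt f (m - q%:Z).
Proof.
elim: q f m => [|q IH] f m; first by rewrite dTpow0 binz_0 mulr1 scale1r subr0.
apply: (scalerI (char0 q)); rewrite -(linZ (hat_elt_linear m)) dTpowS IH.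
rewrite hat_elt_dT !scalerA (_ : m - q%:Z - 1 = m - q.+1%:Z); last lia.
congr (_ *: _); have S := binz_step char0 m q; rewrite exprS rmorphN.
transitivity (- (-1) ^+ q * ((m - q%:Z)%:~R * binz K m q)); first by ring.
by rewrite -S; ring.
Qed.

Lemma hat_elim (P : hat V -> Prop) : P 0 ->
  (forall s f m x, f \in dvoa_gr V s -> P x -> P (hat_elt f m + x)) -> forall x, P x.
Proof.
move=> P0 PS x; rewrite -[x]qreprK.
elim/loop_elim: (qrepr x) => [|f m y IH]; first by rewrite (lin0 qhat_linear).
rewrite (linD qhat_linear) -/(hat_elt f m).
elim/dvoa_elim: f => [|s f g fs IHf]; first by rewrite (lin0 (hat_elt_linear m)) add0r.
by rewrite (linD (hat_elt_linear m)) -addrA; apply: PS fs IHf.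
Qed.

Lemma hat_ext (X : lmodType K) (F G : hat V -> X) : linear F -> linear G ->
  (forall s f m, f \in dvoa_gr V s -> F (hat_elt f m) = G (hat_elt f m)) -> F =1 G.
Proof.
move=> lF lG FG; elim/hat_elim => [|s f m x fs IH]; first by rewrite !lin0.
by rewrite (linD lF) (linD lG) (FG _ _ _ fs) IH.
Qed.

Section Lift.
Variables (X : lmodType K) (phi : dvoa V -> int -> X).
Hypothesis phi_lin : forall m, linear (fun f => phi f m).
Hypothesis phi_dT : forall f m, phi (dT f) m = (- m)%:~R *: phi f (m - 1).

Definition loop_lift : loop V -> X := tlift (fun f (q : laurent K) => fext (phi f) q).

Lemma loop_lift_bilin : bilin (fun f (q : laurent K) => fext (phi f) q).
Proof.
split=> [q a f g|f]; last exact: fext_lin.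
by apply: fext_comb => m; rewrite phi_lin.
Qed.

(** Linear maps out of the space of modes are given by families that respect
    translation. *)
Definition hat_lift (x : hat V) : X := loop_lift (qrepr x).

Lemma hat_lift_qpi x : hat_lift (qpi _ x) = loop_lift x.
Proof.
have ll : linear loop_lift by exact: tlift_linear loop_lift_bilin.
apply/eqP; rewrite -subr_eq0 -(linB ll); apply/eqP.
have /loopD_span[y ->] : qrepr (qpi (lspan (range (@loopD K V))) x) - x
    \in lspan (range (@loopD K V)) by apply/qpi_eq; rewrite qreprK.
elim/loop_elim: y => [|f m y IH]; first by rewrite (lin0 loopD_linear) (lin0 ll).
rewrite (linD loopD_linear) (linD ll) IH addr0 loopD_pure (linD ll) (linZ ll).
rewrite /loop_lift !(tlift_pure _ _ loop_lift_bilin) !fext_basis phi_dT.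
by rewrite -scalerDl rmorphN addNr scale0r.
Qed.

Lemma hat_lift_linear : linear hat_lift.
Proof.
have ll : linear loop_lift by exact: tlift_linear loop_lift_bilin.
move=> a x y; rewrite -[x]qreprK -[y]qreprK -qhat_linear.
by rewrite !hat_lift_qpi ll.
Qed.

Lemma hat_liftE f m : hat_lift (hat_elt f m) = phi f m.
Proof. by rewrite hat_lift_qpi /loop_lift (tlift_pure _ _ loop_lift_bilin) fext_basis. Qed.

End Lift.

Definition loop_coef f m g n : loop V :=
  nsum (fun i => binz K m i *: pure (dmode i%:Z f g) (tpow K (m + n - i%:Z))).

Lemma dmode0_ev0 f g : eventually0 (fun i => dmode i%:Z f g).
Proof.
have [N HN] := eventually0_dmode f g 0.
by exists N => i Ni; rewrite -[i%:Z]add0r HN.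
Qed.

Lemma loop_coef_ev0 (c : nat -> K) (F : nat -> int) f g :
  eventually0 (fun i => c i *: pure (dmode i%:Z f g) (tpow K (F i)) : loop V).
Proof.
by apply: eventually0Z; have [N HN] := dmode0_ev0 f g; exists N => i Ni; rewrite HN // pure0l.
Qed.

Lemma loop_coef_linl m g n : linear (fun f => loop_coef f m g n).
Proof.
move=> a f f'; rewrite /loop_coef -nsumZ; last exact: loop_coef_ev0.
rewrite -nsumD; [|exact/eventually0Z/loop_coef_ev0|exact: loop_coef_ev0].
by apply: eq_nsum => i; rewrite dmode_linl pureDl pureZl scalerDr !scalerA mulrC.
Qed.

Lemma loop_coef_linr m f n : linear (fun g => loop_coef f m g n).
Proof.
move=> a g g'; rewrite /loop_coef -nsumZ; last exact: loop_coef_ev0.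
rewrite -nsumD; [|exact/eventually0Z/loop_coef_ev0|exact: loop_coef_ev0].
by apply: eq_nsum => i; rewrite dmode_linr pureDl pureZl scalerDr !scalerA mulrC.
Qed.

Definition loop_form f (p : laurent K) g (q : laurent K) : loop V :=
  fext (fun m => fext (fun n => loop_coef f m g n) q) p.

Lemma loop_bracketE (x y : loop V) :
  loop_bracket x y = tlift (fun f p => tlift (fun g q => loop_form f p g q) y) x.
Proof. by []. Qed.

Lemma loop_form_bilinr f p : bilin (loop_form f p).
Proof.
split=> [q a g g'|g a q q']; apply: fext_comb => m.
  by apply: fext_comb => n; rewrite loop_coef_linr.
exact: fext_lin.
Qed.

Lemma loop_form_bilinl (y : loop V) : bilin (fun f p => tlift (fun g q => loop_form f p g q) y).
Proof.
split=> [p a f f'|f a p p']; elim/loop_elim: y => [|g n y IH];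
  rewrite ?(lin0 (tlift_linear (loop_form_bilinr _ _))) ?scaler0 ?addr0 //;
  rewrite !(linD (tlift_linear (loop_form_bilinr _ _))) IH;
  rewrite !(tlift_pure _ _ (loop_form_bilinr _ _)) scalerDr addrACA; congr (_ + _).
  apply: fext_comb => m; rewrite !fext_basis; exact: loop_coef_linl.
exact: fext_lin.
Qed.

Lemma loop_bracket_linl (y : loop V) : linear (fun x : loop V => loop_bracket x y).
Proof. exact: tlift_linear (loop_form_bilinl y). Qed.

Lemma loop_bracket_linr (x : loop V) : linear (loop_bracket x).
Proof.
move=> a y z; elim/loop_elim: x => [|f m x IH].
  by rewrite !(lin0 (loop_bracket_linl _)) scaler0 addr0.
rewrite !(linD (loop_bracket_linl _)) IH scalerDr addrACA; congr (_ + _).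
rewrite !loop_bracketE !(tlift_pure _ _ (loop_form_bilinl _)).
exact: tlift_linear (loop_form_bilinr _ _) _ _ _.
Qed.

Lemma loop_bracket_pure f m g n :
  loop_bracket (pure f (tpow K m)) (pure g (tpow K n)) = loop_coef f m g n.
Proof.
rewrite loop_bracketE (tlift_pure _ _ (loop_form_bilinl _)).
by rewrite (tlift_pure _ _ (loop_form_bilinr _ _)) /loop_form !fext_basis.
Qed.

Lemma hat_sum_ev0 (c : nat -> K) (F : nat -> int) f g :
  eventually0 (fun i => c i *: hat_elt (dmode i%:Z f g) (F i)).
Proof.
apply: eventually0Z; have [N HN] := dmode0_ev0 f g.
by exists N => i Ni; rewrite HN // (lin0 (hat_elt_linear _)).
Qed.

Lemma qhat_coef f m g n : qpi (lspan (range (@loopD K V))) (loop_coef f m g n)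
  = nsum (fun i => binz K m i *: hat_elt (dmode i%:Z f g) (m + n - i%:Z)).
Proof.
rewrite (nsum_lin qhat_linear); last exact: loop_coef_ev0.
by apply: eq_nsum => i; rewrite (linZ qhat_linear).
Qed.

(** Translation terms form an ideal for the bracket, so that it descends to the
    quotient; the two terms of [loopD_pure] cancel by [binz_absorb]. *)
Lemma qhat_bracket_Dl (x y : loop V) : qpi (lspan (range (@loopD K V))) (loop_bracket (loopD x) y) = 0.
Proof.
have lq := qhat_linear.
move: x; apply: (loop_ext (G := fun=> 0)) => [||f m].
- exact: lin_comp lq (lin_comp (loop_bracket_linl y) loopD_linear).
- by move=> a u v; rewrite scaler0 addr0.
move: y; apply: (loop_ext (G := fun=> 0)) => [||g n].
- exact: lin_comp lq (loop_bracket_linr _).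
- by move=> a u v; rewrite scaler0 addr0.
rewrite loopD_pure (linD (loop_bracket_linl _)) (linZ (loop_bracket_linl _)).
rewrite !loop_bracket_pure (linD lq) (linZ lq) !qhat_coef -nsumZ; last exact: hat_sum_ev0.
rewrite nsum_recl; last exact: hat_sum_ev0.
rewrite dT_dmode // oppr0 scale0r (lin0 (hat_elt_linear _)) scaler0 add0r -nsumD.
- rewrite -[RHS]nsum0; apply: eq_nsum => i.
  rewrite dT_dmode // (linZ (hat_elt_linear _)) !scalerA (_ : i.+1%:Z - 1 = i%:Z); last lia.
  rewrite (_ : m - 1 + n - i%:Z = m + n - i.+1%:Z); last lia.
  rewrite -scalerDl -(binz_absorb char0) rmorphN mulrN mulrC addNr scale0r //.
- exact: eventually0_shift (hat_sum_ev0 (binz K m) (fun i => m + n - i%:Z) (dT f) g).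
- exact/eventually0Z/hat_sum_ev0.
Qed.

Lemma qhat_bracket_Dr (x y : loop V) : qpi (lspan (range (@loopD K V))) (loop_bracket x (loopD y)) = 0.
Proof.
have lq := qhat_linear.
move: x; apply: (loop_ext (G := fun=> 0)) => [||f m].
- exact: lin_comp lq (loop_bracket_linl _).
- by move=> a u v; rewrite scaler0 addr0.
move: y; apply: (loop_ext (G := fun=> 0)) => [||g n].
- exact: lin_comp lq (lin_comp (loop_bracket_linr _) loopD_linear).
- by move=> a u v; rewrite scaler0 addr0.
rewrite loopD_pure (linD (loop_bracket_linr _)) (linZ (loop_bracket_linr _)).
rewrite !loop_bracket_pure (linD lq) (linZ lq) !qhat_coef -nsumZ; last exact: hat_sum_ev0.
pose y i := hat_elt (dmode i%:Z f g) (m + n - 1 - i%:Z).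
have ey (c : nat -> K) : eventually0 (fun i => c i *: y i) by exact: hat_sum_ev0.
have E i : hat_elt (dmode i%:Z f (dT g)) (m + n - i%:Z) =
   (- (m + n - i%:Z)%:~R) *: y i + (if i is i'.+1 then i%:R *: y i' else 0).
  have -> : dmode i%:Z f (dT g) = dT (dmode i%:Z f g) - dmode i%:Z (dT f) g.
    by rewrite dmode_dT addrC addKr.
  rewrite (linB (hat_elt_linear _)) hat_elt_dT rmorphN dT_dmode // (linZ (hat_elt_linear _)).
  rewrite /y (_ : m + n - i%:Z - 1 = m + n - 1 - i%:Z); last lia.
  congr (_ + _); rewrite rmorphN scaleNr opprK; case: i => [|i]; first by rewrite scale0r.
  rewrite (_ : i.+1%:Z - 1 = i%:Z); last lia.
  by rewrite (_ : m + n - i.+1%:Z = m + n - 1 - i%:Z) //; lia.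
pose z i := if i is i'.+1 then (binz K m i * i%:R) *: y i' else 0.
have ez : eventually0 z.
  by have [N HN] := ey (fun i => binz K m i.+1 * i.+1%:R); exists N.+1 => -[|i] // Ni; exact: HN.
have -> : nsum (fun i => binz K m i *: hat_elt (dmode i%:Z f (dT g)) (m + n - i%:Z)) =
  nsum (fun i => (binz K m i * - (m + n - i%:Z)%:~R) *: y i) + nsum z.
  rewrite -(nsumD (ey _) ez); apply: eq_nsum => i; rewrite E scalerDr scalerA; congr (_ + _).
  by case: i => [|i]; rewrite ?scaler0 // scalerA.
rewrite [nsum z](nsum_recl ez) add0r.
have eA := ey (fun i => binz K m i * - (m + n - i%:Z)%:~R).
have ez' := eventually0_shift ez.
have ed : eventually0 (fun i => n%:~R *: (binz K m i *: hat_elt (dmode i%:Z f g) (m + (n - 1) - i%:Z))).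
  exact/eventually0Z/hat_sum_ev0.
rewrite -(nsumD eA ez') -(nsumD (eventually0D eA ez') ed).
rewrite -[RHS]nsum0; apply: eq_nsum => i; rewrite /z /y (addrA m n).
rewrite scalerA -!scalerDl [X in X *: _](_ : _ = 0) ?scale0r //.
have := binz_step char0 m i; rewrite [i.+1%:R * _]mulrC => ->.
by rewrite !rmorphB !rmorphD /=; ring.
Qed.

Lemma hat_bracket_qpi (x y : loop V) : hat_bracket (qpi _ x) (qpi _ y)
  = qpi (lspan (range (@loopD K V))) (loop_bracket x y).
Proof.
have lq := qhat_linear.
have D z : exists u, qrepr (qpi (lspan (range (@loopD K V))) z) = z + loopD u.
  have /loopD_span[u e] : qrepr (qpi (lspan (range (@loopD K V))) z) - z
    \in lspan (range (@loopD K V)) by apply/qpi_eq; rewrite qreprK.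
  by exists u; rewrite -e addrC subrK.
rewrite /hat_bracket; have [u ->] := D x; have [v ->] := D y.
rewrite (linD (loop_bracket_linl _)) (linD lq) qhat_bracket_Dl addr0.
by rewrite (linD (loop_bracket_linr _)) (linD lq) qhat_bracket_Dr addr0.
Qed.

Lemma hat_bracket_linl (y : hat V) : linear (fun x : hat V => hat_bracket x y).
Proof.
move=> a x x'; rewrite -[x]qreprK -[x']qreprK -[y]qreprK -qhat_linear !hat_bracket_qpi.
by rewrite loop_bracket_linl qhat_linear.
Qed.

Lemma hat_bracket_linr (x : hat V) : linear (hat_bracket x).
Proof.
move=> a y y'; rewrite -[x]qreprK -[y]qreprK -[y']qreprK -qhat_linear !hat_bracket_qpi.
by rewrite loop_bracket_linr qhat_linear.
Qed.

Lemma hat_bracketE f m g n : hat_bracket (hat_elt f m) (hat_elt g n) =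
  nsum (fun i => binz K m i *: hat_elt (dmode i%:Z f g) (m + n - i%:Z)).
Proof. by rewrite /hat_elt hat_bracket_qpi loop_bracket_pure qhat_coef. Qed.

End LoopLie.

(** * The graded Lie algebra of modes *)

Lemma lin_scale (K : fieldType) (U W : lmodType K) (f : U -> W) c :
  linear f -> linear (fun u => c *: f u).
Proof. by move=> lf a u v; rewrite lf scalerDr !scalerA mulrC. Qed.

Section HatLie.
Variables (K : fieldType) (V : gvoc K).
Hypothesis char0 : forall n, n.+1%:R != 0 :> K.
Local Notation ds := (gc_sum (gvoc_graded V)).
Implicit Types (f g h : dvoa V) (m n : int).
Local Opaque dmode hat_elt hat_bracket binz.

Local Notation br := (@hat_bracket K V).
Local Notation brl := (hat_bracket_linl char0).
Local Notation brr := (hat_bracket_linr char0).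
Local Notation brE := (hat_bracketE char0).

(** Skew-symmetry of [V'] contributes translates, which are scalars times modes in
    the quotient; the scalars add up by [binz_alternating]. *)
Lemma hat_bracket_antisym x y : br x y = - br y x.
Proof.
have lN (z : hat V) : linear (fun y => - br y z).
  by move=> a u v; rewrite brl opprD scalerN.
move: x; apply: (hat_ext (brl y)) => [|s f m fs].
  by move=> a u v; rewrite brr opprD scalerN.
move: y; apply: (hat_ext (brr _)) => [|t g n gt]; first exact: lN.
rewrite !brE.
pose y r := hat_elt (dmode r%:Z f g) (m + n - r%:Z).
have ey : eventually0 y.
  have [N HN] := dmode0_ev0 f g.
  by exists N => i Ni; rewrite /y HN // (lin0 (hat_elt_linear _)).
have skew j : hat_elt (dmode j%:Z g f) (n + m - j%:Z) = - nsum (fun q =>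
    ((-1) ^+ j * binz K (m + n - j%:Z) q) *: y (j + q)%N).
  have lh := hat_elt_linear (V := V) (n + m - j%:Z).
  have ed : eventually0 (fun q => ((-1) ^ j%:Z * (-1) ^+ q) *: dTpow char0 q (dmode (j%:Z + q%:Z) f g)).
    apply: eventually0Z; have [N HN] := eventually0_dmode f g j%:Z.
    by exists N => i Ni; rewrite HN // (lin0 (dTpow_linear _ _)).
  rewrite (dmode_skewT char0) (linN lh) (nsum_lin lh ed); congr (- _).
  apply: eq_nsum => q; rewrite (linZ lh) hat_elt_dTpow scalerA /y.
  rewrite (_ : n + m - j%:Z - q%:Z = m + n - (j + q)%N%:Z); last lia.
  rewrite (_ : n + m - j%:Z = m + n - j%:Z); last lia.
  congr (_ *: _); rewrite -exprnP mulrA; congr (_ * _).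
  by rewrite -mulrA -expr2 sqrr_sign mulr1.
pose G j q := (binz K n j * ((-1) ^+ j * binz K (m + n - j%:Z) q)) *: y (j + q)%N.
have bG : bounded2 G.
  by case: ey => N HN; exists N => j q jq; rewrite /G HN ?scaler0 //; lia.
rewrite -nsumN; last exact: hat_sum_ev0.
transitivity (nsum (fun j => nsum (G j))); last first.
  apply: eq_nsum => j; rewrite skew scalerN opprK -nsumZ.
    by apply: eq_nsum => q; rewrite scalerA.
  by case: ey => N HN; exists N => q Nq; rewrite HN ?scaler0 //; lia.
rewrite -(nsum_antidiag bG); apply: eq_nsum => r.
rewrite -(binz_alternating char0 n m r) scaler_suml; apply: eq_bigr => j _.
rewrite /G subnKC; last by rewrite -ltnS.
by move: (binz K _ _) (binz K _ _) => u v; rewrite mulrCA mulrA.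
Qed.

(** The commutator formula for the modes on [V'], with its binomial coefficients
    rearranged by [binz_convolution]. *)
Lemma hat_bracket_jacobi x y z : br x (br y z) - br y (br x z) = br (br x y) z.
Proof.
have lL (b c : hat V) : linear (fun a => br a (br b c) - br b (br a c)).
  by move=> e u v; rewrite !brl brr scalerBr opprD addrACA.
have lM (a c : hat V) : linear (fun b => br a (br b c) - br b (br a c)).
  by move=> e u v; rewrite !brl brr scalerBr opprD addrACA.
have lR (a b : hat V) : linear (fun c => br a (br b c) - br b (br a c)).
  by move=> e u v; rewrite !brr scalerBr opprD addrACA.
move: x; apply: (hat_ext (lL y z)) => [|s f m fs].
  by move=> a u v; rewrite !brl.
move: y; apply: (hat_ext (lM _ z)) => [|t g n gt].
  by move=> a u v; rewrite brr brl.
move: z; apply: (hat_ext (lR _ _)) => [|r h p hr].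
  by move=> a u v; rewrite brr.
rewrite !brE.
have e0 f' g' (c : nat -> K) (F : nat -> int) := hat_sum_ev0 (V := V) c F f' g'.
have sumr u (c : nat -> K) (F : nat -> int) f' g' :
    br u (nsum (fun i => c i *: hat_elt (dmode i%:Z f' g') (F i))) =
    nsum (fun i => c i *: br u (hat_elt (dmode i%:Z f' g') (F i))).
  rewrite (nsum_lin (brr u) (e0 _ _ _ _)); apply: eq_nsum => i; exact: linZ (brr u) _ _.
rewrite !sumr (nsum_lin (brl _) (e0 _ _ _ _)).
pose N' := m + n + p.
pose P i j := hat_elt (dmode i%:Z f (dmode j%:Z g h)) (N' - i%:Z - j%:Z).
pose Q i j := hat_elt (dmode j%:Z g (dmode i%:Z f h)) (N' - i%:Z - j%:Z).
pose F q r' := hat_elt (dmode r'%:Z (dmode q%:Z f g) h) (N' - q%:Z - r'%:Z).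
have bP : bounded2 P.
  have [Ng Hg] := dmode0_ev0 g h; apply: bounded2_swap.
  apply: (@bounded2I _ _ _ Ng) => [j i Nj|j].
    by rewrite /P Hg // (lin0 (dmode_linr _ _)) (lin0 (hat_elt_linear _)).
  have [M HM] := dmode0_ev0 f (dmode j%:Z g h).
  by exists M => i Mi; rewrite /P HM // (lin0 (hat_elt_linear _)).
have bQ : bounded2 Q.
  have [Nf Hf] := dmode0_ev0 f h.
  apply: (@bounded2I _ _ _ Nf) => [i j Ni|i].
    by rewrite /Q Hf // (lin0 (dmode_linr _ _)) (lin0 (hat_elt_linear _)).
  have [M HM] := dmode0_ev0 g (dmode i%:Z f h).
  by exists M => j Mj; rewrite /Q HM // (lin0 (hat_elt_linear _)).
have bF : bounded2 F.
  have [Nf Hf] := dmode0_ev0 f g.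
  apply: (@bounded2I _ _ _ Nf) => [i j Ni|i].
    by rewrite /F Hf // (lin0 (dmode_linl _ _)) (lin0 (hat_elt_linear _)).
  have [M HM] := dmode0_ev0 (dmode i%:Z f g) h.
  by exists M => j Mj; rewrite /F HM // (lin0 (hat_elt_linear _)).
have bPc := bounded2Z (fun i j => binz K m i * binz K n j) bP.
have bQc := bounded2Z (fun i j => binz K m i * binz K n j) bQ.
transitivity (nsum (fun i => nsum (fun j => (binz K m i * binz K n j) *: P i j))
  - nsum (fun i => nsum (fun j => (binz K m i * binz K n j) *: Q i j))).
  congr (_ - _).
    rewrite (exchange_nsum bPc); apply: eq_nsum => j; rewrite brE -nsumZ; last exact: e0.
    apply: eq_nsum => i; rewrite scalerA mulrC /P.
    by rewrite (_ : m + (n + p - j%:Z) - i%:Z = N' - i%:Z - j%:Z) // /N'; lia.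
  apply: eq_nsum => i; rewrite brE -nsumZ; last exact: e0.
  apply: eq_nsum => j; rewrite scalerA /Q.
  by rewrite (_ : n + (m + p - i%:Z) - j%:Z = N' - i%:Z - j%:Z) // /N'; lia.
have PQ i j : P i j - Q i j = nsum (fun q => binz K i%:Z q *: F q (j + (i - q))%N).
  rewrite /P /Q -(linB (hat_elt_linear _)) dmode_commutator.
  rewrite (nsum_lin (hat_elt_linear _)); last first.
    apply: eventually0Z; have [N HN] := dmode0_ev0 f g.
    by exists N => q Nq; rewrite HN // (lin0 (dmode_linl _ _)).
  apply: eq_nsum => q; rewrite (linZ (hat_elt_linear _)) /F.
  have [iq|qi] := ltnP i q; first by rewrite (binz_nat_eq0 _ iq) !scale0r.
  rewrite (_ : (j + (i - q))%N%:Z = i%:Z + j%:Z - q%:Z); last lia.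
  by rewrite (_ : N' - q%:Z - (i%:Z + j%:Z - q%:Z) = N' - i%:Z - j%:Z) //; lia.
transitivity (nsum (fun i => binz K m i *: nsum (fun j => binz K n j *:
     nsum (fun q => binz K i%:Z q *: F q (j + (i - q))%N)))).
  rewrite -(nsumB (bounded2_outer bPc) (bounded2_outer bQc)).
  apply: eq_nsum => i; rewrite -(nsumB (bounded2_inner i bPc) (bounded2_inner i bQc)).
  rewrite -nsumZ.
    by apply: eq_nsum => j; rewrite -scalerBr PQ scalerA.
  case: bF => N HN; exists N => j Nj; rewrite [nsum _](_ : _ = 0) ?scaler0 // -[RHS]nsum0.
  by apply: eq_nsum => q; rewrite HN ?scaler0 //; lia.
rewrite (binz_convolution char0 _ _ bF); apply: eq_nsum => q.
rewrite (linZ (brl _)) brE; congr (_ *: _); apply: eq_nsum => i.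
rewrite (_ : m - q%:Z + n = m + n - q%:Z); last lia.
by rewrite /F (_ : m + n - q%:Z + p - i%:Z = N' - q%:Z - i%:Z) // /N'; lia.
Qed.

Lemma hat_elt_gr s f m : f \in dvoa_gr V s -> hat_elt f m \in hat_gr V (s - m - 1).
Proof. by move=> fs; apply: mem_lspan; exists s, f, m. Qed.

Lemma hat_homogeneous_elim (P : hat V -> Prop) : P 0 ->
  (forall d x y, x \in hat_gr V d -> P y -> P (x + y)) -> forall x, P x.
Proof. by move=> P0 PS; apply: hat_elim => // s f m x /(hat_elt_gr m) /PS; apply. Qed.

Lemma hat_bracket_gr d e x y : x \in hat_gr V d -> y \in hat_gr V e ->
  br x y \in hat_gr V (d + e).
Proof.
move=> xd; move: y; apply: lspan_lin; first exact: brr.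
move=> _ [t [g [n [gt <- ->]]]]; move: x xd; apply: (lspan_lin (brl _)).
move=> _ [s [f [m [fs <- ->]]]]; rewrite brE.
apply: nsum_mem => [|i]; first exact: hat_sum_ev0.
apply: rpredZ; have := hat_elt_gr (m + n - i%:Z) (dmode_gr i%:Z fs gt).
by rewrite (_ : _ - _ - 1 = s - m - 1 + (t - n - 1)) //; lia.
Qed.

Section NegativePart.
Variable N : int.
Hypothesis HN : forall s f, (s < N)%R -> f \in dvoa_gr V s -> f = 0.

Definition low_count m : nat := if (m - N)%R is Posz k then k else 0%N.

Lemma low_countP m (i : nat) : (i < low_count m)%N = (N + i%:Z < m)%R.
Proof. by rewrite /low_count; case e : (m - N) => [k|k]; lia. Qed.

(** The sum of the components of weight less than [m]; [N] bounds the weights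
    from below. *)
Definition low m f : dvoa V := \sum_(i < low_count m) rdual_comp ds (N + i%:Z) f.

Lemma low_linear m : linear (low m).
Proof.
move=> a f g; rewrite /low scaler_sumr -big_split /=; apply: eq_bigr => i _.
exact: rdual_comp_linear.
Qed.

Lemma lowE m s f : f \in dvoa_gr V s -> low m f = if (s < m)%R then f else 0.
Proof.
move=> fs; rewrite /low; have [sN|Ns] := ltP s N.
  rewrite (HN sN fs) big1 ?if_same // => i _; exact: lin0 (rdual_comp_linear _ _).
have [sm|ms] := ltP s m.
  have si : (`|(s - N)%R|%N < low_count m)%N by rewrite low_countP; lia.
  rewrite (bigD1 (Ordinal si)) //= (rdual_comp_id ds _ fs).
  rewrite (_ : N + `|(s - N)%R|%N%:Z = s) ?eqxx; last lia.
  rewrite big1 ?addr0 // => i /eqP ne; rewrite (rdual_comp_id ds _ fs) ifF //.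
  by apply/eqP => e; apply: ne; apply: val_inj => /=; lia.
apply: big1 => i _; rewrite (rdual_comp_id ds _ fs) ifF //; apply/eqP.
by have := ltn_ord i; rewrite low_countP; lia.
Qed.

Definition neg_coef f m : hat V := hat_elt (low (m + 1) f) m.

Lemma neg_coef_linear m : linear (fun f => neg_coef f m).
Proof. exact: lin_comp (hat_elt_linear m) (low_linear _). Qed.

Lemma neg_coef_dT f m : neg_coef (dT f) m = (- m)%:~R *: neg_coef f (m - 1).
Proof.
move: f; apply: (rdual_extg ds).
- exact: lin_comp (neg_coef_linear m) (@dT_linear _ _).
- exact: lin_scale (neg_coef_linear _).
move=> s f fs; rewrite /neg_coef (lowE _ (dT_gr char0 fs)) (lowE _ fs).
rewrite subrK (_ : (s + 1 < m + 1)%R = (s < m)%R); last lia.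
case: ifP => _; first exact: hat_elt_dT.
by rewrite !(lin0 (hat_elt_linear _)) scaler0.
Qed.

(** The projection onto negative degrees: the coefficient of [t^m] keeps only the
    weights at most [m]. The translation relation trades a unit of weight for a unit
    of the exponent of [t], so this cut-off respects it. *)
Definition neg_part : hat V -> hat V := hat_lift neg_coef.

Lemma neg_part_linear : linear neg_part.
Proof. exact: hat_lift_linear neg_coef_linear neg_coef_dT. Qed.

Lemma neg_part_elt s f m : f \in dvoa_gr V s ->
  neg_part (hat_elt f m) = if (s - m - 1 < 0)%R then hat_elt f m else 0.
Proof.
move=> fs; rewrite /neg_part (hat_liftE neg_coef_linear neg_coef_dT) /neg_coef (lowE _ fs).
rewrite (_ : (s < m + 1)%R = (s - m - 1 < 0)%R); last lia.
by case: ifP => // _; exact: lin0 (hat_elt_linear _).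
Qed.

Local Opaque neg_part.

Lemma neg_partE d x : x \in hat_gr V d -> neg_part x = if (d < 0)%R then x else 0.
Proof.
move: x; apply: lspan_elim => [|a _ x [s [f [m [fs <- ->]]]] IH].
  by rewrite (lin0 neg_part_linear) if_same.
rewrite neg_part_linear IH (neg_part_elt _ fs); case: ifP => //.
by rewrite scaler0 addr0.
Qed.

Section ZeroAction.
Variables (M : lmodType K) (DM : {linear M -> tensor (zhuC V) M}).
Implicit Types nn : dual M.

Definition zero_coef nn f m : dual M := zero_mode DM (rdual_comp ds (m + 1) f) nn.

Lemma zero_coef_linear nn m : linear (fun f => zero_coef nn f m).
Proof. exact: lin_comp (zero_mode_linl DM nn) (rdual_comp_linear _ _). Qed.

Lemma zero_coef_dT nn f m : zero_coef nn (dT f) m = (- m)%:~R *: zero_coef nn f (m - 1).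
Proof.
move: f; apply: (rdual_extg ds).
- exact: lin_comp (zero_coef_linear nn m) (@dT_linear _ _).
- exact: lin_scale (zero_coef_linear _ _).
move=> s f fs; rewrite /zero_coef subrK.
rewrite (rdual_comp_id ds _ (dT_gr char0 fs)) (rdual_comp_id ds _ fs).
rewrite (inj_eq (addIr 1)); case: eqP => [->|_]; last first.
  by rewrite !(lin0 (zero_mode_linl _ _)) scaler0.
by rewrite /zero_mode (restr_dT char0 fs) (linZ (zhu_act_linl DM nn)).
Qed.

(** The action of the degree-zero elements on the dual of [M], extended by zero to
    the other degrees. *)
Definition zero_part (x : hat V) nn : dual M := hat_lift (zero_coef nn) x.

Lemma zero_part_linl nn : linear (fun x => zero_part x nn).
Proof. exact: hat_lift_linear (zero_coef_linear nn) (zero_coef_dT nn). Qed.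

Lemma zero_part_elt s f m nn : f \in dvoa_gr V s ->
  zero_part (hat_elt f m) nn = if s - m - 1 == 0 then zero_mode DM f nn else 0.
Proof.
move=> fs; rewrite /zero_part (hat_liftE (zero_coef_linear nn) (zero_coef_dT nn)).
rewrite /zero_coef (rdual_comp_id ds _ fs) (_ : (m + 1 == s) = (s - m - 1 == 0)); last lia.
by case: ifP => // _; exact: lin0 (zero_mode_linl _ _).
Qed.

Local Opaque neg_part zero_part.

Lemma zero_part_linr x : linear (zero_part x).
Proof.
elim/hat_elim: x => [|s f m x fs IH] a u v.
  by rewrite !(lin0 (zero_part_linl _)) scaler0 addr0.
rewrite !(linD (zero_part_linl _)) IH !(zero_part_elt _ _ fs) scalerDr addrACA.
by congr (_ + _); case: ifP => _; [exact: zero_mode_linr|rewrite scaler0 addr0].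
Qed.

Lemma zero_part_neq0 d x nn : x \in hat_gr V d -> d != 0 -> zero_part x nn = 0.
Proof.
move=> xd d0; move: x xd; apply: lspan_eq0; first exact: zero_part_linl.
by move=> _ [s [f [m [fs ds' ->]]]]; rewrite (zero_part_elt _ _ fs) ds' (negbTE d0).
Qed.

Hypothesis hDM : zhu_comodule DM.

Lemma hat_gr_zero x : x \in hat_gr V 0 ->
  x \in lspan [set y | exists s f, f \in dvoa_gr V s /\ y = hat_elt f (s - 1)].
Proof.
apply: lspan_ind => _ [s [f [m [fs e ->]]]]; apply: mem_lspan; exists s, f; split=> //.
by rewrite (_ : m = s - 1) //; lia.
Qed.

Lemma zero_part_bracket x y nn : x \in hat_gr V 0 -> y \in hat_gr V 0 ->
  zero_part (br x y) nn = zero_part x (zero_part y nn) - zero_part y (zero_part x nn).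
Proof.
move=> /hat_gr_zero x0 /hat_gr_zero y0.
have lz := zero_part_linl; have lr := zero_part_linr.
pose D x y := zero_part (br x y) nn - (zero_part x (zero_part y nn) - zero_part y (zero_part x nn)).
have lDl y' : linear (fun x => D x y').
  move=> a u v; rewrite /D (brl y' a u v) (lz nn a (br u y')) (lz _ a u v) (lz _ a u v).
  rewrite (lr y' a); move: (zero_part _ _) (zero_part _ _) (zero_part _ _)
    (zero_part _ _) (zero_part _ _) (zero_part _ _) => A B C A' B' C'.
  by rewrite !scalerBr !opprD !opprK !addrA (ACl (1 * 3 * 5 * 2 * 4 * 6))%AC.
have lDr x' : linear (D x').
  move=> a u v; rewrite /D (brr x' a u v) (lz nn a (br x' u)) (lz _ a u v) (lz _ a u v).
  rewrite (lr x' a); move: (zero_part _ _) (zero_part _ _) (zero_part _ _)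
    (zero_part _ _) (zero_part _ _) (zero_part _ _) => A B C A' B' C'.
  by rewrite !scalerBr !opprD !opprK !addrA (ACl (1 * 3 * 5 * 2 * 4 * 6))%AC.
apply/eqP; rewrite -subr_eq0; apply/eqP; rewrite -/(D x y).
move: x x0; apply: (lspan_eq0 (lDl y)) => _ [s [f [fs ->]]].
move: y y0; apply: (lspan_eq0 (lDr _)) => _ [t [g [gt ->]]].
apply/eqP; rewrite /D subr_eq0; apply/eqP.
rewrite !(zero_part_elt _ _ fs) !(zero_part_elt _ _ gt) !ifT; try lia.
rewrite brE (nsum_lin (lz _) (hat_sum_ev0 _ _ _ _)).
rewrite (zero_mode_commutator char0 hDM nn fs gt); apply: eq_nsum => i.
by rewrite (linZ (lz _)) (zero_part_elt _ _ (dmode_gr i%:Z fs gt)) ifT //; lia.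
Qed.

End ZeroAction.
End NegativePart.
End HatLie.

(** * Projection to degree zero for a graded Lie algebra *)

Section TriangularLie.
Variables (K : fieldType) (g N : lmodType K).
Variables (br : g -> g -> g) (gr : int -> submodClosed g) (pm : g -> g) (o : g -> N -> N).
Hypothesis g_elim : forall P : g -> Prop, P 0 ->
  (forall d x y, x \in gr d -> P y -> P (x + y)) -> forall x, P x.
Hypothesis brl : forall y, linear (fun x => br x y).
Hypothesis brr : forall x, linear (br x).
Hypothesis br_antisym : forall x y, br x y = - br y x.
Hypothesis br_jacobi : forall x y z, br x (br y z) - br y (br x z) = br (br x y) z.
Hypothesis br_gr : forall d e x y, x \in gr d -> y \in gr e -> br x y \in gr (d + e).
Hypothesis pm_lin : linear pm.
Hypothesis pmE : forall d x, x \in gr d -> pm x = if (d < 0)%R then x else 0.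
Hypothesis o_linl : forall n, linear (fun x => o x n).
Hypothesis o_linr : forall x, linear (o x).
Hypothesis o_neq0 : forall d x n, x \in gr d -> d != 0 -> o x n = 0.
Hypothesis o_br : forall x y n, x \in gr 0 -> y \in gr 0 ->
  o (br x y) n = o x (o y n) - o y (o x n).

Lemma pm_idem x : pm (pm x) = pm x.
Proof.
elim/g_elim: x => [|d x y xd IH]; first by rewrite !(lin0 pm_lin).
rewrite !(linD pm_lin) IH (pmE xd); case: ifP => d0; last by rewrite (lin0 pm_lin).
by rewrite (pmE xd) d0.
Qed.

Lemma o_pm x n : o (pm x) n = 0.
Proof.
elim/g_elim: x => [|d x y xd IH]; first by rewrite (lin0 pm_lin) (lin0 (o_linl n)).
rewrite (linD pm_lin) (linD (o_linl n)) IH addr0 (pmE xd); case: ifP => d0.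
  by apply: o_neq0 xd _; lia.
exact: (lin0 (o_linl n)).
Qed.

Lemma pm_br_neg x y : pm (br (pm x) (pm y)) = br (pm x) (pm y).
Proof.
elim/g_elim: x => [|d x x' xd IHx].
  by rewrite (lin0 pm_lin) (lin0 (brl _)) (lin0 pm_lin).
rewrite (linD pm_lin) (linD (brl _)) (linD pm_lin) IHx; congr (_ + _).
rewrite (pmE xd); case: ifP => d0; last by rewrite (lin0 (brl _)) (lin0 pm_lin).
elim/g_elim: y {IHx} => [|e y y' ye IHy].
  by rewrite (lin0 pm_lin) (lin0 (brr _)) (lin0 pm_lin).
rewrite (linD pm_lin) (linD (brr _)) (linD pm_lin) IHy; congr (_ + _).
rewrite (pmE ye); case: ifP => e0; last by rewrite (lin0 (brr _)) (lin0 pm_lin).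
by rewrite (pmE (br_gr xd ye)) ifT //; lia.
Qed.

Lemma pm_br_zero x y : y \in gr 0 -> pm (br (pm x) y) = br (pm x) y.
Proof.
move=> y0; elim/g_elim: x => [|d x x' xd IHx].
  by rewrite (lin0 pm_lin) (lin0 (brl _)) (lin0 pm_lin).
rewrite (linD pm_lin) (linD (brl _)) (linD pm_lin) IHx; congr (_ + _).
rewrite (pmE xd); case: ifP => d0; last by rewrite (lin0 (brl _)) (lin0 pm_lin).
by rewrite (pmE (br_gr xd y0)) addr0 d0.
Qed.

Lemma nnE d x : x \in gr d -> x - pm x = if (d < 0)%R then 0 else x.
Proof. by move=> xd; rewrite (pmE xd); case: ifP => _; rewrite ?subrr ?subr0. Qed.

Lemma nn_lin : linear (fun x => x - pm x).
Proof. by move=> a u v; rewrite pm_lin scalerBr opprD addrACA. Qed.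

Lemma pm_br_nn x y : pm (br (x - pm x) (y - pm y)) = 0.
Proof.
elim/g_elim: x => [|d x x' xd IHx].
  by rewrite (lin0 nn_lin) (lin0 (brl _)) (lin0 pm_lin).
rewrite (linD nn_lin) (linD (brl _)) (linD pm_lin) IHx addr0 (nnE xd).
case: ifP => d0; first by rewrite (lin0 (brl _)) (lin0 pm_lin).
elim/g_elim: y {IHx} => [|e y y' ye IHy].
  by rewrite (lin0 nn_lin) (lin0 (brr _)) (lin0 pm_lin).
rewrite (linD nn_lin) (linD (brr _)) (linD pm_lin) IHy addr0 (nnE ye).
case: ifP => e0; first by rewrite (lin0 (brr _)) (lin0 pm_lin).
by rewrite (pmE (br_gr xd ye)) ifF //; lia.
Qed.

Lemma o_br_nn x y n :
  o (br (x - pm x) (y - pm y)) n = o x (o y n) - o y (o x n).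
Proof.
elim/g_elim: x => [|d x x' xd IHx].
  by rewrite (lin0 nn_lin) (lin0 (brl _)) !(lin0 (o_linl _)) (lin0 (o_linr _)) subrr.
rewrite (linD nn_lin) (linD (brl _)) !(linD (o_linl _)) (linD (o_linr _)) IHx opprD addrACA.
congr (_ + _); rewrite (nnE xd).
elim/g_elim: y {IHx} => [|e y y' ye IHy].
  by rewrite (lin0 nn_lin) (lin0 (brr _)) !(lin0 (o_linl _)) (lin0 (o_linr _)) subrr.
rewrite (linD nn_lin) (linD (brr _)) !(linD (o_linl _)) (linD (o_linr _)) IHy opprD addrACA.
congr (_ + _); rewrite (nnE ye).
have [d0|d0|d0] := ltgtP d 0.
- rewrite (lin0 (brl _)) (lin0 (o_linl _)) !(o_neq0 _ xd) ?(lin0 (o_linr _)) ?subrr //; lia.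
- rewrite !(o_neq0 _ xd) ?(lin0 (o_linr _)) ?subrr; try lia.
  case: ifP => e0; first by rewrite (lin0 (brr _)) (lin0 (o_linl _)).
  by rewrite (o_neq0 _ (br_gr xd ye)) //; lia.
subst d; have [e0|e0|e0] := ltgtP e 0.
- rewrite (lin0 (brr _)) (lin0 (o_linl _)) !(o_neq0 _ ye) ?(lin0 (o_linr _)) ?subrr //; lia.
- rewrite !(o_neq0 _ ye) ?(lin0 (o_linr _)) ?subrr; try lia.
  by rewrite (o_neq0 _ (br_gr xd ye)) //; lia.
by subst e; exact: o_br.
Qed.

(** [dsum P z w] is the value of [P] on the formal sum of the words obtained from
    [w] by bracketing one letter with [z]. *)
Fixpoint dsum (P : seq g -> N) (z : g) (w : seq g) : N :=
  if w is x :: w' then P (br z x :: w') + dsum (fun u => P (x :: u)) z w' else 0.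

Lemma dsum_cat P z u w : dsum P z (u ++ w) =
  dsum (fun u' => P (u' ++ w)) z u + dsum (fun w' => P (u ++ w')) z w.
Proof.
elim: u P => [|x u IH] P /=; first by rewrite add0r.
by rewrite IH addrA.
Qed.

Lemma eq_dsum P Q z w : (forall u, size u = size w -> P u = Q u) -> dsum P z w = dsum Q z w.
Proof.
elim: w P Q => [|x w IH] P Q PQ //=; rewrite PQ //; congr (_ + _).
by apply: IH => u su; apply: PQ; rewrite /= su.
Qed.

Lemma dsum_comb a P Q z w :
  dsum (fun u => a *: P u + Q u) z w = a *: dsum P z w + dsum Q z w.
Proof.
elim: w P Q => [|x w IH] P Q /=; first by rewrite scaler0 addr0.
by rewrite IH scalerDr addrACA.
Qed.

Lemma dsumB P Q z w : dsum (fun u => P u - Q u) z w = dsum P z w - dsum Q z w.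
Proof.
rewrite -scaleN1r addrC -dsum_comb; apply: eq_dsum => u _.
by rewrite scaleN1r addrC.
Qed.

Lemma dsumD P Q z w : dsum (fun u => P u + Q u) z w = dsum P z w + dsum Q z w.
Proof.
rewrite -[dsum P z w]scale1r -dsum_comb; apply: eq_dsum => u _.
by rewrite scale1r.
Qed.

Lemma dsum_comp (f : N -> N) P z w : linear f ->
  dsum (fun u => f (P u)) z w = f (dsum P z w).
Proof.
move=> lf; elim: w P => [|x w IH] P /=; first by rewrite (lin0 lf).
by rewrite IH (linD lf).
Qed.

Lemma dsum0 P z w : (forall u, size u = size w -> P u = 0) -> dsum P z w = 0.
Proof.
elim: w P => [|x w IH] P P0 //=; rewrite P0 // add0r; apply: IH => u su.
by apply: P0; rewrite /= su.
Qed.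

Definition multilinear_at (P : seq g -> N) k := forall u a x y w,
  size (u ++ x :: w) = k -> P (u ++ (a *: x + y) :: w) = a *: P (u ++ x :: w) + P (u ++ y :: w).

Lemma multilinear_cons P k x : multilinear_at P k.+1 -> multilinear_at (fun u => P (x :: u)) k.
Proof.
by move=> ml u a y z w sw; have := ml (x :: u) a y z w; rewrite /= sw => ->.
Qed.

Lemma dsum_linz P a z z' w : multilinear_at P (size w) ->
  dsum P (a *: z + z') w = a *: dsum P z w + dsum P z' w.
Proof.
elim: w P => [|x w IH] P ml /=; first by rewrite scaler0 addr0.
rewrite IH; last exact: multilinear_cons.
rewrite brl (ml [::] a _ _ w) // scalerDr /= -!addrA; congr (_ + _).
by rewrite addrCA.
Qed.

Lemma dsum_z0 P w : multilinear_at P (size w) -> dsum P 0 w = 0.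
Proof.
move=> ml; have := dsum_linz (-1) 0 0 ml.
by rewrite scaler0 addr0 scaleN1r addNr.
Qed.

Lemma dsum_commutator P x y w : multilinear_at P (size w) ->
  dsum (dsum P y) x w - dsum (dsum P x) y w = dsum P (br y x) w.
Proof.
elim: w P => [|z w IH] P ml /=; first by rewrite subrr.
rewrite !dsumD.
have IH' := IH _ (@multilinear_cons P (size w) z ml).
rewrite -IH' -br_jacobi.
have -> : P ((br y (br x z) - br x (br y z)) :: w)
    = P (br y (br x z) :: w) - P (br x (br y z) :: w).
  rewrite addrC -scaleN1r (ml [::] _ _ _ w) //= scaleN1r; exact: addrC.
move: (P (br y (br x z) :: w)) (P (br x (br y z) :: w)) => A A'.
move: (dsum _ x w) (dsum _ y w) => B B'.
move: (dsum _ x w) (dsum _ y w) => C C'.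
rewrite !opprD !addrA (ACl (1 * 5 * 4 * 8 * (2 * 7) * (3 * 6)))%AC /=.
by rewrite !subrr !addr0.
Qed.

Definition homogeneous_word (w : seq (int * g)) := forall p, p \in w -> p.2 \in gr p.1.

Lemma dsum_mem (S : submodClosed N) P d z w : z \in gr d -> homogeneous_word w ->
  (forall w', homogeneous_word w' -> size w' = size w ->
     \sum_(p <- w') p.1 = d + \sum_(p <- w) p.1 -> P (map snd w') \in S) ->
  dsum P z (map snd w) \in S.
Proof.
move=> zd; elim: w P => [|[e x] w IH] P hw HP; first exact: rpred0.
have xe : x \in gr e by apply: (hw (e, x)); rewrite mem_head.
have {}hw : homogeneous_word w by move=> p pw; apply: hw; rewrite inE pw orbT.
apply: rpredD.
  apply: (HP ((d + e, br z x) :: w)) => //; last by rewrite !big_cons /= addrA.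
  by move=> p; rewrite inE => /predU1P[->|/hw] //=; exact: br_gr.
apply: IH => // w' hw' sw' dw'.
apply: (HP ((e, x) :: w')); rewrite /= ?sw' //.
  by move=> p; rewrite inE => /predU1P[->|/hw'].
by rewrite !big_cons /= dw' addrCA.
Qed.

(** Each letter that the last one passes on its way to the front costs a bracket. *)
Lemma dsum_rcons (P : seq g -> N) w y :
  (forall u x a, linear (fun z => P (u ++ z :: a)) /\
    forall v, P (u ++ x :: v :: a) - P (u ++ v :: x :: a) = P (u ++ br x v :: a)) ->
  P (rcons w y) = P (y :: w) - dsum P y w.
Proof.
elim: w P => [|x w IH] P HP /=; first by rewrite subr0.
rewrite (IH (fun u => P (x :: u))) => [|u z a]; last exact: (HP (x :: u) z a).
have [l1 r1] := HP [::] x w; have /= := r1 y; rewrite br_antisym (linN l1) /= => e.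
by rewrite opprD addrA -e [P (y :: _) + _]addrC subrK.
Qed.

Section Words.
Variable n : N.

(** The recursion is on the length because [dsum] evaluates it on words other than
    the tail. *)
Fixpoint project_rec (k : nat) (w : seq g) : N :=
  match k, w with
  | k'.+1, x :: w' => o x (project_rec k' w') + dsum (project_rec k') (pm x) w'
  | _, _ => n
  end.

(** The component in [N] of the word [w] applied to [n], in a module where [n]
    generates, negative elements kill [n], and elements of degree zero act on [n]
    by [o]: a first letter of positive degree contributes nothing, one of degree
    zero acts by [o], and one of negative degree is moved to the right. *)
Definition project (w : seq g) : N := project_rec (size w) w.

Lemma project_cons x w : project (x :: w) = o x (project w) + dsum project (pm x) w.
Proof.
rewrite {1}/project /=; congr (_ + _); apply: eq_dsum => u su.
by rewrite /project su.
Qed.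

Lemma project_multilinear k : multilinear_at project k.
Proof.
elim: k => [|k IH] [|z u] a x y w //= [sw]; rewrite !project_cons.
  rewrite o_linl pm_lin dsum_linz; last by rewrite sw.
  by rewrite scalerDr addrACA.
rewrite IH // o_linr !dsum_cat /= scalerDr -!addrA; congr (_ + _).
have e1 : dsum (fun u' => project (u' ++ (a *: x + y) :: w)) (pm z) u =
   a *: dsum (fun u' => project (u' ++ x :: w)) (pm z) u + dsum (fun u' => project (u' ++ y :: w)) (pm z) u.
  rewrite -dsum_comb; apply: eq_dsum => u' su; apply: IH.
  by rewrite -sw !size_cat su.
have e2 : dsum (fun w' => project (u ++ (a *: x + y) :: w')) (pm z) w =
   a *: dsum (fun w' => project (u ++ x :: w')) (pm z) w + dsum (fun w' => project (u ++ y :: w')) (pm z) w.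
  rewrite -dsum_comb; apply: eq_dsum => w' sw'; apply: IH.
  by rewrite -sw !size_cat /= sw'.
rewrite e1 e2 brr IH; last by rewrite -sw !size_cat.
move: (dsum _ _ _) (dsum _ _ _) (dsum _ _ _) (dsum _ _ _) (project _) (project _) (o z _).
move=> A A' B B' C C' D; rewrite !scalerDr !addrA.
by rewrite (ACl (2 * 4 * 6 * 1 * 3 * 5 * 7))%AC.
Qed.

Lemma project_head a x y w : project ((a *: x + y) :: w) = a *: project (x :: w) + project (y :: w).
Proof. exact: (@project_multilinear _ [::] a x y w erefl). Qed.

Lemma project_head_linear w : linear (fun x => project (x :: w)).
Proof. by move=> a x y; exact: project_head. Qed.

Lemma project_mid_linear u w : linear (fun x => project (u ++ x :: w)).
Proof. by move=> a x y; exact: (@project_multilinear _ u a x y w erefl). Qed.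

Lemma project_two x y w : project (x :: y :: w) =
  o x (o y (project w)) + o x (dsum project (pm y) w) + (project (br (pm x) y :: w)
  + (o y (dsum project (pm x) w) + dsum (dsum project (pm y)) (pm x) w)).
Proof.
rewrite (project_cons x) (project_cons y) (linD (o_linr x)) /=; congr (_ + (_ + _)).
rewrite -(dsum_comp _ _ _ (o_linr y)) -dsumD; apply: eq_dsum => u _.
exact: project_cons.
Qed.

Lemma project_bracket_head x y w :
  project (x :: y :: w) - project (y :: x :: w) = project (br x y :: w).
Proof.
have ML := @project_multilinear (size w); have lh := project_head_linear w.
have brE : br x y = br (x - pm x) (y - pm y) + br (pm x) y - br (pm y) x + br (pm y) (pm x).
  rewrite (br_antisym (pm y) x) (br_antisym (pm y)) opprK.
  rewrite (linB (brl _)) !(linB (brr _)) !opprD !opprK !addrA.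
  rewrite (ACl (1 * (2 * 6) * (3 * 5) * (4 * 7)))%AC /= !addNr subrr !addr0.
  by [].
have H1 : project (br (pm y) (pm x) :: w) = dsum project (br (pm y) (pm x)) w.
  by rewrite project_cons -pm_br_neg o_pm add0r pm_idem.
have H2 : project (br (x - pm x) (y - pm y) :: w) = o x (o y (project w)) - o y (o x (project w)).
  by rewrite project_cons pm_br_nn dsum_z0 // addr0 o_br_nn.
rewrite brE (linD lh) (linB lh) (linD lh) H1 H2 -(dsum_commutator (pm x) (pm y) ML).
rewrite !project_two.
move: (project (br (pm x) y :: w)) (project (br (pm y) x :: w)) => A B.
move: (dsum (dsum project (pm y)) (pm x) w) (dsum (dsum project (pm x)) (pm y) w) => C D.
move: (o x (o y _)) (o y (o x _)) (o x (dsum _ _ _)) (o y (dsum _ _ _)) => a b c d.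
rewrite !opprD !addrA (ACl (1 * 6 * 3 * 8 * 5 * 10 * (2 * 9) * (4 * 7)))%AC /=.
by rewrite !subrr !addr0.
Qed.

Lemma sum5_difference (a1 a2 a3 a4 a5 b1 b2 b3 b4 b5 : N) :
  (a1 + (a2 + (a3 + (a4 + a5)))) - (b1 + (b2 + (b3 + (b4 + b5))))
  = (a1 - b1) + ((a2 - b2) + ((a4 - b3) + (a3 - b4) + (a5 - b5))).
Proof. by rewrite !opprD !addrA (ACl (1 * 6 * 2 * 7 * 4 * 8 * 3 * 9 * 5 * 10))%AC. Qed.

(** Hence [project] factors through the enveloping algebra. At the head of a word
    this is a computation with the five terms of [project_two]; further letters in
    front act through [o] and through brackets, which are derivations by the
    Jacobi identity. *)
Lemma project_bracket u x y w :
  project (u ++ x :: y :: w) - project (u ++ y :: x :: w) = project (u ++ br x y :: w).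
Proof.
move: {2}(size (u ++ w)) (erefl (size (u ++ w))) => k.
elim: k u x y w => [|k IH] [|z u] x y w //= sk; try exact: project_bracket_head.
case: sk => sk; rewrite !project_cons !dsum_cat /= sum5_difference -(linB (o_linr z)).
rewrite -!dsumB; congr (_ + (_ + (_ + _))).
- by rewrite IH.
- by apply: eq_dsum => v sv; apply: IH; rewrite size_cat sv -size_cat.
- rewrite !IH // -(linD (project_mid_linear u w)); congr (project (u ++ _ :: w)).
  by rewrite -br_jacobi addrC subrK.
- by apply: eq_dsum => v sv; apply: IH; rewrite size_cat sv -size_cat.
Qed.

Lemma project_neg u y : pm y = y -> project (rcons u y) = 0.
Proof.
move: {2}(size u) (erefl (size u)) => k; elim: k u y => [|k IH] [|x u] y //= sk yneg.
  by rewrite project_cons /= addr0 -yneg o_pm.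
case: sk => sk; rewrite project_cons IH // (lin0 (o_linr x)) add0r.
rewrite -cats1 dsum_cat /= addr0 dsum0 ?add0r => [|v sv].
  by rewrite cats1 IH // -yneg pm_br_neg.
by rewrite cats1 IH // sv.
Qed.

Lemma project_pos d x w : (0 < d)%R -> x \in gr d -> project (x :: w) = 0.
Proof.
move=> d0 xd; rewrite project_cons (o_neq0 _ xd); last by lia.
rewrite (pmE xd) ifF; last by lia.
by rewrite add0r dsum_z0 //; exact: project_multilinear.
Qed.

Lemma project_zero_head x w : x \in gr 0 -> project (x :: w) = o x (project w).
Proof.
move=> x0; rewrite project_cons (pmE x0) ltxx dsum_z0 ?addr0 //.
exact: project_multilinear.
Qed.

Lemma project_degree w : homogeneous_word w -> \sum_(p <- w) p.1 != 0 ->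
  project (map snd w) = 0.
Proof.
move: {2}(size w) (erefl (size w)) => k; elim: k w => [|k IH] [|[d x] w] //= sk hw.
  by rewrite big_nil eqxx.
case: sk => sk.
have xd : x \in gr d by apply: (hw (d, x)); rewrite mem_head.
have {}hw : homogeneous_word w by move=> p pw; apply: hw; rewrite inE pw orbT.
rewrite big_cons /= project_cons => deg.
rewrite (_ : o x _ = 0) ?add0r; last first.
  have [d0|d0] := eqVneq d 0; last exact: (o_neq0 _ xd).
  by rewrite IH // ?(lin0 (o_linr x)) //; move: deg; rewrite d0 add0r.
rewrite (pmE xd); case: ifP => _; last by rewrite dsum_z0 //; exact: project_multilinear.
have : dsum project x (map snd w) \in lspan set0.
  apply: (dsum_mem xd hw) => w' hw' sw' dw'.
  by rewrite IH ?rpred0 //; rewrite ?sw' ?dw'.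
by move: (dsum _ _ _); apply: lspan_elim.
Qed.

End Words.

(** The projections are built from the operators [o] by sums and composites only,
    whatever the words; properties of such operators therefore pass to them. *)
Lemma project_ind (Q : (N -> N) -> Prop) : Q id -> Q (fun=> 0) ->
  (forall F G, Q F -> Q G -> Q (fun n => F n + G n)) ->
  (forall x F, Q F -> Q (fun n => o x (F n))) ->
  forall w, Q (fun n => project n w).
Proof.
move=> Q1 Q0 QD Qo w; have [k] := ubnP (size w); elim: k w => // k IH [|x w] sw //.
rewrite (_ : (fun n => _) = fun n => o x (project n w) + dsum (project n) (pm x) w).
  apply: (QD _ _); first exact/Qo/IH.
  have Qd (P : N -> seq g -> N) z u : (forall u', size u' = size u -> Q (fun n => P n u')) ->
      Q (fun n => dsum (P n) z u).
    elim: u P => [|y u IHu] P QP //=; apply: (QD _ _); first exact: QP.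
    by apply: IHu => u' su; apply: QP; rewrite /= su.
  by apply: Qd => u su; apply: IH; rewrite su.
by apply/funext => n; exact: project_cons.
Qed.

Lemma project_linear w : linear (fun n => project n w).
Proof.
move: {2}(size w) (erefl (size w)) => k; elim: k w => [|k IH] [|x w] //= sk a n n'.
case: sk => sk; rewrite !project_cons IH // o_linr scalerDr addrACA; congr (_ + _).
by rewrite -dsum_comb; apply: eq_dsum => u su; apply: IH; rewrite su.
Qed.

Lemma project_zero n u y : y \in gr 0 -> project n (rcons u y) = project (o y n) u.
Proof.
move=> y0; move: {2}(size u) (erefl (size u)) => k.
elim: k u => [|k IH] [|x u] //= sk; first by rewrite project_cons /= addr0.
case: sk => sk; rewrite !project_cons IH //; congr (_ + _).
rewrite -cats1 dsum_cat /= addr0 cats1 (project_neg n u (pm_br_zero x y0)) addr0.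
by apply: eq_dsum => v sv; rewrite cats1 IH // sv.
Qed.

End TriangularLie.

(** * The universal enveloping algebra *)

Section QuotientLift.
Variables (K : fieldType) (V W : lmodType K) (A : set V) (f : V -> W).
Hypotheses (lf : linear f) (fA : forall v, A v -> f v = 0).

Lemma quot_lift v : f (qrepr (qpi (lspan A) v)) = f v.
Proof.
apply/eqP; rewrite -subr_eq0 -(linB lf); apply/eqP; apply: (lspan_eq0 lf fA).
by apply/qpi_eq; rewrite qreprK.
Qed.

Lemma quot_lift_linear : linear (fun x : quotsp (lspan A) => f (qrepr x)).
Proof.
by move=> a x y; rewrite -[x]qreprK -[y]qreprK -(@qpi_linear _ _ (lspan A)) !quot_lift lf.
Qed.

End QuotientLift.

Section EnvelopingAlgebra.
Variables (K : fieldType) (g : lmodType K) (br : g -> g -> g).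
Local Notation U := (uea br).
Local Notation uword := (@uea_word K g br).

Lemma quword_linear : linear (qpi (lspan (@uea_rel K g br))).
Proof. exact: qpi_linear. Qed.

Lemma uword_multilinear u a x y w :
  uword (u ++ (a *: x + y) :: w) = a *: uword (u ++ x :: w) + uword (u ++ y :: w).
Proof.
rewrite -(linZ quword_linear) -(linD quword_linear); apply/qpi_eq/mem_lspan.
by left; exists u, w, a, x, y.
Qed.

Lemma uword_linear u w : linear (fun x => uword (u ++ x :: w)).
Proof. by move=> a x y; exact: uword_multilinear. Qed.

Lemma uword_bracket u x y w :
  uword (u ++ x :: y :: w) - uword (u ++ y :: x :: w) = uword (u ++ br x y :: w).
Proof.
apply/eqP; rewrite -subr_eq0 -!(linB quword_linear) -(lin0 quword_linear); apply/eqP/qpi_eq.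
by rewrite subr0; apply: mem_lspan; right; exists u, w, x, y.
Qed.

Lemma uea_elim (P : U -> Prop) : P 0 ->
  (forall a w x, P x -> P (a *: uword w + x)) -> forall x, P x.
Proof.
move=> P0 PS x; rewrite -[x]qreprK; elim/freemod_elim: (qrepr x) => [|a w y IH].
  by rewrite (lin0 quword_linear).
by rewrite quword_linear; exact: PS.
Qed.

Lemma uea_ext (X : lmodType K) (F G : U -> X) : linear F -> linear G ->
  (forall w, F (uword w) = G (uword w)) -> F =1 G.
Proof.
move=> lF lG FG; elim/uea_elim => [|a w x IH]; first by rewrite !lin0.
by rewrite lF lG IH FG.
Qed.

Section Lift.
Variables (X : lmodType K) (P : seq g -> X).
Hypothesis P_lin : forall u w, linear (fun x => P (u ++ x :: w)).
Hypothesis P_br : forall u x y w,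
  P (u ++ x :: y :: w) - P (u ++ y :: x :: w) = P (u ++ br x y :: w).

Lemma uea_lift_rel r : @uea_rel K g br r -> fext P r = 0.
Proof.
have lP := fext_lin P.
case=> [[u [w [a [x [y ->]]]]]|[u [w [x [y ->]]]]].
  by rewrite (linB lP) (linD lP) (linZ lP) !fext_basis (P_lin u w a x y) subrr.
by rewrite !(linB lP) !fext_basis P_br subrr.
Qed.

(** The universal property of the enveloping algebra, for functions of words with
    values in a space. *)
Definition uea_lift (x : U) : X := fext P (qrepr x).

Lemma uea_lift_linear : linear uea_lift.
Proof. exact: quot_lift_linear (fext_lin P) uea_lift_rel. Qed.

Lemma uea_lift_word w : uea_lift (uword w) = P w.
Proof. by rewrite /uea_lift (quot_lift (fext_lin P) uea_lift_rel) fext_basis. Qed.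

End Lift.

Lemma mul_inner_lin u a b : linear (fun x => uword (u ++ (a ++ x :: b))).
Proof. by move=> c x y; rewrite !catA; exact: uword_multilinear. Qed.

Lemma mul_inner_br u a x y b :
  uword (u ++ (a ++ x :: y :: b)) - uword (u ++ (a ++ y :: x :: b)) = uword (u ++ (a ++ br x y :: b)).
Proof. by rewrite !catA; exact: uword_bracket. Qed.

Local Notation lmul u := (uea_lift (fun w => uword (u ++ w))).

Lemma lmul_linear u : linear (lmul u).
Proof. exact: (@uea_lift_linear _ (fun w => uword (u ++ w)) (mul_inner_lin u) (mul_inner_br u)). Qed.

Lemma lmul_word u w : lmul u (uword w) = uword (u ++ w).
Proof. exact: (@uea_lift_word _ (fun w => uword (u ++ w)) (mul_inner_lin u) (mul_inner_br u)). Qed.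

Lemma mul_outer_lin y a b : linear (fun x => lmul (a ++ x :: b) y).
Proof.
move=> c x x'; elim/uea_elim: y => [|d w y IH].
  by rewrite !(lin0 (lmul_linear _)) scaler0 addr0.
rewrite !(lmul_linear _ d) IH !lmul_word.
rewrite -!catA !cat_cons uword_multilinear !scalerDr !scalerA [c * d]mulrC -!addrA.
by congr (_ + _); rewrite addrCA.
Qed.

Lemma mul_outer_br y a x x' b :
  lmul (a ++ x :: x' :: b) y - lmul (a ++ x' :: x :: b) y = lmul (a ++ br x x' :: b) y.
Proof.
elim/uea_elim: y => [|d w y IH]; first by rewrite !(lin0 (lmul_linear _)) subrr.
rewrite !(lmul_linear _ d) opprD addrACA IH !lmul_word.
by rewrite -scalerBr -!catA !cat_cons uword_bracket.
Qed.

Lemma uea_mul_wordl u y : uea_mul (uword u) y = lmul u y.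
Proof.
exact: (@uea_lift_word _ (fun u => lmul u y) (mul_outer_lin y) (mul_outer_br y)).
Qed.

Lemma uea_mul_word u w : uea_mul (uword u) (uword w) = uword (u ++ w).
Proof. by rewrite uea_mul_wordl lmul_word. Qed.

Lemma uea_mul_linl y : linear (fun x : U => uea_mul x y).
Proof.
exact: (@uea_lift_linear _ (fun u => lmul u y) (mul_outer_lin y) (mul_outer_br y)).
Qed.

Lemma uea_mul_linr (x : U) : linear (uea_mul x).
Proof.
move=> a y y'; elim/uea_elim: x => [|d w x IH].
  by rewrite !(lin0 (uea_mul_linl _)) scaler0 addr0.
rewrite !(uea_mul_linl _ d) IH !uea_mul_wordl.
rewrite (lmul_linear w a) !scalerDr !scalerA [a * d]mulrC -!addrA.
by congr (_ + _); rewrite addrCA.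
Qed.

Lemma uea_mulA (x y z : U) : uea_mul x (uea_mul y z) = uea_mul (uea_mul x y) z.
Proof.
have ll := uea_mul_linl; have lr := uea_mul_linr.
move: x; apply: uea_ext => [||u].
- exact: ll.
- exact: lin_comp (ll z) (ll y).
move: y; apply: uea_ext => [||v].
- exact: lin_comp (lr _) (ll z).
- exact: lin_comp (ll z) (lr _).
move: z; apply: uea_ext => [||w].
- exact: lin_comp (lr _) (lr _).
- exact: lr.
by rewrite !uea_mul_word catA.
Qed.

(** By multilinearity, the letters of a word are expanded one at a time. *)
Lemma uea_span (G : set g) : (forall x, x \in lspan G) ->
  forall x : U, x \in lspan [set uword w | w in [set w : seq g | forall z : g, z \in w -> G z]].
Proof.
move=> Gspan; set S := lspan _.
suff H (u w : seq g) : (forall z : g, z \in u -> G z) -> uword (u ++ w) \in S.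
  by elim/uea_elim => [|a w x xS]; [exact: rpred0|rewrite rpredD // rpredZ // (H [::] w)].
elim: w u => [|x w IH] u Gu.
  by rewrite cats0; apply: mem_lspan; exists u.
move: x (Gspan x); apply: lspan_elim => [|a x y Gx yS].
  by rewrite (lin0 (uword_linear u w)) rpred0.
rewrite uword_multilinear rpredD // rpredZ // -cat_rcons; apply: IH => z.
by rewrite mem_rcons inE => /predU1P[->|/Gu].
Qed.

End EnvelopingAlgebra.

(** * The induced module *)

Section InducedModule.
Variables (K : fieldType) (V : gvoc K) (M : lmodType K).
Hypothesis char0 : forall n, n.+1%:R != 0 :> K.
Variable DM : {linear M -> tensor (zhuC V) M}.
Hypothesis hDM : zhu_comodule DM.
Variable N : int.
Hypothesis HN : forall s (f : dvoa V), (s < N)%R -> f \in dvoa_gr V s -> f = 0.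

Local Notation g := (hat V).
Local Notation br := (@hat_bracket K V).
Local Notation U := (uea br).
Local Notation uw := (@uea_word K (hat V) br).
Local Notation Md := (dual M).
Local Notation oz := (zero_mode DM).
Implicit Types (n : Md) (f : dvoa V) (u v w : seq g).

Definition wproj n w : Md := project br (neg_part N) (zero_part DM) n w.

Local Notation Hbrl := (hat_bracket_linl char0).
Local Notation Hbrr := (hat_bracket_linr char0).
Local Notation Hbrg := (@hat_bracket_gr K V char0).
Local Notation Hpl := (@neg_part_linear K V char0 N HN).
Local Notation HpE := (@neg_partE K V char0 N HN).
Local Notation Hol := (zero_part_linl char0 DM).
Local Notation Hor := (zero_part_linr char0 DM).
Local Notation Ho0 := (@zero_part_neq0 K V char0 M DM).
Local Notation Hob := (@zero_part_bracket K V char0 M DM hDM).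
Local Notation Hel := (@hat_homogeneous_elim K V).

Lemma wproj_nil n : wproj n [::] = n. Proof. by []. Qed.

Lemma wproj_lin n u w : linear (fun x => wproj n (u ++ x :: w)).
Proof. exact: (project_mid_linear Hbrl Hbrr Hpl Hol Hor). Qed.

Lemma wproj_br n u x y w :
  wproj n (u ++ x :: y :: w) - wproj n (u ++ y :: x :: w) = wproj n (u ++ br x y :: w).
Proof.
exact: (project_bracket Hel Hbrl Hbrr (hat_bracket_antisym char0) (hat_bracket_jacobi char0)
  Hbrg Hpl HpE Hol Hor Ho0 Hob).
Qed.

Lemma wproj_neg n u d x : (d < 0)%R -> x \in hat_gr V d -> wproj n (rcons u x) = 0.
Proof.
move=> d0 xd; apply: (project_neg Hel Hbrl Hbrr Hbrg Hpl HpE Hol Hor Ho0).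
by rewrite (HpE xd) d0.
Qed.

Lemma wproj_zero n u x : x \in hat_gr V 0 -> wproj n (rcons u x) = wproj (zero_part DM x n) u.
Proof. exact: (project_zero Hel Hbrl Hbrr Hbrg Hpl HpE Hol Hor Ho0). Qed.

Lemma wproj_pos n d x w : (0 < d)%R -> x \in hat_gr V d -> wproj n (x :: w) = 0.
Proof. exact: (project_pos Hbrl Hbrr Hpl HpE Hol Hor Ho0). Qed.

Lemma wproj_zero_head n x w : x \in hat_gr V 0 -> wproj n (x :: w) = zero_part DM x (wproj n w).
Proof. exact: (project_zero_head Hbrl Hbrr Hpl HpE Hol Hor). Qed.

Lemma wproj_degree n (w : seq (int * g)) : homogeneous_word (hat_gr V) w ->
  \sum_(p <- w) p.1 != 0 -> wproj n (map snd w) = 0.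
Proof. exact: (project_degree Hbrl Hbrr Hbrg Hpl HpE Hol Hor Ho0). Qed.

Lemma wproj_linear w : linear (fun n => wproj n w).
Proof. exact: (project_linear _ _ Hor). Qed.

Definition uproj n : U -> Md := uea_lift (wproj n).

Lemma uproj_linr n : linear (uproj n).
Proof. exact: (uea_lift_linear (wproj_lin n) (wproj_br n)). Qed.

Lemma uproj_word n w : uproj n (uw w) = wproj n w.
Proof. exact: (uea_lift_word (wproj_lin n) (wproj_br n)). Qed.

Lemma uproj_linl (x : U) : linear (fun n => uproj n x).
Proof.
move=> a n n'; elim/uea_elim: x => [|d w x IH].
  by rewrite !(lin0 (uproj_linr _)) scaler0 addr0.
rewrite !(uproj_linr _ d) IH !uproj_word (wproj_linear w a).
by rewrite !scalerDr !scalerA [a * d]mulrC addrACA.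
Qed.

Local Notation elt := (@ind_elt K V M DM).
Local Notation qind := (qpi (lspan (ind_rel DM))).

Lemma qind_linear : linear qind. Proof. exact: qpi_linear. Qed.

Lemma elt_linl n : linear (fun x : U => elt x n).
Proof. by move=> a x y; rewrite /ind_elt pureDl pureZl qind_linear. Qed.

Lemma elt_linr (x : U) : linear (elt x).
Proof. by move=> a n n'; rewrite /ind_elt pureDr pureZr qind_linear. Qed.

Lemma ind_elim (P : indU DM -> Prop) : P 0 ->
  (forall w n x, P x -> P (elt (uw w) n + x)) -> forall x, P x.
Proof.
move=> P0 PS x; rewrite -[x]qreprK; elim/tensor_elim: (qrepr x) => [|y n t IH].
  by rewrite (lin0 qind_linear).
rewrite (linD qind_linear) -/(ind_elt DM y n); elim/uea_elim: y => [|a w y IHy].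
  by rewrite (lin0 (elt_linl n)) add0r.
rewrite (elt_linl n) -(linZ (elt_linr _)) -addrA; exact: PS.
Qed.

Lemma ind_ext (X : lmodType K) (F G : indU DM -> X) : linear F -> linear G ->
  (forall w n, F (elt (uw w) n) = G (elt (uw w) n)) -> F =1 G.
Proof.
move=> lF lG FG; elim/ind_elim => [|w n x IH]; first by rewrite !lin0.
by rewrite (linD lF) (linD lG) IH FG.
Qed.

Section IndLift.
Variables (X : lmodType K) (b : U -> Md -> X).
Hypothesis bb : bilin b.
Hypothesis b_neg : forall w d x n, (d < 0)%R -> x \in hat_gr V d -> b (uw (rcons w x)) n = 0.
Hypothesis b_zero : forall w s f n, f \in dvoa_gr V s ->
  b (uw (rcons w (hat_elt f (s - 1)))) n = b (uw w) (oz f n).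

Lemma ind_lift_rel r : ind_rel DM r -> tlift b r = 0.
Proof.
have lb := tlift_linear bb.
have ml := @uea_mul_linl K g br.
case=> [[y [d [x [n [d0 xd ->]]]]]|[y [s [f [n [fs ->]]]]]].
  rewrite tlift_pure //; elim/uea_elim: y => [|a w y IH].
    by rewrite (lin0 (ml _)) (lin0 (bb.1 _)).
  by rewrite (ml _ a) (bb.1 n a) IH uea_mul_word cats1 (b_neg _ _ d0 xd) scaler0 addr0.
rewrite (linB lb) !tlift_pure // (zhuPhi_qpi char0) -/(zero_mode DM f n).
elim/uea_elim: y => [|a w y IH].
  by rewrite (lin0 (ml _)) !(lin0 (bb.1 _)) subrr.
rewrite (ml _ a) !(bb.1 _ a) opprD addrACA IH uea_mul_word cats1 b_zero //.
by rewrite subrr addr0.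
Qed.

Definition ind_lift (x : indU DM) : X := tlift b (qrepr x).

Lemma ind_lift_linear : linear ind_lift.
Proof. exact: quot_lift_linear (tlift_linear bb) ind_lift_rel. Qed.

Lemma ind_lift_elt y n : ind_lift (elt y n) = b y n.
Proof. by rewrite /ind_lift (quot_lift (tlift_linear bb) ind_lift_rel) tlift_pure. Qed.

End IndLift.

Lemma uproj_bilin : bilin (fun (x : U) n => uproj n x).
Proof. by split=> [n|x]; [exact: uproj_linr|exact: uproj_linl]. Qed.

Lemma uproj_neg w d x n : (d < 0)%R -> x \in hat_gr V d -> uproj n (uw (rcons w x)) = 0.
Proof. by move=> d0 xd; rewrite uproj_word (wproj_neg _ _ d0 xd). Qed.

Lemma hat_elt_gr0 s f : f \in dvoa_gr V s -> hat_elt f (s - 1) \in hat_gr V 0.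
Proof.
move=> fs; have := hat_elt_gr (s - 1) fs; rewrite (_ : s - (s - 1) - 1 = 0) //; lia.
Qed.

Lemma zero_part_elt0 s f n : f \in dvoa_gr V s -> zero_part DM (hat_elt f (s - 1)) n = oz f n.
Proof. by move=> fs; rewrite (zero_part_elt char0 DM _ _ fs) ifT //; lia. Qed.

Lemma uproj_zero w s f n : f \in dvoa_gr V s ->
  uproj n (uw (rcons w (hat_elt f (s - 1)))) = uproj (oz f n) (uw w).
Proof.
move=> fs; rewrite !uproj_word wproj_zero ?(zero_part_elt0 _ fs) //.
exact: hat_elt_gr0.
Qed.

(** Negative elements and degree-zero elements at the end of a word act on
    [project] as prescribed in the induced module. The recursion [project] takes
    the place of a basis of the enveloping algebra in telling the degrees apart. *)
Definition ind_proj : indU DM -> Md := ind_lift (fun (x : U) n => uproj n x).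

Lemma ind_proj_linear : linear ind_proj.
Proof. exact: (ind_lift_linear uproj_bilin uproj_neg uproj_zero). Qed.

Lemma ind_proj_word w n : ind_proj (elt (uw w) n) = wproj n w.
Proof. by rewrite /ind_proj (ind_lift_elt uproj_bilin uproj_neg uproj_zero) uproj_word. Qed.

Lemma elt_neg w d x n : (d < 0)%R -> x \in hat_gr V d -> elt (uw (rcons w x)) n = 0.
Proof.
move=> d0 xd; rewrite -cats1 -uea_mul_word -(lin0 qind_linear); apply/qpi_eq.
by rewrite subr0; apply: mem_lspan; left; exists (uw w), d, x, n.
Qed.

Lemma elt_zero w s f n : f \in dvoa_gr V s ->
  elt (uw (rcons w (hat_elt f (s - 1)))) n = elt (uw w) (oz f n).
Proof.
move=> fs; rewrite -cats1 -uea_mul_word /zero_mode -(zhuPhi_qpi char0); apply/qpi_eq.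
by apply: mem_lspan; right; exists (uw w), s, f, n.
Qed.

Lemma elt_zero_gr w x n : x \in hat_gr V 0 -> elt (uw (rcons w x)) n = elt (uw w) (zero_part DM x n).
Proof.
move=> /hat_gr_zero x0.
have l1 : linear (fun x => elt (uw (rcons w x)) n).
  move=> a y z; rewrite -!cats1 uword_multilinear; exact: elt_linl.
have l2 : linear (fun x => elt (uw w) (zero_part DM x n)) by exact: lin_comp (elt_linr _) (Hol n).
apply/eqP; rewrite -subr_eq0; apply/eqP; move: x x0.
apply: lspan_eq0 => [a y z|_ [s [f [fs ->]]]].
  by rewrite l1 l2 scalerBr opprD addrACA.
by rewrite elt_zero // zero_part_elt0 // subrr.
Qed.

Section IndAction.
Variable z : U.

Lemma ind_act_bilin : bilin (fun (x : U) n => elt (uea_mul z x) n).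
Proof.
split=> [n|x]; last exact: elt_linr.
exact: lin_comp (elt_linl n) (@uea_mul_linr K g br z).
Qed.

Lemma ind_act_neg w d x n : (d < 0)%R -> x \in hat_gr V d -> elt (uea_mul z (uw (rcons w x))) n = 0.
Proof.
move=> d0 xd; elim/uea_elim: z => [|a v y IH].
  by rewrite (lin0 (@uea_mul_linl K g br _)) (lin0 (elt_linl _)).
rewrite (@uea_mul_linl K g br _ a) (elt_linl n a) IH uea_mul_word -rcons_cat.
by rewrite (elt_neg _ _ d0 xd) scaler0 addr0.
Qed.

Lemma ind_act_zero w s f n : f \in dvoa_gr V s ->
  elt (uea_mul z (uw (rcons w (hat_elt f (s - 1))))) n = elt (uea_mul z (uw w)) (oz f n).
Proof.
move=> fs; elim/uea_elim: z => [|a v y IH].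
  by rewrite !(lin0 (@uea_mul_linl K g br _)) !(lin0 (elt_linl _)).
rewrite !(@uea_mul_linl K g br _ a) !(elt_linl _ a) IH !uea_mul_word -rcons_cat.
by rewrite elt_zero.
Qed.

Lemma ind_act_linr : linear (@ind_act K V M DM z).
Proof. exact: (ind_lift_linear ind_act_bilin ind_act_neg ind_act_zero). Qed.

Lemma ind_act_elt x n : ind_act z (elt x n) = elt (uea_mul z x) n.
Proof. exact: (ind_lift_elt ind_act_bilin ind_act_neg ind_act_zero). Qed.

End IndAction.

Lemma ind_act_linl (x : indU DM) : linear (fun z : U => ind_act z x).
Proof.
move=> a z z'; elim/ind_elim: x => [|w n x IH].
  by rewrite !(lin0 (ind_act_linr _)) scaler0 addr0.
rewrite !(linD (ind_act_linr _)) IH !ind_act_elt (@uea_mul_linl K g br _ a) (elt_linl n a).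
by rewrite scalerDr addrACA.
Qed.

Lemma ind_actA (z z' : U) (x : indU DM) : ind_act z (ind_act z' x) = ind_act (uea_mul z z') x.
Proof.
move: x; apply: ind_ext => [||w n].
- exact: lin_comp (ind_act_linr _) (ind_act_linr _).
- exact: ind_act_linr.
by rewrite !ind_act_elt uea_mulA.
Qed.

Lemma ind_act_word u w n : ind_act (uw u) (elt (uw w) n) = elt (uw (u ++ w)) n.
Proof. by rewrite ind_act_elt uea_mul_word. Qed.

(** Letters of positive degree can be moved to the left, at the cost of shorter
    words; when the degree is not positive, none can be left over. *)
Lemma elt_nonpos (w : seq (int * g)) n : homogeneous_word (hat_gr V) w ->
  (\sum_(p <- w) p.1 <= 0)%R ->
  elt (uw (map snd w)) n \in lspan (if \sum_(p <- w) p.1 == 0 then range (elt (uw [::])) else set0).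
Proof.
move: {2}(size w) (erefl (size w)) => k.
elim: k w n => [|k IH] w n.
  by case: w => //= _ _ _; rewrite big_nil eqxx; apply: mem_lspan; exists n.
case/lastP: w => [//|w [d y]]; rewrite size_rcons => -[sw] hw.
have yd : y \in hat_gr V d by apply: (hw (d, y)); rewrite mem_rcons mem_head.
have {}hw : homogeneous_word (hat_gr V) w.
  by move=> p pw; apply: hw; rewrite mem_rcons inE pw orbT.
have -> : \sum_(p <- rcons w (d, y)) p.1 = \sum_(p <- w) p.1 + d.
  by rewrite -cats1 big_cat big_seq1.
rewrite map_rcons /=; set S := \sum_(p <- w) p.1 => deg.
have [d0|d0|d0] := ltgtP d 0.
- by rewrite (elt_neg _ _ d0 yd) rpred0.
- rewrite (dsum_rcons (br := br) (hat_bracket_antisym char0)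
    (P := fun w => elt (uw w) n)) => [|u' x a]; last first.
    split=> [|v]; first exact: (lin_comp (elt_linl n) (@uword_linear K g br u' a)).
    by rewrite -(linB (elt_linl n)) uword_bracket.
  apply: submodB.
    have := IH w n sw hw; rewrite -/S ifF; last by apply/negbTE; move: deg; lia.
    rewrite -cat1s -ind_act_word => w0.
    have -> : elt (uw (map snd w)) n = 0.
      have : elt (uw (map snd w)) n \in lspan set0 by apply: w0; lia.
      by move: (elt _ n); apply: lspan_elim.
    by rewrite (lin0 (ind_act_linr _)) rpred0.
  apply: (dsum_mem (gr := hat_gr V) Hbrg yd hw) => w' hw' sw' dw'.
  by rewrite (addrC _ d) -dw'; apply: IH; rewrite ?sw' // dw' addrC.
subst d; rewrite elt_zero_gr // addr0; apply: IH => //.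
by move: deg; rewrite addr0.
Qed.

Lemma elt_negative (w : seq (int * g)) n : homogeneous_word (hat_gr V) w ->
  (\sum_(p <- w) p.1 < 0)%R -> elt (uw (map snd w)) n = 0.
Proof.
move=> hw neg; have := elt_nonpos n hw (ltW neg); rewrite ifF; last by apply/negbTE; lia.
by move: (elt _ n); apply: lspan_elim.
Qed.

Lemma elt_degree0 (w : seq (int * g)) n : homogeneous_word (hat_gr V) w ->
  \sum_(p <- w) p.1 = 0 -> elt (uw (map snd w)) n = elt (uw [::]) (wproj n (map snd w)).
Proof.
move=> hw e; have := elt_nonpos n hw; rewrite e eqxx => /(_ (lexx _)) H.
have [c ec] : exists c, elt (uw (map snd w)) n = elt (uw [::]) c.
  move: (elt _ n) H; apply: lspan_elim.
    by exists 0; rewrite (lin0 (elt_linr _)).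
  by move=> a _ y [c _ <-] [c' ->]; exists (a *: c + c'); rewrite elt_linr.
by rewrite ec; have := congr1 ind_proj ec; rewrite !ind_proj_word wproj_nil => ->.
Qed.

Definition hat_generators : set g :=
  [set x | exists s f m, f \in dvoa_gr V s /\ x = hat_elt f m].

Lemma hat_generators_span x : x \in lspan hat_generators.
Proof.
elim/hat_elim: x => [|s f m x fs IH]; first exact: rpred0.
by rewrite rpredD //; apply: mem_lspan; exists s, f, m.
Qed.

Lemma generators_homogeneous w : (forall z, z \in w -> hat_generators z) ->
  exists2 w' : seq (int * g), homogeneous_word (hat_gr V) w' & w = map snd w'.
Proof.
elim: w => [|x w IH] gw; first by exists [::].
have [w' hw' ew] := IH (fun z zw => gw z (mem_behead (s := x :: w) zw)).
have [s [f [m [fs ->]]]] := gw x (mem_head x w).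
exists ((s - m - 1, hat_elt f m) :: w'); last by rewrite /= ew.
by move=> p; rewrite inE => /predU1P[->|/hw' //]; exact: hat_elt_gr.
Qed.

Lemma ind_span (x : indU DM) : x \in lspan [set y | exists (w : seq (int * g)) n,
  homogeneous_word (hat_gr V) w /\ y = elt (uw (map snd w)) n].
Proof.
elim/ind_elim: x => [|w n x IH]; first exact: rpred0.
rewrite rpredD //; have := uea_span (br := br) hat_generators_span (uw w).
apply: (lspan_lin (elt_linl n)).
move=> _ [v gv <-]; have [w' hw' ->] := generators_homogeneous gv.
by apply: mem_lspan; exists w', n.
Qed.

(** The induced module has no negative degrees and its degree-zero part is the
    dual of [M], so such a functional is determined by [e]. *)
Lemma extends_by_zeroE (e : dual Md) (phi : dual (indU DM)) (x : indU DM) :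
  extends_by_zero e phi -> subsp_val phi x = subsp_val e (ind_proj x).
Proof.
move=> [phi0 phi_pos]; have lphi := dual_linear phi; have le := dual_linear e.
apply/eqP; rewrite -subr_eq0; apply/eqP; move: x (ind_span x).
apply: (@lspan_eq0 _ _ _ (fun x => subsp_val phi x - subsp_val e (ind_proj x) : K^o))
  => [a x y|_ [w [n [hw ->]]]].
  by rewrite ind_proj_linear lphi le scalerBr opprD addrACA.
rewrite ind_proj_word; have [neg|pos|e0] := ltgtP (\sum_(p <- w) p.1) 0.
- rewrite elt_negative // (lin0 lphi) wproj_degree ?(lin0 le) ?subrr //; lia.
- rewrite (phi_pos _ _ pos) ?wproj_degree ?(lin0 le) ?subrr //; first by lia.
  apply: mem_lspan; exists (uw (map snd w)), n; split=> //.
  by apply: mem_lspan; exists w.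
by rewrite elt_degree0 // phi0 subrr.
Qed.

Lemma ind_proj_extends (m : M) :
  exists e (phi : dual (indU DM)), extends_by_zero e phi /\
    forall x, subsp_val phi x = subsp_val (ind_proj x) m.
Proof.
have pe : (fun n : Md => subsp_val n m : K^o) \in linear_functionals Md.
  by apply/asboolP => a u v.
have pp : (fun x => subsp_val (ind_proj x) m : K^o) \in linear_functionals (indU DM).
  by apply/asboolP => a u v; rewrite ind_proj_linear.
exists (Subsp pe), (Subsp pp); split=> //; split=> /= [n|d x d0 xd].
  by rewrite ind_proj_word.
suff -> : ind_proj x = 0 by [].
move: x xd; apply: lspan_eq0; first exact: ind_proj_linear.
move=> _ [u [n [ud ->]]]; move: u ud; apply: lspan_eq0.
  exact: lin_comp ind_proj_linear (elt_linl n).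
move=> _ [w [hw dw ->]]; rewrite ind_proj_word wproj_degree // dw.
by rewrite gt_eqF.
Qed.

(** Evaluations at elements of [M] are among the functionals that define [J], and
    they separate the dual of [M]. *)
Lemma indJP (x : indU DM) : x \in indJ DM <-> forall z : U, ind_proj (ind_act z x) = 0.
Proof.
split=> [xJ z|x0].
  have lz := lin_comp ind_proj_linear (ind_act_linr z).
  move: x xJ; apply: (lspan_eq0 lz) => x Hx; apply: dual_ext => m.
  have [e [phi [ext phiE]]] := ind_proj_extends m.
  by rewrite -phiE (Hx e phi z ext).
apply: mem_lspan => e phi z ext.
by rewrite (extends_by_zeroE _ ext) x0 (lin0 (dual_linear e)).
Qed.

Lemma indJ_act (z : U) (x : indU DM) : x \in indJ DM -> ind_act z x \in indJ DM.
Proof. by move=> /indJP xJ; apply/indJP => z'; rewrite ind_actA. Qed.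

End InducedModule.

(** * The quotient by [J] as a module for [V'] *)

Section LModuleStructure.
Variables (K : fieldType) (V : gvoc K) (M : lmodType K).
Hypothesis char0 : forall n, n.+1%:R != 0 :> K.
Variable DM : {linear M -> tensor (zhuC V) M}.
Hypothesis hDM : zhu_comodule DM.
Variable N : int.
Hypothesis HN : forall s (f : dvoa V), (s < N)%R -> f \in dvoa_gr V s -> f = 0.

Local Notation g := (hat V).
Local Notation br := (@hat_bracket K V).
Local Notation U := (uea br).
Local Notation uw := (@uea_word K (hat V) br).
Local Notation Md := (dual M).
Local Notation oz := (zero_mode DM).
Local Notation elt := (@ind_elt K V M DM).
Local Notation L := (Lst DM).
Local Notation qL := (qpi (indJ DM)).
Local Notation iproj := (@ind_proj K V M DM N).
Local Notation alr := (ind_act_linr char0 (DM := DM)).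
Local Notation all := (ind_act_linl char0 (DM := DM)).
Implicit Types (n : Md) (f h : dvoa V).

Lemma qL_linear : linear qL. Proof. exact: qpi_linear. Qed.

Lemma qL_repr x : qrepr (qL x) - x \in indJ DM.
Proof. by apply/qpi_eq; rewrite qreprK. Qed.

Lemma qL_act (z : U) x : qL (ind_act z (qrepr (qL x))) = qL (ind_act z x).
Proof.
apply/qpi_eq; rewrite -(linB (alr z)).
exact: (indJ_act char0 hDM HN) (qL_repr x).
Qed.

Lemma Lst_modeE k f x : Lst_mode k f (qL x) = qL (ind_act (uw [:: hat_elt f k]) x).
Proof. exact: qL_act. Qed.

Lemma uw1_linear : linear (fun x : g => uw [:: x]).
Proof. exact: (@uword_linear K g br [::] [::]). Qed.

Lemma ind_act1 x : ind_act (uw [::]) x = x :> indU DM.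
Proof. by move: x; apply: (ind_ext (alr _)) => // w n; rewrite (ind_act_word char0). Qed.

Lemma Lst_elim (P : L -> Prop) : (forall x, P (qL x)) -> forall x, P x.
Proof. by move=> PS x; rewrite -[x]qreprK. Qed.

Lemma Lst_mode_linl k x : linear (fun f => Lst_mode k f x : L).
Proof.
elim/Lst_elim: x => x a f h; rewrite !Lst_modeE (hat_elt_linear k a) (uw1_linear a).
by rewrite (all x a) qL_linear.
Qed.

Lemma Lst_mode_linr k f : linear (Lst_mode k f : L -> L).
Proof.
move=> a x y; rewrite -[x]qreprK -[y]qreprK -qL_linear !Lst_modeE.
by rewrite (alr _ a) qL_linear.
Qed.

Lemma Lst_mode_comm k j f h (x : L) :
  Lst_mode k f (Lst_mode j h x) - Lst_mode j h (Lst_mode k f x) =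
  nsum (fun i => binz K k i *: Lst_mode (k + j - i%:Z) (dmode i%:Z f h) x).
Proof.
elim/Lst_elim: x => x; rewrite !Lst_modeE !(ind_actA char0) !uea_mul_word /=.
rewrite -(linB qL_linear) -(linB (all x)) (@uword_bracket K g br [::] _ _ [::]) /=.
rewrite (hat_bracketE char0).
have lq : linear (fun z : g => qL (ind_act (uw [:: z]) x)).
  exact: lin_comp qL_linear (lin_comp (all x) uw1_linear).
rewrite (nsum_lin lq); last exact: hat_sum_ev0.
by apply: eq_nsum => i; rewrite (linZ lq) Lst_modeE.
Qed.

Lemma Lst_mode_dT k f (x : L) : Lst_mode k (dT f) x = (- k)%:~R *: Lst_mode (k - 1) f x.
Proof.
elim/Lst_elim: x => x; rewrite !Lst_modeE hat_elt_dT (linZ uw1_linear) (linZ (all x)).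
exact: (linZ qL_linear).
Qed.

Lemma hat_elt_one k : k != -1 -> hat_elt (one V char0) k = 0.
Proof.
move=> k1; have k10 : (- (k + 1))%:~R != 0 :> K by apply: (intr_neq0 char0); lia.
apply: (scalerI k10); have := hat_elt_dT (one V char0) (k + 1).
by rewrite addrK dT_one (lin0 (hat_elt_linear _)) scaler0 => <-.
Qed.

Lemma hat_one_central x : br (hat_elt (one V char0) (-1)) x = 0.
Proof.
elim/hat_elim: x => [|s f m x fs IH]; first exact: (lin0 (hat_bracket_linr char0 _)).
rewrite (linD (hat_bracket_linr char0 _)) IH addr0 (hat_bracketE char0) -[RHS]nsum0.
by apply: eq_nsum => i; rewrite one_dmode (lin0 (hat_elt_linear _)) scaler0.
Qed.

(** Translation kills the vacuum, so its modes vanish except the one with index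
    [-1], which is central and acts as the identity on generators. *)
Lemma Lst_mode_one k (x : L) : Lst_mode k (one V char0) x = if k == -1 then x else 0.
Proof.
elim/Lst_elim: x => x; rewrite Lst_modeE; case: eqVneq => [->|k1]; last first.
  by rewrite (hat_elt_one k1) (lin0 uw1_linear) (lin0 (all x)) (lin0 qL_linear).
congr qL; move: x; apply: (ind_ext (alr _)) => // w n.
rewrite (ind_act_word char0) /=; set e := hat_elt _ _.
have H u : uw (u ++ e :: w) = uw (u ++ rcons w e).
  elim: w u => [|y w IH] u //=; have := uword_bracket br u e y w.
  rewrite hat_one_central (lin0 (@uword_linear K g br u w)) => /eqP; rewrite subr_eq0 => /eqP ->.
  by rewrite -cat_rcons IH cat_rcons.
rewrite (H [::]) /= (_ : e = hat_elt (one V char0) (0 - 1)) // (elt_zero char0) ?(zero_mode_one char0 hDM) //.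
exact: one_gr.
Qed.

Lemma hom_word_span (x : L) : x \in lspan [set y | exists (w : seq (int * g)) n,
  homogeneous_word (hat_gr V) w /\ y = qL (elt (uw (map snd w)) n)].
Proof.
elim/Lst_elim: x => x; move: x (ind_span x); apply: (lspan_lin qL_linear).
by move=> _ [w [n [hw ->]]]; apply: mem_lspan; exists w, n.
Qed.

Lemma cons_homogeneous s f k (w : seq (int * g)) : f \in dvoa_gr V s ->
  homogeneous_word (hat_gr V) w -> homogeneous_word (hat_gr V) ((s - k - 1, hat_elt f k) :: w).
Proof.
by move=> fs hw p; rewrite inE => /predU1P[->|/hw //]; exact: hat_elt_gr.
Qed.

Lemma Lst_mode_word k f (w : seq (int * g)) s n :
  Lst_mode k f (qL (elt (uw (map snd w)) n)) =
  qL (elt (uw (map snd ((s - k - 1, hat_elt f k) :: w))) n).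
Proof. by rewrite Lst_modeE (ind_act_word char0). Qed.

Lemma Lst_mode_trunc f (x : L) : exists B : int, forall k, (B <= k)%R -> Lst_mode k f x = 0.
Proof.
elim/dvoa_elim: f => [|s f f' fs [B' HB']].
  by exists 0 => k _; rewrite (lin0 (Lst_mode_linl k x)).
suff [B HB] : exists B : int, forall k, (B <= k)%R -> Lst_mode k f x = 0.
  exists (Num.max B B') => k; rewrite ge_max => /andP[kB kB'].
  by rewrite (linD (Lst_mode_linl k x)) HB ?HB' ?addr0.
move: x {HB'} (hom_word_span x); apply: lspan_elim => [|a _ x [w [n [hw ->]]] [B HB]].
  by exists 0 => k _; rewrite (lin0 (Lst_mode_linr k f)).
exists (Num.max B (s + \sum_(p <- w) p.1)) => k; rewrite ge_max => /andP[kB kw].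
rewrite (linD (Lst_mode_linr k f)) (linZ (Lst_mode_linr k f)) HB // addr0.
rewrite (Lst_mode_word k f w s) (elt_negative char0) ?(lin0 qL_linear) ?scaler0 //.
  exact: cons_homogeneous.
by rewrite big_cons /=; move: (\sum_(p <- w) p.1) kw => S; lia.
Qed.

Lemma Lst_mode_ev0 m f (x : L) : eventually0 (fun i => Lst_mode (m + i%:Z) f x).
Proof.
have [B HB] := Lst_mode_trunc f x.
exact: (@eventually0_int _ _ (fun k => Lst_mode k f x) B).
Qed.

Definition Lst_proj (x : L) : Md := iproj (qrepr x).
Definition Lst_incl n : L := qL (elt (uw [::]) n).

Lemma Lst_projE x : Lst_proj (qL x) = iproj x.
Proof.
have lp := ind_proj_linear char0 hDM HN.
apply/eqP; rewrite -subr_eq0 -(linB lp); apply/eqP.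
by have /(indJP char0 hDM HN) /(_ (uw [::])) := qL_repr x; rewrite ind_act1.
Qed.

Lemma Lst_proj_linear : linear Lst_proj.
Proof.
move=> a x y; rewrite -[x]qreprK -[y]qreprK -qL_linear !Lst_projE.
exact: (ind_proj_linear char0 hDM HN).
Qed.

Lemma Lst_incl_linear : linear Lst_incl.
Proof. by move=> a x y; rewrite /Lst_incl elt_linr qL_linear. Qed.

Lemma Lst_proj_word w n : Lst_proj (qL (elt (uw w) n)) = wproj DM N n w.
Proof. by rewrite Lst_projE (ind_proj_word char0 hDM HN). Qed.

Lemma Lst_proj_incl n : Lst_proj (Lst_incl n) = n.
Proof. exact: Lst_proj_word. Qed.

Lemma Lst_mode_incl_neg s k f n : f \in dvoa_gr V s -> (s - k - 1 < 0)%R ->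
  Lst_mode k f (Lst_incl n) = 0.
Proof.
move=> fs neg; rewrite Lst_modeE (ind_act_word char0) /=.
by rewrite (elt_neg DM [::] n neg (hat_elt_gr k fs)) (lin0 qL_linear).
Qed.

Lemma Lst_mode_incl_zero s f n : f \in dvoa_gr V s ->
  Lst_mode (s - 1) f (Lst_incl n) = Lst_incl (oz f n).
Proof.
move=> fs; rewrite Lst_modeE (ind_act_word char0) /=.
by rewrite (elt_zero char0 DM [::] n fs).
Qed.

Local Opaque Lst_mode Lst_proj.

Lemma Lst_proj_mode0 s f (x : L) : f \in dvoa_gr V s ->
  Lst_proj (Lst_mode (s - 1) f x) = oz f (Lst_proj x).
Proof.
move=> fs; have gd := hat_elt_gr0 fs.
have l1 := lin_comp Lst_proj_linear (Lst_mode_linr (s - 1) f).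
have l2 := lin_comp (zero_mode_linr DM f) Lst_proj_linear.
move: x (hom_word_span x); apply: (lspan_ext l1 l2) => _ [w [n [hw ->]]].
rewrite (Lst_mode_word _ f w s) !Lst_proj_word.
by rewrite (wproj_zero_head char0 DM HN n (map snd w) gd) (zero_part_elt0 char0 DM _ fs).
Qed.

Lemma Lst_proj_mode_pos s k f (x : L) : f \in dvoa_gr V s -> (0 < s - k - 1)%R ->
  Lst_proj (Lst_mode k f x) = 0.
Proof.
move=> fs pos; have gd := hat_elt_gr k fs.
have l1 := lin_comp Lst_proj_linear (Lst_mode_linr k f).
move: x (hom_word_span x); apply: (lspan_eq0 l1) => _ [w [n [hw ->]]].
rewrite (Lst_mode_word k f w s) Lst_proj_word.
exact: (wproj_pos char0 DM HN n (map snd w) pos gd).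
Qed.

Lemma act_word_qL (w : seq (int * dvoa V)) x :
  act_word (fun k f (y : L) => Lst_mode k f y) w (qL x)
  = qL (ind_act (uw [seq hat_elt p.2 p.1 | p <- w]) x).
Proof.
elim: w => [|[k f] w IH] /=; first by rewrite ind_act1.
by rewrite IH Lst_modeE (ind_actA char0) uea_mul_word.
Qed.

Lemma generator_word w : (forall z, z \in w -> @hat_generators K V z) ->
  exists w' : seq (int * dvoa V), w = [seq hat_elt p.2 p.1 | p <- w'].
Proof.
elim: w => [|x w IH] gw; first by exists [::].
have [w' ->] := IH (fun z zw => gw z (mem_behead (s := x :: w) zw)).
have [s [f [m [fs ->]]]] := gw x (mem_head x w).
by exists ((m, f) :: w').
Qed.

Lemma Lst_proj_separates (x : L) :
  (forall w, Lst_proj (act_word (fun k f (y : L) => Lst_mode k f y) w x) = 0) -> x = 0.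
Proof.
elim/Lst_elim: x => x H; rewrite -(lin0 qL_linear); apply/qpi_eq; rewrite subr0.
have lp := ind_proj_linear char0 hDM HN.
apply/(indJP char0 hDM HN) => z.
move: z (uea_span (br := br) (@hat_generators_span K V) z).
apply: lspan_eq0; first exact: lin_comp lp (all x).
move=> _ [v gv <-]; have [w ->] := generator_word gv.
by rewrite -Lst_projE -act_word_qL H.
Qed.

Lemma Lst_span (x : L) : x \in lspan [set y | exists w n,
   y = act_word (fun k f (y : L) => Lst_mode k f y) w (Lst_incl n)].
Proof.
elim/Lst_elim: x => x; elim/ind_elim: x => [|w n x IH].
  by rewrite (lin0 qL_linear) rpred0.
rewrite (linD qL_linear) rpredD //.
have := uea_span (br := br) (@hat_generators_span K V) (uw w).
have lq : linear (fun z : U => qL (elt z n)) by exact: (lin_comp qL_linear (elt_linl DM n)).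
apply: (lspan_lin lq) => _ [v gv <-]; have [w' ->] := generator_word gv.
apply: mem_lspan; exists w', n; rewrite act_word_qL (ind_act_word char0) cats0 //.
Qed.

(** The commutator formula comes from the bracket on modes, the two rules for zero
    modes from the coassociativity of [M] and from the vanishing of [O(V')] on
    [C(V)], and dividing by [J] leaves no vector whose descendants are all
    invisible in degree zero. *)
Lemma Lst_borcherds l m k f h (x : L) :
  borcherds (@dmode K V) (fun k f (y : L) => Lst_mode k f y) l m k f h x = 0.
Proof.
apply: (@borcherds_extension K (dvoa V) L Md char0 (@dmode K V)
  (fun k f (y : L) => Lst_mode k f y) _ _ _ _ _ _ _ _ (dvoa_gr V) _ _
  Lst_incl Lst_proj oz).
- exact: dmode_linl.
- exact: dmode_linr.
- by move=> *; exact: eventually0_dmode.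
- exact: dmode_commutator.
- exact: Lst_mode_linl.
- exact: Lst_mode_linr.
- exact: Lst_mode_ev0.
- exact: Lst_mode_comm.
- exact: dvoa_elim.
- exact: dmode_gr.
- exact: Lst_proj_linear.
- exact: zero_mode_linr.
- exact: Lst_proj_incl.
- exact: Lst_mode_incl_neg.
- exact: Lst_mode_incl_zero.
- exact: Lst_proj_mode_pos.
- exact: Lst_proj_mode0.
- by move=> s a b n; exact: (zero_mode_mul hDM b n).
- by move=> l' s a b n sa l2; exact: (zero_mode_vanish char0 DM b n sa l2).
- exact: Lst_proj_separates.
exact: Lst_span.
Qed.

Lemma Lst_gr_words t (x : L) : x \in Lst_gr DM t -> x \in lspan [set y |
  exists (w : seq (int * g)) n, [/\ homogeneous_word (hat_gr V) w,
    \sum_(p <- w) p.1 = t%:Z & y = qL (elt (uw (map snd w)) n)]].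
Proof.
apply: lspan_ind => _ [y yt <-]; move: y yt.
apply: (lspan_lin qL_linear) => _ [u [n [ut ->]]].
have lq : linear (fun z : U => qL (elt z n)) by exact: (lin_comp qL_linear (elt_linl DM n)).
move: u ut; apply: (lspan_lin lq) => _ [w [hw dw ->]].
by apply: mem_lspan; exists w, n.
Qed.

Lemma words_Lst_gr t (w : seq (int * g)) n : homogeneous_word (hat_gr V) w ->
  \sum_(p <- w) p.1 = t%:Z -> qL (elt (uw (map snd w)) n) \in Lst_gr DM t.
Proof.
move=> hw dw; apply: mem_lspan; exists (elt (uw (map snd w)) n) => //.
apply: mem_lspan; exists (uw (map snd w)), n; split=> //; apply: mem_lspan; by exists w.
Qed.

Lemma Lst_gr_span (x : L) : x \in lspan [set y | exists t, y \in Lst_gr DM t].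
Proof.
move: x (hom_word_span x); apply: lspan_ind => _ [w [n [hw ->]]].
have [neg|nneg] := ltP (\sum_(p <- w) p.1) 0.
  by rewrite (elt_negative char0) // (lin0 qL_linear) rpred0.
apply: mem_lspan; exists (`|(\sum_(p <- w) p.1)%R|%N); apply: words_Lst_gr => //.
by rewrite gez0_abs.
Qed.

Lemma Lst_mode_gr s k f t r (x : L) : f \in dvoa_gr V s -> x \in Lst_gr DM t ->
  t%:Z + s - k - 1 = r%:Z -> Lst_mode k f x \in Lst_gr DM r.
Proof.
move=> fs /Lst_gr_words xt e; have lk := Lst_mode_linr k f.
move: x xt; apply: (lspan_lin lk) => _ [w [n [hw dw ->]]].
rewrite (Lst_mode_word k f w s); apply: words_Lst_gr; first exact: cons_homogeneous.
by rewrite big_cons /= dw; lia.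
Qed.

Lemma Lst_mode_gr_neg s k f t (x : L) : f \in dvoa_gr V s -> x \in Lst_gr DM t ->
  (t%:Z + s - k - 1 < 0)%R -> Lst_mode k f x = 0.
Proof.
move=> fs /Lst_gr_words xt neg; have lk := Lst_mode_linr k f.
move: x xt; apply: (lspan_eq0 lk) => _ [w [n [hw dw ->]]].
rewrite (Lst_mode_word k f w s) (elt_negative char0) ?(lin0 qL_linear) //.
  exact: cons_homogeneous.
by rewrite big_cons /= dw; lia.
Qed.

Lemma Lst_incl_gr n : Lst_incl n \in Lst_gr DM 0.
Proof. by apply: (@words_Lst_gr 0 [::] n) => //; rewrite big_nil. Qed.

Lemma Lst_gr0 (x : L) : x \in Lst_gr DM 0 -> exists n, x = Lst_incl n.
Proof.
move=> /Lst_gr_words; move: x; apply: lspan_elim => [|a _ x [w [n [hw dw ->]]] [c ->]].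
  by exists 0; rewrite (lin0 Lst_incl_linear).
exists (a *: wproj DM N n (map snd w) + c); rewrite Lst_incl_linear; congr (_ *: _ + _).
by rewrite (elt_degree0 char0 hDM HN n hw dw).
Qed.

Lemma Lst_proj_gr t (x : L) : (0 < t)%N -> x \in Lst_gr DM t -> Lst_proj x = 0.
Proof.
move=> t0 /Lst_gr_words; move: x; apply: (lspan_eq0 Lst_proj_linear).
move=> _ [w [n [hw dw ->]]]; rewrite Lst_proj_word.
by apply: (wproj_degree char0 DM HN n hw); rewrite dw; lia.
Qed.

End LModuleStructure.

(** * Comodule structure on the restricted dual *)

(** The pairing of a dual basis, read on the side of the functionals. *)
Lemma dvoa_basis (K : fieldType) (V : gvoc K) s :
  exists (n : nat) (e : nat -> V) (b : nat -> dvoa V),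
  [/\ forall i, (i < n)%N -> e i \in gr V s, forall i, b i \in dvoa_gr V s &
      forall f, f \in dvoa_gr V s -> f = \sum_(i < n) subsp_val f (e i) *: b i].
Proof.
have [n [e [b [es bs bE]]]] := dvoa_dual_basis V s.
exists n, e, b; split=> // f fs.
apply: rdual_ext; apply: (graded_ext (gc_sum (gvoc_graded V)) (rdual_linear _) (rdual_linear _)).
move=> r v vr; rewrite (lin_sum (@rdual_eval_linear _ _ _ (gr V) v)).
have [rs|rs] := eqVneq r s; last first.
  have /dvoa_gr0P f0 := fs; rewrite (f0 r v) //; last exact/eqP.
  rewrite big1 // => i _; have /dvoa_gr0P b0 := bs i.
  transitivity (subsp_val f (e i) * subsp_val (b i) v) => //.
  by rewrite (b0 r v) ?mulr0 //; exact/eqP.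
rewrite rs in vr; rewrite [in LHS](bE v vr) (lin_sum (dvoa_linear f)).
by apply: eq_bigr => i _; rewrite (linZ (dvoa_linear f)); exact: mulrC.
Qed.

Section DualComodule.
Variables (K : fieldType) (V : gvoc K) (M : lmodType K).
Hypothesis char0 : forall n, n.+1%:R != 0 :> K.
Variable DM : {linear M -> tensor (zhuC V) M}.
Hypothesis hDM : zhu_comodule DM.
Variable N : int.
Hypothesis HN : forall s (f : dvoa V), (s < N)%R -> f \in dvoa_gr V s -> f = 0.

Local Notation L := (Lst DM).
Local Notation Ld := (Ldual DM).
Local Notation one := (one V char0).
Local Notation mode_linl := (Lst_mode_linl char0 hDM HN).
Local Notation mode_linr := (Lst_mode_linr char0 hDM HN).
Local Notation mode_gr := (Lst_mode_gr char0 hDM HN).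
Local Notation mode_gr_neg := (Lst_mode_gr_neg char0 hDM HN).
Local Notation gr_span := (Lst_gr_span char0 (DM := DM)).
Implicit Types (f h : dvoa V) (y : L) (x : Ld).
Local Opaque Lst_mode dmode.

(** The Virasoro relations for the transposed operators, with the index of a mode
    of the conformal vector reflected: L(k) is the transpose of its mode 1 - k. *)
Lemma Lst_mode_virasoro k j y :
  Lst_mode (1 - j) (omega V) (Lst_mode (1 - k) (omega V) y)
  - Lst_mode (1 - k) (omega V) (Lst_mode (1 - j) (omega V) y) =
  (k - j)%:~R *: Lst_mode (1 - (k + j)) (omega V) y +
  (if k + j == 0 then (k ^+ 3 - k)%:~R / 12%:R * rank V else 0) *: y.
Proof.
rewrite (Lst_mode_comm char0 hDM HN) (@nsumE _ _ 4) => [|i i4]; last first.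
  rewrite (omega_omega V char0) ?(leq_trans _ i4) //.
  rewrite !gtn_eqF ?(leq_trans _ i4) //.
  by rewrite (lin0 (mode_linl _ _)) scaler0.
rewrite 4!big_ord_recl big_ord0 addr0 /= -/(dT (omega V)) (Lst_mode_dT char0 hDM HN).
rewrite !(omega_omega V char0) //=.
rewrite (lin0 (mode_linl _ _)) scaler0 add0r addrA binz_0 scale1r.
rewrite (linZ (mode_linl _ _)) (linZ (mode_linl _ _)) (Lst_mode_one char0 hDM HN).
rewrite addr0 /bump /= !add1n.
rewrite (_ : 1 - j + (1 - k) - 1 = 1 - (k + j)); last lia.
move: (Lst_mode (1 - (k + j)) (omega V) y) => X.
have aux (E : lmodType K) (a b c e : K) (u v w : E) : a + b * 2 = c -> e *: v = w ->
  a *: u + b *: (2 *: u) + e *: v = c *: u + w by move=> <- <-; rewrite (scalerDl u a (b * 2)) scalerA.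
apply: aux.
  rewrite /binz big_ord_recl big_ord0 subr0 mulr1 (_ : 1`! = 1%N) // divr1.
  by rewrite !(rmorphB, rmorphD, rmorphN) /=; ring.
rewrite (_ : (_ == -1) = (k + j == 0)); last by apply/eqP/eqP; lia.
case: eqP => [kj|_]; last by rewrite !scaler0 scale0r.
have aux' (E : lmodType K) (a b c : K) (u : E) : a * b = c -> a *: (b *: u) = c *: u.
  by move=> <-; rewrite scalerA.
apply: aux'; rewrite (_ : k = - j); last lia.
rewrite /binz !big_ord_recl big_ord0 mulr1 (_ : 3`! = 6%N) //=.
rewrite !(rmorphB, rmorphXn, rmorphN) /= /bump /= !add1n.
have [n2 n6 n12] := And3 (char0 1) (char0 5) (char0 11).
rewrite mulr0z mulr1z (_ : 2%Z%:~R = 2) // subr0.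
by field; rewrite ?n2 ?n6 ?n12.
Qed.

Lemma Ldual_ext x x' : (forall t y, y \in Lst_gr DM t -> subsp_val x y = subsp_val x' y) -> x = x'.
Proof.
move=> xx'; apply: rdual_ext => y; move: y (gr_span y).
by apply: (lspan_ext (rdual_linear x) (rdual_linear x')) => y [t]; exact: xx'.
Qed.

Lemma eval_linear y : linear (fun x : Ld => subsp_val x y : K^o).
Proof. by []. Qed.

Lemma adj_subproof k f x :
  (fun y => subsp_val x (Lst_mode k f y) : K^o) \in restricted_functionals (Lst_gr DM).
Proof.
have lx := rdual_linear x.
elim/dvoa_elim: f => [|s f f' fs IH].
  rewrite (_ : (fun y => _) = 0) ?rpred0 //; apply/funext => y.
  by rewrite (lin0 (mode_linl k y)) (lin0 lx).
rewrite (_ : (fun y => _) = (fun y => subsp_val x (Lst_mode k f y) : K^o)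
   + (fun y => subsp_val x (Lst_mode k f' y) : K^o)); last first.
  by apply/funext => y; rewrite (linD (mode_linl k y)) (linD lx).
apply: rpredD IH; apply/asboolP; split; first exact: lin_comp lx (mode_linr k f).
have fin := rdual_support x.
apply: (@sub_finite_set _ _ ((fun r : nat => `|(r%:Z - s + k + 1)%R|%N) @`
   fsupport (Lst_gr DM) (subsp_val x))); last exact: finite_image.
move=> t [y yt /= nz].
have [neg|nneg] := ltP (t%:Z + s - k - 1) 0.
  by rewrite (mode_gr_neg fs yt neg) (lin0 lx) eqxx in nz.
exists `|(t%:Z + s - k - 1)%R|%N; last by lia.
exists (Lst_mode k f y) => //; apply: (mode_gr fs yt); lia.
Qed.

(** The transpose of a mode of [L], which is the coaction contracted by [f]. *)
Definition adj k f x : Ld := Subsp (adj_subproof k f x).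

Lemma adj_linl k x : linear (fun f => adj k f x).
Proof.
move=> a f h; apply: rdual_ext => y.
transitivity (subsp_val x (Lst_mode k (a *: f + h) y)) => //.
by rewrite (mode_linl k y a) (rdual_linear x).
Qed.

Lemma adj_linr k f : linear (adj k f).
Proof. by move=> a x x'; apply: rdual_ext. Qed.

Lemma adj_gr s k f t r x : f \in dvoa_gr V s -> x \in Ldual_gr DM t ->
  t%:Z + k + 1 - s = r%:Z -> adj k f x \in Ldual_gr DM r.
Proof.
move=> fs /rdual_grP xt e; apply/rdual_grP => j y jr yj /=.
have [neg|nneg] := ltP (j%:Z + s - k - 1) 0.
  by rewrite (mode_gr_neg fs yj neg) (lin0 (rdual_linear x)).
apply: (xt `|(j%:Z + s - k - 1)%R|%N); first by lia.
apply: (mode_gr fs yj); lia.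
Qed.

Lemma adj_gr_neg s k f t x : f \in dvoa_gr V s -> x \in Ldual_gr DM t ->
  (t%:Z + k + 1 - s < 0)%R -> adj k f x = 0.
Proof.
move=> fs /rdual_grP xt neg; apply: Ldual_ext => j y yj /=.
have [neg'|nneg] := ltP (j%:Z + s - k - 1) 0.
  by rewrite (mode_gr_neg fs yj neg') (lin0 (rdual_linear x)).
apply: (xt `|(j%:Z + s - k - 1)%R|%N); first by lia.
apply: (mode_gr fs yj); lia.
Qed.

Lemma Ldual_bounded x : exists T : nat, forall t y, (T < t)%N -> y \in Lst_gr DM t ->
  subsp_val x y = 0.
Proof.
have /finite_seqP[A eA] := rdual_support x.
exists (\max_(i <- A) i)%N => t y Tt yt; apply/eqP/negPn/negP => nz.
have : fsupport (Lst_gr DM) (subsp_val x) t by exists y.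
rewrite eA /= => tA; move: Tt; rewrite ltnNge; apply/negP/negPn.
by rewrite (big_rem t) //= leq_maxl.
Qed.

(** Both the whole dual and its subspaces stable under transposed modes carry a
    coaction; they are treated together as a space [Z] embedded in the dual. *)
Section Coaction.
Variables (Z : lmodType K) (emb : Z -> Ld) (zadj : int -> dvoa V -> Z -> Z).
Hypothesis emb_lin : linear emb.
Hypothesis emb_inj : injective emb.
Hypothesis embE : forall k f z, emb (zadj k f z) = adj k f (emb z).

Definition ev y (z : Z) : K^o := subsp_val (emb z) y.

Lemma ev_linear y : linear (ev y).
Proof. exact: (lin_comp (eval_linear y) emb_lin). Qed.

Lemma ev_ext z z' : (forall y, ev y z = ev y z') -> z = z'.
Proof. by move=> zz'; apply: emb_inj; apply: rdual_ext => y; exact: zz'. Qed.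

Lemma tpair_dvoa_linear (h : Z -> K^o) p : linear h ->
  linear (fun f : dvoa V => tpair (subsp_val f) h p).
Proof. by move=> lh a f f'; exact: (tpair_linl _ _ (dvoa_linear f) (dvoa_linear f') lh). Qed.

Lemma ev_inv_linear (X : lmodType K) (F : X -> Z) :
  (forall a (x x' : X) y, ev y (F (a *: x + x')) = a *: ev y (F x) + ev y (F x')) -> linear F.
Proof. by move=> H a x x'; apply: ev_ext => y; rewrite H (ev_linear y). Qed.

Definition coaction_at k z (p : tensor V Z) : Prop :=
  forall f y, tpair (subsp_val f) (ev y) p = ev (Lst_mode k f y) z.

Lemma coaction_unique p q :
  (forall f y, tpair (subsp_val f) (ev y) p = tpair (subsp_val f) (ev y) q) -> p = q.
Proof.
move=> pq; apply/eqP; rewrite -subr_eq0; apply/eqP.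
apply: (tensor_separation (F := [set f | exists f' : dvoa V, f = subsp_val f'])
  (G := [set f | exists y, f = ev y])).
- by move=> _ [f ->]; exact: dvoa_linear.
- by move=> _ [y ->]; exact: ev_linear.
- by move=> v v0; apply: dvoa_separates => f; apply: v0; exists f.
- move=> z z0; apply: ev_ext => y; rewrite (lin0 (ev_linear y)).
  by apply: z0; exists y.
move=> _ _ [f ->] [y ->].
by rewrite (linB (tpair_linear (dvoa_linear f) (ev_linear y))) pq subrr.
Qed.

(** For functionals of a single weight the pairing condition is met by a sum over
    a basis of [V_s] and its dual basis. *)
Lemma weight_coaction s k z : exists p : tensor V Z,
  [/\ forall f y, f \in dvoa_gr V s -> tpair (subsp_val f) (ev y) p = ev (Lst_mode k f y) z,
      forall r f y, r != s -> f \in dvoa_gr V r -> tpair (subsp_val f) (ev y) p = 0 &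
      p \in lspan [set q | exists v f, [/\ v \in gr V s, f \in dvoa_gr V s & q = pure v (zadj k f z)]]].
Proof.
have [n [e [b [es bs fE]]]] := dvoa_basis V s.
exists (\sum_(i < n) pure (e i) (zadj k (b i) z)).
have E f y : tpair (subsp_val f) (ev y) (\sum_(i < n) pure (e i) (zadj k (b i) z)) =
    \sum_(i < n) subsp_val f (e i) * ev (Lst_mode k (b i) y) z.
  have lf := dvoa_linear f; have le := ev_linear y.
  rewrite (lin_sum (tpair_linear lf le)); apply: eq_bigr => i _.
  by rewrite tpair_pure // /ev embE.
split=> [f y fs|r f y rs|].
- rewrite E [in RHS](fE f fs) /ev (lin_sum (mode_linl k y)) (lin_sum (rdual_linear (emb z))).
  by apply: eq_bigr => i _; rewrite (linZ (mode_linl k y)) (linZ (rdual_linear (emb z))).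
- move=> /dvoa_gr0P f0; rewrite E big1 // => i _.
  by rewrite (f0 s) ?mul0r //; [apply/eqP; rewrite eq_sym | exact: es].
apply: rpred_sum => i _; apply: mem_lspan; exists (e i), (b i); split=> //; exact: es.
Qed.

Definition homogeneous_tensors k z : set (tensor V Z) := [set q | exists s v f,
  [/\ v \in gr V s, f \in dvoa_gr V s & q = pure v (zadj k f z)]].

Lemma partial_coaction k z (n : nat) : exists p : tensor V Z,
  [/\ forall s f y, (N <= s < N + n%:Z)%R -> f \in dvoa_gr V s ->
        tpair (subsp_val f) (ev y) p = ev (Lst_mode k f y) z,
      forall s f y, (N + n%:Z <= s)%R -> f \in dvoa_gr V s ->
        tpair (subsp_val f) (ev y) p = 0 &
      p \in lspan (homogeneous_tensors k z)].
Proof.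
elim: n => [|n [p [p1 p0 ps]]].
  exists 0; split=> [s f y|s f y _ _|]; [lia| |exact: rpred0].
  exact: (lin0 (tpair_linear (dvoa_linear f) (ev_linear y))).
have [q [q1 q0 qs]] := weight_coaction (N + n%:Z) k z.
exists (p + q); split=> [s f y sn fs|s f y sn fs|].
- rewrite (linD (tpair_linear (dvoa_linear f) (ev_linear y))).
  have [e|ne] := eqVneq s (N + n%:Z).
    by rewrite (p0 s f y) ?e // ?add0r ?q1 // -e.
  by rewrite (p1 s f y) // ?(q0 s f y) ?addr0 //; lia.
- rewrite (linD (tpair_linear (dvoa_linear f) (ev_linear y))).
  rewrite (p0 s f y) // ?(q0 s f y) ?addr0 //; lia.
rewrite rpredD //; move: q qs {q1 q0}; apply: lspan_ind => _ [v [f [vs fs ->]]].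
by apply: mem_lspan; exists (N + n%:Z), v, f.
Qed.

Lemma high_mode_vanish (T : nat) s k f y z :
  (forall t y, (T < t)%N -> y \in Lst_gr DM t -> ev y z = 0) ->
  f \in dvoa_gr V s -> (T%:Z + k + 1 < s)%R -> ev (Lst_mode k f y) z = 0.
Proof.
move=> zT fs Ts; have lf := lin_comp (rdual_linear (emb z)) (mode_linr k f).
move: y (gr_span y); apply: (lspan_eq0 lf) => y [r yr].
have [neg|nneg] := ltP (r%:Z + s - k - 1) 0.
  by rewrite (mode_gr_neg fs yr neg) (lin0 (rdual_linear (emb z))).
apply: (zT `|(r%:Z + s - k - 1)%R|%N); first by lia.
apply: (mode_gr fs yr); lia.
Qed.

(** Finitely many weights suffice: weights are bounded below, and modes of high
    weight raise the degree beyond the support of the functional. The second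
    property serves to locate the coaction in the grading. *)
Lemma coaction_exists k z : exists2 p, coaction_at k z p & p \in lspan (homogeneous_tensors k z).
Proof.
have [T zT] := Ldual_bounded (emb z).
have [p [p1 p0 ps]] := partial_coaction k z (`|(T%:Z + k + 2 - N)%R|%N).
exists p => // f y; elim/dvoa_elim: f => [|s f f' fs IH].
  rewrite (lin0 (tpair_dvoa_linear p (ev_linear y))) (lin0 (mode_linl k y)) /ev.
  by rewrite (lin0 (rdual_linear (emb z))).
rewrite (linD (tpair_dvoa_linear p (ev_linear y))) IH (linD (mode_linl k y)).
rewrite /ev (linD (rdual_linear (emb z))) -/(ev _ z); congr (_ + _).
have [sN|Ns] := ltP s N.
  rewrite (HN sN fs) (lin0 (tpair_dvoa_linear p (ev_linear y))) (lin0 (mode_linl k y)).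
  by rewrite /ev (lin0 (rdual_linear (emb z))).
have [sn|ns] := ltP s (N + (`|(T%:Z + k + 2 - N)%R|%N)%:Z); first by apply: p1 fs; lia.
rewrite (p0 s) //; symmetry; apply: (high_mode_vanish y zT fs); lia.
Qed.

Definition coaction k z : tensor V Z := xget 0 [set p | coaction_at k z p].

Lemma coactionP k z : coaction_at k z (coaction k z).
Proof.
by have [p cp _] := coaction_exists k z; exact: (@xgetI _ 0 [set p | coaction_at k z p] p cp).
Qed.

Lemma coaction_span k z : coaction k z \in lspan (homogeneous_tensors k z).
Proof.
have [p cp ps] := coaction_exists k z; rewrite (_ : coaction k z = p) //.
by apply: coaction_unique => f y; rewrite coactionP cp.
Qed.

Lemma coaction_lin k : linear (coaction k).
Proof.
move=> a z z'; apply: coaction_unique => f y; have le := ev_linear.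
rewrite coactionP (tpair_linear (dvoa_linear f) (le y)) !coactionP.
exact: ev_linear.
Qed.

HB.instance Definition _ k := GRing.isLinear.Build K Z (tensor V Z) *:%R (coaction k) (coaction_lin k).

Definition Zcoaction k : {linear Z -> tensor V Z} := coaction k.

Lemma ZcoactionP k z f y : tpair (subsp_val f) (ev y) (Zcoaction k z) = ev (Lst_mode k f y) z.
Proof. exact: coactionP. Qed.

Lemma Zcoaction_linear k : linear (Zcoaction k).
Proof. exact: coaction_lin. Qed.

Local Opaque Zcoaction.

Lemma Zcoaction_trunc : truncated Zcoaction.
Proof.
move=> z; have [T zT] := Ldual_bounded (emb z).
exists (N - T%:Z - 1) => k kN; apply: coaction_unique => f y; rewrite ZcoactionP.
rewrite (lin0 (tpair_linear (dvoa_linear f) (ev_linear y))).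
have lf g := lin_comp (rdual_linear (emb z)) (mode_linl k g).
elim/dvoa_elim: f => [|s f f' fs IH]; first exact: (lin0 (lf y)).
rewrite /ev (linD (lf y)) [X in _ + X]IH addr0.
have [sN|Ns] := ltP s N; first by rewrite (HN sN fs) (lin0 (lf y)).
apply: (high_mode_vanish y zT fs); lia.
Qed.

Lemma Zcoaction_counit k z :
  contrl (counit V) (Zcoaction k z) = if k == -1 then z else 0.
Proof.
apply: ev_ext => y; rewrite -tpair_contrl; [|exact: counit_linear|exact: ev_linear].
rewrite -[counit V : V -> K^o]/(subsp_val one) ZcoactionP (Lst_mode_one char0 hDM HN).
by case: eqP => _; rewrite ?(lin0 (ev_linear y)) // /ev (lin0 (rdual_linear (emb z))).
Qed.

(** Products of functionals separate the points of the triple tensor product, and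
    on them the identity is the transposed Borcherds identity of [L]. *)
Lemma Zcoaction_jacobi : jacobi (coact V) Zcoaction.
Proof.
move=> l m n x; apply/eqP; rewrite -subr_eq0; apply/eqP.
pose F := [set p : tensor V V -> K^o |
  exists f h : dvoa V, p = tpair (subsp_val f) (subsp_val h)].
apply: (tensor_separation (F := F) (G := [set p : Z -> K^o | exists y, p = ev y])).
- by move=> _ [f [h ->]]; apply: tpair_linear; exact: dvoa_linear.
- by move=> _ [y ->]; exact: ev_linear.
- move=> t t0; apply: (tensor_separation (F := [set p | exists f : dvoa V, p = subsp_val f])
    (G := [set p | exists f : dvoa V, p = subsp_val f])).
  + by move=> _ [f ->]; exact: dvoa_linear.
  + by move=> _ [f ->]; exact: dvoa_linear.
  + by move=> v v0; apply: dvoa_separates => f; apply: v0; exists f.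
  + by move=> v v0; apply: dvoa_separates => f; apply: v0; exists f.
  by move=> _ _ [f ->] [h ->]; apply: t0; exists f, h.
- by move=> z z0; apply: ev_ext => y; rewrite (lin0 (ev_linear y)); apply: z0; exists y.
move=> _ _ [f [h ->]] [y ->].
have [[lf lh] le] := (dvoa_linear f, dvoa_linear h, ev_linear y).
have lfh := tpair_linear lf lh; have lP := tpair_linear lfh le.
have [B HB] := Zcoaction_trunc x.
have lD := Zcoaction_linear.
have e1 : eventually0 (fun i => ((-1) ^+ i * binz K l i) *:
    tassoc (tmap id (Zcoaction (n + i%:Z)) (Zcoaction (l + m - i%:Z) x))).
  apply: eventually0Z; exists (`|(l + m - B)%R|%N).+1 => i Ni; rewrite HB; last lia.
  by rewrite (lin0 (tmap_linear (@lin_id' _ _) (lD _))) (lin0 (@tassoc_linear _ _ _ _)).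
have e2 : eventually0 (fun i => ((-1) ^ l * (-1) ^+ i * binz K l i) *:
    tmap (@tswap K V V) id
      (tassoc (tmap id (Zcoaction (m + i%:Z)) (Zcoaction (l + n - i%:Z) x)))).
  apply: eventually0Z; exists (`|(l + n - B)%R|%N).+1 => i Ni; rewrite HB; last lia.
  rewrite (lin0 (tmap_linear (@lin_id' _ _) (lD _))) (lin0 (@tassoc_linear _ _ _ _)).
  by rewrite (lin0 (tmap_linear (@tswap_linear _ _ _) (@lin_id' _ _))).
have e3 : eventually0 (fun i => binz K m i *:
    tmap (coact V (l + i%:Z)) id (Zcoaction (m + n - i%:Z) x)).
  apply: eventually0Z; exists (`|(m + n - B)%R|%N).+1 => i Ni; rewrite HB; last lia.
  by rewrite (lin0 (tmap_linear (coact_linear _) (@lin_id' _ _))).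
rewrite (linB lP) (linB lP) (nsum_lin lP e1) (nsum_lin lP e2) (nsum_lin lP e3).
have lx : linear (fun y' : L => ev y' x) := rdual_linear (emb x).
have lx3 A B' C : A - B' - C = 0 -> ev A x - ev B' x - ev C x = 0.
  by rewrite -(lin0 lx) => <-; rewrite (linB lx (A - B') C) (linB lx A B').
pose F4 i := ((-1) ^+ i * binz K l i) *: Lst_mode (l + m - i%:Z) f (Lst_mode (n + i%:Z) h y).
pose F5 i := ((-1) ^ l * (-1) ^+ i * binz K l i) *:
  Lst_mode (l + n - i%:Z) h (Lst_mode (m + i%:Z) f y).
pose F6 i := binz K m i *: Lst_mode (m + n - i%:Z) (dmode (l + i%:Z) f h) y.
have e4 : eventually0 F4.
  apply: eventually0Z; have [C HC] := Lst_mode_ev0 char0 hDM HN n h y.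
  by exists C => i Ci; rewrite HC // (lin0 (mode_linr _ _)).
have e5 : eventually0 F5.
  apply: eventually0Z; have [C HC] := Lst_mode_ev0 char0 hDM HN m f y.
  by exists C => i Ci; rewrite HC // (lin0 (mode_linr _ _)).
have e6 : eventually0 F6.
  apply: eventually0Z; have [C HC] := eventually0_dmode f h l.
  by exists C => i Ci; rewrite HC // (lin0 (mode_linl _ _)).
have evE g k : (fun z => tpair (subsp_val g) (ev y) (Zcoaction k z)) = ev (Lst_mode k g y).
  by apply/funext => z; exact: ZcoactionP.
transitivity (ev (nsum F4) x - ev (nsum F5) x - ev (nsum F6) x); last first.
  by apply: lx3; exact: (Lst_borcherds char0 hDM HN l m n f h y).
congr (_ - _ - _).
- apply: etrans (esym (nsum_lin lx e4)); apply: eq_nsum => i.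
  rewrite (linZ lP) /F4 (linZ lx); congr (_ *: _).
  by rewrite (tpair_assoc _ lf lh le (lD _)) evE ZcoactionP.
- apply: etrans (esym (nsum_lin lx e5)); apply: eq_nsum => i.
  rewrite (linZ lP) /F5 (linZ lx); congr (_ *: _).
  by rewrite (tpair_swap_assoc _ lf lh le (lD _)) evE ZcoactionP.
apply: etrans (esym (nsum_lin lx e6)); apply: eq_nsum => i.
rewrite (linZ lP) /F6 (linZ lx); congr (_ *: _).
rewrite (tpair_tmap _ lfh le (coact_linear _) (@lin_id' _ _)).
rewrite -[X in tpair X _ _]/(subsp_val (dmode (l + i%:Z) f h)).
exact: ZcoactionP.
Qed.

Lemma ev_vir k y z : ev y (vir (rho V) Zcoaction k z) = ev (Lst_mode (1 - k) (omega V) y) z.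
Proof.
rewrite /vir -tpair_contrl; [|exact: rho_linear|exact: ev_linear].
by rewrite -(omega_val V char0) ZcoactionP.
Qed.

Lemma vir_lin k : linear (vir (rho V) Zcoaction k).
Proof. by apply: ev_inv_linear => a z z' y; rewrite !ev_vir (ev_linear _ a). Qed.

Lemma Zcoaction_deriv k z :
  tmap (vir (rho V) (coact V) 1) id (Zcoaction k z) = (- k)%:~R *: Zcoaction (k - 1) z.
Proof.
apply: coaction_unique => f y; have [lf le] := (dvoa_linear f, ev_linear y).
rewrite (tpair_tmap _ lf le (vir_linear 1) (@lin_id' _ _)) (linZ (tpair_linear lf le)).
rewrite (_ : (fun v => _) = subsp_val (dT f)); last by apply/funext => v; rewrite (dTE char0).
by rewrite !ZcoactionP (Lst_mode_dT char0 hDM HN) /ev (linZ (rdual_linear (emb z))).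
Qed.

Lemma Zcoaction_comm k z : (- k)%:~R *: Zcoaction (k - 1) z =
  Zcoaction k (vir (rho V) Zcoaction 1 z) - tmap id (vir (rho V) Zcoaction 1) (Zcoaction k z).
Proof.
apply: coaction_unique => f y; have [lf le] := (dvoa_linear f, ev_linear y).
have lP := tpair_linear lf le.
rewrite (linZ lP) (linB lP) (tpair_tmap _ lf le (@lin_id' _ _) (vir_lin 1)).
rewrite (_ : (fun z => ev y _) = ev (Lst_mode 0 (omega V) y)); last first.
  by apply/funext => x; rewrite ev_vir subrr.
have lz : linear (fun y' : L => ev y' z) := rdual_linear (emb z).
have E0 : tpair (subsp_val f) (ev y) (Zcoaction k (vir (rho V) Zcoaction 1 z))
    = ev (Lst_mode 0 (omega V) (Lst_mode k f y)) z.
  by rewrite ZcoactionP (ev_vir 1 (Lst_mode k f y) z) (subrr (1 : int)).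
transitivity ((- k)%:~R *: ev (Lst_mode (k - 1) f y) z : K^o).
  by congr (_ *: _); exact: ZcoactionP.
transitivity (ev (Lst_mode 0 (omega V) (Lst_mode k f y)) z
  - ev (Lst_mode k f (Lst_mode 0 (omega V) y)) z); last first.
  by congr (_ - _); [rewrite E0 | symmetry; exact: ZcoactionP].
apply: etrans (linB lz (Lst_mode 0 (omega V) (Lst_mode k f y)) (Lst_mode k f (Lst_mode 0 (omega V) y))).
rewrite (Lst_mode_comm char0 hDM HN 0 k) nsum1 => [|[|i] // _]; last by rewrite binz0S scale0r.
rewrite binz_0 scale1r add0r (subr0 k) -/(dT f) (Lst_mode_dT char0 hDM HN).
exact: (esym (linZ lz _ _)).
Qed.

(** Transposition reverses products, which matches the reflection of the indices
    in [Lst_mode_virasoro]. *)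
Lemma Zcoaction_vir : virasoro (rank V) (vir (rho V) Zcoaction).
Proof.
move=> k j z; apply: ev_ext => y; have le := ev_linear y.
have lz : linear (fun y' : L => ev y' z) := rdual_linear (emb z).
have E2 a b : ev y (vir (rho V) Zcoaction a (vir (rho V) Zcoaction b z))
    = ev (Lst_mode (1 - b) (omega V) (Lst_mode (1 - a) (omega V) y)) z.
  by rewrite (ev_vir a y) (ev_vir b _ z).
have H (E F : lmodType K) (p : E -> F) (q : Z -> F) A B' C e c (A' B1 C' w : Z) : linear p -> linear q ->
    q A' = p A -> q B1 = p B' -> q C' = p C -> q w = p e -> 
    A - B' = (k - j)%:~R *: C + c *: e -> q (A' - B1) = q ((k - j)%:~R *: C' + c *: w).
  move=> lp lq e1 e2 e3 e4 E5; rewrite (linB lq) (linD lq) !(linZ lq) e1 e2 e3 e4.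
  by rewrite -(linB lp) E5 (linD lp) !(linZ lp).
exact: (H _ _ _ _ _ _ _ _ _ _ _ _ _ lz le (E2 k j) (E2 j k) (ev_vir (k + j) y z) erefl
  (Lst_mode_virasoro k j y)).
Qed.

Lemma Zcoaction_weak : weak_comodule Zcoaction.
Proof.
split; [exact: Zcoaction_trunc|exact: Zcoaction_counit|exact: Zcoaction_jacobi|
  exact: Zcoaction_vir|exact: Zcoaction_deriv|exact: Zcoaction_comm].
Qed.

Lemma Zcoaction_gr (gZ : nat -> submodClosed Z) k t z :
  (forall r z', emb z' \in Ldual_gr DM r -> z' \in gZ r) -> emb z \in Ldual_gr DM t ->
  Zcoaction k z \in tgr Posz (gr V) gZ (t%:Z + k + 1).
Proof.
move=> embZ zt; apply: lspan_ind (coaction_span k z) => _ [s [v [f [vs fs ->]]]].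
have [neg|nneg] := ltP (t%:Z + k + 1 - s) 0.
  rewrite (_ : zadj k f z = 0) ?pure0r ?rpred0 //; apply: emb_inj.
  by rewrite embE (adj_gr_neg fs zt neg) (lin0 emb_lin).
apply: mem_lspan; exists `|(t%:Z + k + 1 - s)%R|%N, v, (zadj k f z); split=> //.
  by rewrite (_ : _ - _ = s) //; lia.
apply: embZ; rewrite embE; apply: (adj_gr fs zt); lia.
Qed.

End Coaction.

Lemma Ldual_coactE k x f y :
  tpair (subsp_val f) (fun x' : Ld => subsp_val x' y) (Ldual_coact k x)
  = subsp_val x (Lst_mode k f y).
Proof.
have [p cp _] := @coaction_exists Ld id adj (@lin_id' _ _) (fun _ _ _ => erefl) k x.
exact: (@xgetI _ 0 [set p | coaction_at id k x p] p cp).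
Qed.

Lemma subgr_val (S : submodClosed Ld) t (z : subsp S) :
  z \in subgr S t -> subsp_val z \in Ldual_gr DM t.
Proof.
move: z; apply: lspan_elim => [|a u v ut vt]; first exact: rpred0.
by rewrite (_ : subsp_val _ = a *: subsp_val u + subsp_val v) // rpredD // rpredZ.
Qed.

(** A functional of degree [t] is determined by its values in degree [t], where
    functionals of the other degrees vanish. *)
Lemma subgr_direct_sum (S : submodClosed Ld) :
  (forall x, x \in S -> x \in lspan [set x' | x' \in S /\ exists t, x' \in Ldual_gr DM t]) ->
  direct_sum (subgr S).
Proof.
move=> graded; split=> [z|i z zi zj].
  suff [z' /subsp_inj -> //] : exists2 z' : subsp S, subsp_val z' = subsp_val z &
      z' \in lspan [set x | exists i, x \in subgr S i].
  have zS : subsp_val z \in S := valP z.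
  move: (subsp_val z) (graded _ zS) => {z zS}; apply: lspan_elim => [|a x x' [xS [t xt]] [z' <- zs]].
    by exists 0 => //; exact: rpred0.
  exists (a *: Subsp xS + z') => //; rewrite rpredD // rpredZ //.
  by apply: mem_lspan; exists t; exact: mem_lspan.
apply: subsp_inj; apply: Ldual_ext => t y yt.
have [ti|/eqP ti] := eqVneq t i; last first.
  by have /rdual_grP zi0 := subgr_val zi; exact: (zi0 t y ti yt).
have lf := lin_comp (eval_linear y) (@subsp_val_linear _ _ S).
apply: (lspan_eq0 lf) zj => u [j ji /subgr_val /rdual_grP uj].
by apply: (uj t y _ yt); rewrite ti => /esym.
Qed.

(** Stability under the transposed modes is all that a graded subspace of the
    dual needs in order to be a comodule. *)
Lemma stable_subcomodule (S : submodClosed Ld) :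
  (forall k f x, x \in S -> adj k f x \in S) ->
  (forall x, x \in S -> x \in lspan [set x' | x' \in S /\ exists t, x' \in Ldual_gr DM t]) ->
  subcomodule S.
Proof.
move=> stable graded.
pose zadj k f (z : subsp S) : subsp S := Subsp (stable k f _ (valP z)).
have lv := @subsp_val_linear _ _ S.
have iv : injective (@subsp_val _ _ S) by exact: subsp_inj.
have ve k f z : subsp_val (zadj k f z) = adj k f (subsp_val z) by [].
have lid := @lin_id' K Ld; have iid : injective (@id Ld) by [].
have vid k f x : id (adj k f x) = adj k f (id x) by [].
exists (Zcoaction lv iv ve); split=> [k z|].
  apply: (coaction_unique lid iid) => f y; rewrite Ldual_coactE.
  rewrite (tpair_tmap _ (dvoa_linear f) (ev_linear lid y) (@lin_id' _ _) lv).
  exact: (ZcoactionP lv iv ve).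
split.
- exact: Zcoaction_weak.
- exact: subgr_direct_sum.
by move=> k t z /subgr_val; apply: Zcoaction_gr => r z' zr; exact: mem_lspan.
Qed.

End DualComodule.

(** * Bases and countable dimension *)

Section CountableDimension.
Variables (K : fieldType) (E : lmodType K).
Implicit Types (u v : E).

Lemma lin_indep_notin (B : set E) v : lin_indep B -> B v ->
  v \notin lspan [set u | B u /\ u != v].
Proof.
move=> indep Bv; apply/negP => /asboolP[s sB ev].
pose U := undup (map snd s).
pose c u := \sum_(p <- s | p.2 == u) p.1.
have eU : v = \sum_(u <- U) c u *: u.
  rewrite ev; under [RHS]eq_bigr do rewrite scaler_suml.
  rewrite (exchange_big_dep xpredT) //= big_seq [RHS]big_seq; apply: eq_bigr => p ps.
  have pU : p.2 \in U by rewrite mem_undup map_f.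
  rewrite big_mkcond (bigD1_seq p.2) ?undup_uniq //= eqxx big1 ?addr0 // => u.
  by rewrite eq_sym => /negbTE ->.
have vU : v \notin U.
  by apply/negP; rewrite mem_undup => /mapP[p /sB[_ +] e]; rewrite -e eqxx.
have UB u : u \in U -> B u by rewrite mem_undup => /mapP[p /sB[? _] ->].
have := indep (v :: U) (fun u => if u == v then -1 else c u).
rewrite /= vU undup_uniq => /(_ isT) H.
have /H {}H : forall u, u \in v :: U -> B u.
  by move=> u; rewrite inE => /predU1P[-> //|]; exact: UB.
suff /eqP : -1 = 0 :> K by rewrite oppr_eq0 oner_eq0.
have := H _ v (mem_head _ _); rewrite eqxx; apply.
rewrite big_cons eqxx scaleN1r [X in - v + X](_ : _ = v) ?addNr // {2}eU.
apply: eq_big_seq => u uU; case: eqP => // e.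
by rewrite -e uU in vU.
Qed.

(** The lines spanned by the vectors of a basis, indexed by all vectors;
    components in this direct sum are coordinates. *)
Lemma basis_direct_sum (B : set E) : basis B ->
  direct_sum (fun i : E => lspan [set v | B v /\ v = i]).
Proof.
move=> [indep spanB]; split=> [v|i x xi xj].
  apply: lspan_ind (spanB v) => u Bu; apply: mem_lspan; exists u.
  exact: mem_lspan.
have {}xj : x \in lspan [set u | B u /\ u != i].
  apply: lspan_ind xj => u [j ji]; apply: lspan_ind => w [Bw wj].
  by apply: mem_lspan; split=> //; apply/eqP; rewrite wj.
have [Bi|nBi] := pselect (B i); last first.
  by move: x xi {xj}; apply: lspan_elim => // a u v [Bu ui]; case: nBi; rewrite -ui.
have [a xa] : exists a, x = a *: i.
  move: x xi {xj}; apply: lspan_elim => [|a u v [_ ->] [b ->]].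
    by exists 0; rewrite scale0r.
  by exists (a + b); rewrite scalerDl.
have [a0|a0] := eqVneq a 0; first by rewrite xa a0 scale0r.
have /negP [] := lin_indep_notin indep Bi.
by rewrite -[X in X \in _](scalerK a0 i) rpredZ // -xa.
Qed.

(** Coordinates in a basis separate points. *)
Lemma dual_separates (m : E) : (exists B : set E, basis B) ->
  (forall n : dual E, subsp_val n m = 0) -> m = 0.
Proof.
move=> [B bB] m0; have ds := basis_direct_sum bB.
have [A _ mA] := graded_sum ds m; rewrite (mA (undup A)) ?undup_uniq //; last first.
  by move=> i; rewrite mem_undup.
rewrite big1 // => i _.
have [Bi|nBi] := pselect (B i); last first.
  move: (hcomp _ _ _) (hcomp_mem ds i m) => x; move: x.
  by apply: lspan_elim => // a u v [Bu ui]; case: nBi; rewrite -ui.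
have i0 : i != 0.
  by apply/eqP => i0; have := lin_indep_notin bB.1 Bi; rewrite [X in X \notin _]i0 rpred0.
have ex v : exists a, hcomp (fun i : E => lspan [set v | B v /\ v = i]) i v = a *: i.
  move: (hcomp _ _ _) (hcomp_mem ds i v) => x; move: x.
  apply: lspan_elim => [|a u w [_ ->] [b ->]]; first by exists 0; rewrite scale0r.
  by exists (a + b); rewrite scalerDl.
pose phi v : K^o := projT1 (cid (ex v)).
have phiE v : hcomp (fun i : E => lspan [set v | B v /\ v = i]) i v = phi v *: i.
  exact: projT2 (cid (ex v)).
have iinj (a b : K) : a *: i = b *: i -> a = b.
  move=> /eqP; rewrite -subr_eq0 -scalerBl scaler_eq0 (negbTE i0) orbF subr_eq0.
  by move/eqP.
have lphi : phi \in linear_functionals E.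
  apply/asboolP => a u v; apply: iinj; rewrite -phiE (hcomp_linear i ds) !phiE.
  by rewrite scalerDl scalerA.
have phi0 : phi m = 0 := m0 (Subsp lphi).
by rewrite phiE phi0 scale0r.
Qed.

(** Of a spanning sequence, keep the vectors that do not depend on earlier ones. *)
Lemma countable_span_dim (x : nat -> E) : (forall v, v \in lspan (range x)) ->
  countable_dim E.
Proof.
move=> span_x; pose before i := lspan [set u | exists2 j, (j < i)%N & u = x j].
pose B := [set v | exists2 i, v = x i & x i \notin before i].
exists B; last first.
  have BX : B `<=` range x by move=> v [i -> _]; exists i.
  apply: sub_countable (subset_card_le BX) _.
  exact: sub_countable (card_image_le _ _) (countableP _).
split=> [s a us sB s0 v vs|v]; last first.
  apply: lspan_ind (span_x v) => _ [i _ <-]; have [n] := ubnP i.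
  elim: n i => // n IH i; rewrite ltnS => ni.
  have [xi|xi] := boolP (x i \in before i); last by apply: mem_lspan; exists i.
  by apply: lspan_ind xi => _ [j ji ->]; apply: IH; exact: leq_trans ni.
have [ix ixP] : exists ix : E -> nat, forall u, u \in s ->
    u = x (ix u) /\ x (ix u) \notin before (ix u).
  have [u|ix ixP] := @choice E nat (fun u i => u \in s -> u = x i /\ x i \notin before i).
    have [/sB[i ui xi]|us'] := pselect (u \in s); first by exists i => _; rewrite -ui in xi *.
    by exists 0%N.
  by exists ix.
(* Downward induction on the index: the last vector with a nonzero coefficient
   would depend on earlier ones. *)
pose T := (\max_(u <- s) ix u)%N.
have ixT u : u \in s -> (ix u <= T)%N.
  by move=> us'; rewrite /T (big_rem u) //= leq_maxl.
have [n] := ubnP (T - ix v)%N; elim: n v vs => // n IH v vs; rewrite ltnS => vn.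
apply/eqP; apply: contraT => av; have [vE /negP[]] := ixP v vs.
rewrite -vE -[X in X \in _](scalerK av v) rpredZ //.
move: s0; rewrite (bigD1_seq v) //= => /eqP; rewrite addr_eq0 => /eqP ->.
rewrite -scaleN1r rpredZ // big_seq_cond rpred_sum // => u /andP[us' uv].
have [uE _] := ixP u us'.
have [lt|gt|e] := ltngtP (ix u) (ix v).
- by apply/rpredZ/mem_lspan; exists (ix u).
- rewrite (IH u us') ?scale0r ?rpred0 //; have := ixT u us'; lia.
by rewrite uE e -vE eqxx in uv.
Qed.

End CountableDimension.

(** * The sub comodule generated by [M] *)

Section LowestWeight.
Variables (K : fieldType) (V : gvoc K) (M : lmodType K).
Hypothesis char0 : forall n, n.+1%:R != 0 :> K.
Variable DM : {linear M -> tensor (zhuC V) M}.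
Hypothesis hDM : zhu_comodule DM.
Variable N : int.
Hypothesis HN : forall s (f : dvoa V), (s < N)%R -> f \in dvoa_gr V s -> f = 0.

Local Notation L := (Lst DM).
Local Notation Ld := (Ldual DM).
Local Notation adj := (adj char0 hDM HN).
Local Notation embM := (M_embed DM).
Implicit Types (f h : dvoa V) (y : L) (x : Ld) (m : M) (n : dual M).
Local Opaque Lst_mode dmode Lst_proj.

Lemma embed_subproof m :
  (fun y => subsp_val (Lst_proj N y) m : K^o) \in restricted_functionals (Lst_gr DM).
Proof.
have lp := Lst_proj_linear char0 hDM HN.
apply/asboolP; split; first by move=> a y y'; rewrite (lp a).
apply: (@sub_finite_set _ _ [set 0%N]); last exact: finite_set1.
move=> t [y yt] /=; case: t yt => // t yt.
by rewrite (Lst_proj_gr char0 hDM HN _ yt) // eqxx.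
Qed.

Lemma embed_unique x x' : x \in Ldual_gr DM 0 -> x' \in Ldual_gr DM 0 ->
  (forall n, subsp_val x (Lst_incl DM n) = subsp_val x' (Lst_incl DM n)) -> x = x'.
Proof.
move=> /rdual_grP x0 /rdual_grP x0' e; apply: (Ldual_ext char0) => t y yt.
have [t0|/eqP t0] := eqVneq t 0%N; last by rewrite (x0 t y) // (x0' t y).
by rewrite t0 in yt; have [n ->] := Lst_gr0 char0 hDM HN yt; exact: e.
Qed.

Lemma embedP m : embM m \in Ldual_gr DM 0 /\
  forall n, subsp_val (embM m) (Lst_incl DM n) = subsp_val n m.
Proof.
have e0 : (Subsp (embed_subproof m) : Ld) \in Ldual_gr DM 0.
  apply/rdual_grP => t y t0 yt /=; rewrite (Lst_proj_gr char0 hDM HN _ yt) //.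
  by case: t t0 {yt}.
have e1 n : subsp_val (Subsp (embed_subproof m) : Ld) (Lst_incl DM n) = subsp_val n m.
  by rewrite /= (Lst_proj_incl char0 hDM HN).
exact: (@xgetI _ 0 [set x | x \in Ldual_gr DM 0 /\ forall n : dual M,
    subsp_val x (Lst_incl DM n) = subsp_val n m] _ (conj e0 e1)).
Qed.

Lemma embedE m y : subsp_val (embM m) y = subsp_val (Lst_proj N y) m.
Proof.
have [e0 e1] := embedP m.
suff -> : embM m = Subsp (embed_subproof m) by [].
apply: embed_unique => // [|n]; last by rewrite e1 /= (Lst_proj_incl char0 hDM HN).
apply/rdual_grP => t u t0 ut /=; rewrite (Lst_proj_gr char0 hDM HN _ ut) //.
by case: t t0 {ut}.
Qed.

Lemma embed_linear : linear embM.
Proof.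
by move=> a m m'; apply: rdual_ext => y; rewrite embedE (dual_linear (Lst_proj N y)) -!embedE.
Qed.

(** A sub comodule recovers the transposed modes of its elements by contracting
    its coaction. *)
Lemma subcomodule_stable (S : submodClosed Ld) k f x : subcomodule S ->
  x \in S -> adj k f x \in S.
Proof.
move=> [D [DE _]] xS; have lf := dvoa_linear f.
have lv := @subsp_val_linear _ _ S.
have lD : linear (D k) := lin_linear (D k).
rewrite (_ : adj k f x = subsp_val (contrl (subsp_val f) (D k (Subsp xS)))); last first.
  apply: rdual_ext => y.
  rewrite -[LHS]/(subsp_val x (Lst_mode k f y)) -(Ldual_coactE char0 hDM HN).
  rewrite -(DE k (Subsp xS)) (tpair_tmap _ lf (eval_linear y) (@lin_id' _ _) lv).
  exact: (tpair_contrl _ lf (lin_comp (eval_linear y) lv)).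
exact: valP.
Qed.

Lemma subcomodule_graded (S : submodClosed Ld) x : subcomodule S -> x \in S ->
  x \in lspan [set x' | x' \in S /\ exists t, x' \in Ldual_gr DM t].
Proof.
move=> [D [_ aD]] xS; have := (ac_sum aD).1 (Subsp xS).
have lv := @subsp_val_linear _ _ S.
rewrite -[X in X \in lspan [set x' | _ /\ _]]/(subsp_val (Subsp xS)); move: (Subsp xS).
apply: (lspan_lin lv) => z [t zt]; apply: mem_lspan; split; first exact: valP.
by exists t; exact: subgr_val zt.
Qed.

Lemma act_word_adj (w : seq (int * dvoa V)) x y :
  subsp_val (act_word adj w x) y =
  subsp_val x (act_word (fun k f (y : L) => Lst_mode k f y) (rev w) y).
Proof.
elim: w y => [|[k f] w IH] y //=.
by rewrite IH rev_cons /act_word -cats1 foldr_cat.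
Qed.

(** The transpose of an operator on [M], which sends [m] to [m']. *)
Definition transposable (F : dual M -> dual M) : Prop :=
  forall m, exists m', forall n, subsp_val (F n) m = subsp_val n m'.

(** The transpose of a zero mode is the coaction of [M] contracted by the
    functional. *)
Lemma zero_part_transposable z F : transposable F -> transposable (fun n => zero_part DM z (F n)).
Proof.
move=> HF m; elim/hat_elim: z => [|s f k z fs [m' IH]].
  exists 0 => n; rewrite (lin0 (zero_part_linl char0 DM (F n))).
  by rewrite (lin0 (dual_linear n)).
have [m1 H1] : exists m1, forall n, subsp_val (zero_part DM (hat_elt f k) (F n)) m = subsp_val n m1.
  have [e|ne] := eqVneq (s - k - 1) 0; last first.
    exists 0 => n; rewrite (zero_part_elt char0 DM _ _ fs) (negbTE ne).
    by rewrite (lin0 (dual_linear n)).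
  have [m1 H1] := HF (contrl (subsp_val (restr f)) (DM m)).
  exists m1 => n; rewrite (zero_part_elt char0 DM _ _ fs) e eqxx -H1.
  by rewrite -tpair_contrl //; exact: dual_linear.
exists (m1 + m') => n; rewrite (linD (zero_part_linl char0 DM (F n))) (linD (dual_linear n)).
by rewrite -H1 -IH.
Qed.

Lemma wproj_transposable w : transposable (fun n => wproj DM N n w).
Proof.
rewrite /wproj; move: w; apply: project_ind.
- by move=> m; exists m.
- by move=> m; exists 0 => n; rewrite (lin0 (dual_linear n)).
- move=> F G HF HG m; have [[m1 H1] [m2 H2]] := (HF m, HG m).
  by exists (m1 + m2) => n; rewrite (linD (dual_linear n)) -H1 -H2.
exact: zero_part_transposable.
Qed.

(** The lowest component of the sub comodule generated by [M] is [M]: paired with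
    the lowest component of the module, a word of transposed modes applied to [m]
    is a projected word, which is built from the action of [C(V)^*] on the dual of
    [M], and this action is the transpose of the coaction of [M]. *)
Lemma word_degree0 (w : seq (int * dvoa V)) m : exists m', forall n,
  subsp_val (act_word adj w (embM m)) (Lst_incl DM n) = subsp_val n m'.
Proof.
have [m' H] := wproj_transposable [seq hat_elt p.2 p.1 | p <- rev w] m.
exists m' => n; rewrite act_word_adj embedE (act_word_qL char0 hDM HN).
by rewrite (ind_act_word char0) cats0 (Lst_proj_word char0 hDM HN).
Qed.

Variables (bm : nat -> M) (fb : int -> nat -> dvoa V).
Hypothesis bm_span : forall m, m \in lspan (range bm).
Hypothesis fb_gr : forall s i, fb s i \in dvoa_gr V s.
Hypothesis fb_span : forall s f, f \in dvoa_gr V s -> f \in lspan (range (fb s)).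

Definition gen_index := (seq (int * (int * nat)) * nat)%type.
Definition index_word (w : seq (int * (int * nat))) : seq (int * dvoa V) :=
  [seq (p.1, fb p.2.1 p.2.2) | p <- w].
Definition generator (i : gen_index) : Ld := act_word adj (index_word i.1) (embM (bm i.2)).
Definition generated : submodClosed Ld := lspan (range generator).

Lemma generator_gr i : exists t, generator i \in Ldual_gr DM t.
Proof.
case: i => w j; rewrite /generator; elim: w => [|[k [s i]] w [t IH]] /=.
  by exists 0%N; case: (embedP (bm j)).
have [neg|nneg] := ltP (t%:Z + k + 1 - s) 0.
  by exists 0%N; rewrite (adj_gr_neg char0 hDM HN (fb_gr s i) IH neg) rpred0.
exists `|(t%:Z + k + 1 - s)%R|%N; apply: (adj_gr char0 hDM HN (fb_gr s i) IH); lia.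
Qed.

Lemma generated_stable k f x : x \in generated -> adj k f x \in generated.
Proof.
have ll x' := adj_linl char0 hDM HN k x'.
move=> xg; elim/dvoa_elim: f => [|s f f' fs IH]; first by rewrite (lin0 (ll x)) rpred0.
rewrite (linD (ll x)) rpredD //; move: f {f' IH fs} (fb_span fs).
apply: (lspan_lin (ll x)) => _ [i _ <-].
move: x xg; apply: (lspan_lin (adj_linr char0 hDM HN k (fb s i))) => _ [[w j] _ <-].
by apply: mem_lspan; exists ((k, (s, i)) :: w, j).
Qed.

Lemma embed_generated m : embM m \in generated.
Proof.
move: m (bm_span m); apply: (lspan_lin embed_linear) => _ [j _ <-].
by apply: mem_lspan; exists ([::], j).
Qed.

(** The words of transposed modes applied to [M] are homogeneous and their span is
    stable, so that no further closure is needed to obtain [W(M)]. *)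
Lemma generated_subcomodule : subcomodule generated.
Proof.
apply: (@stable_subcomodule K V M char0 DM hDM N HN generated); first exact: generated_stable.
move=> x; apply: lspan_ind => _ [i _ <-]; apply: mem_lspan; split.
  by apply: mem_lspan; exists i.
exact: generator_gr.
Qed.

(** A sub comodule containing [M] is stable under transposed modes. *)
Lemma generator_W i : generator i \in W DM.
Proof.
apply/asboolP => S cS MS; case: i => w j; rewrite /generator /=.
elim: w => [|[k [s i]] w IH] /=; first exact: MS.
exact: subcomodule_stable.
Qed.

Lemma W_generated x : x \in W DM -> x \in generated.
Proof. by move=> /asboolP; apply; [exact: generated_subcomodule|exact: embed_generated]. Qed.

Lemma W_degree0 x : x \in W DM -> x \in Ldual_gr DM 0 -> exists m, x = embM m.
Proof.
move=> /W_generated xW x0.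
have [m Hm] : exists m, forall n, subsp_val x (Lst_incl DM n) = subsp_val n m.
  move: x xW {x0}; apply: lspan_elim => [|a _ x [[w j] _ <-] [m Hm]].
    by exists 0 => n; rewrite (lin0 (dual_linear n)).
  have [m' Hm'] := word_degree0 (index_word w) (bm j).
  exists (a *: m' + m) => n; rewrite (dual_linear n) -Hm -Hm'.
  exact: (eval_linear (Lst_incl DM n) a (generator (w, j)) x).
exists m; have [e0 e1] := embedP m.
by apply: embed_unique => // n; rewrite e1 Hm.
Qed.

(** A sub comodule is graded, so that one meeting [M] trivially has no component
    of degree 0. *)
Lemma Jmax_degree0 (y : subsp (W DM)) n : y \in Jmax DM ->
  subsp_val (subsp_val y) (Lst_incl DM n) = 0.
Proof.
have lv := @subsp_val_linear _ _ (W DM).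
apply: (lspan_eq0 (lin_comp (eval_linear (Lst_incl DM n)) lv)).
move=> {}y [T [cT TW TM yT]].
move: (subsp_val y) (subcomodule_graded cT yT).
apply: (lspan_eq0 (eval_linear (Lst_incl DM n))) => x [xT [t xt]].
case: t xt => [|t] xt; last first.
  by move/rdual_grP: xt => /(_ 0%N) -> //; exact: Lst_incl_gr.
have [m xm] := W_degree0 (TW x xT) xt.
by rewrite xm TM // -xm.
Qed.

Lemma LM_incl_linear : linear (LM_incl DM).
Proof.
move=> a m m'; rewrite /LM_incl -qpi_linear; congr (qpi _ _).
by apply: subsp_inj; exact: embed_linear.
Qed.

Lemma LM_degree0 (z : LM DM) : z \in LM_gr DM 0 <-> exists m, z = LM_incl DM m.
Proof.
split=> [|[m ->]]; last first.
  by apply: mem_lspan; eexists; last reflexivity; exact: (embedP m).1.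
move: z; apply: lspan_elim => [|a _ z [y y0 <-] [m ->]].
  by exists 0; rewrite (lin0 LM_incl_linear).
have [m' ym'] := W_degree0 (valP y) y0.
exists (a *: m' + m); rewrite LM_incl_linear; congr (_ *: qpi _ _ + _).
exact: subsp_inj.
Qed.

Lemma LM_incl_inj : (exists B : set M, basis B) -> injective (LM_incl DM).
Proof.
move=> bM m m' /qpi_eq J; apply/eqP; rewrite -subr_eq0; apply/eqP.
apply: (dual_separates bM) => n; rewrite -(embedP (m - m')).2 (linB embed_linear).
exact: (Jmax_degree0 n J).
Qed.

Definition LM_generator (i : nat) : LM DM :=
  if @choice.unpickle gen_index i is Some j then qpi (Jmax DM) (Subsp (generator_W j)) else 0.

Lemma LM_span (z : LM DM) : z \in lspan (range LM_generator).
Proof.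
rewrite -[z]qreprK; move: (qrepr z) => [x xW].
have [y <- ys] : exists2 y : subsp (W DM), y = Subsp xW &
    y \in lspan (range (fun j => Subsp (generator_W j))).
  suff [y yx ys] : exists2 y : subsp (W DM), subsp_val y = x &
      y \in lspan (range (fun j => Subsp (generator_W j))).
    by exists y => //; exact: subsp_inj.
  move: (W_generated xW); move: x {xW}; apply: lspan_elim => [|a _ x [j _ <-] [y <- ys]].
    by exists 0 => //; exact: rpred0.
  exists (a *: Subsp (generator_W j) + y) => //; rewrite rpredD // rpredZ //.
  by apply: mem_lspan; exists j.
move: y ys; apply: (lspan_lin (@qpi_linear _ _ _)) => _ [j _ <-].
by apply: mem_lspan; exists (choice.pickle j) => //; rewrite /LM_generator choice.pickleK.
Qed.

End LowestWeight.

(** * Dimension and lowest component *)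

Lemma dvoa_countable_span (K : fieldType) (V : gvoc K) : exists fb : int -> nat -> dvoa V,
  (forall s i, fb s i \in dvoa_gr V s) /\
  (forall s (f : dvoa V), f \in dvoa_gr V s -> f \in lspan (range (fb s))).
Proof.
have [s|fb H] := @choice int (nat -> dvoa V) (fun s b => (forall i, b i \in dvoa_gr V s) /\
    forall f : dvoa V, f \in dvoa_gr V s -> f \in lspan (range b)).
  have [n [e [b [_ bs fE]]]] := dvoa_basis V s; exists b; split=> // f /fE ->.
  by apply: rpred_sum => i _; apply/rpredZ/mem_lspan; exists i.
by exists fb; split=> s; case: (H s).
Qed.

Lemma countable_dim_span (K : fieldType) (E : lmodType K) : countable_dim E ->
  exists b : nat -> E, forall v, v \in lspan (range b).
Proof.
move=> [B [_ spanB] /countable_injP[p pinj]].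
exists (fun i => xget 0 [set v | B v /\ p v = i]) => v.
apply: lspan_ind (spanB v) => u Bu; apply: mem_lspan; exists (p u) => //.
case: xgetP => [w _ [Bw pw]|/(_ u)[]//]; apply: pinj; rewrite ?inE //.
Qed.

Theorem lemma6p2 (R : realType) (V : gvoc R[i])
    (hc : ~ (forall v, v \in gr V 0 -> counit V v = 0))
    (hrho : ~ (forall v, v \in gr V 2 -> rho V v = 0))
    (hC : findim (zhu_sub V))
    (M : lmodType R[i]) (DM : {linear M -> tensor (zhuC V) M})
    (hDM : zhu_comodule DM)
    (hM : countable_dim M) :
  countable_dim (LM DM) /\
  (injective (LM_incl DM) /\
   forall x : LM DM, x \in LM_gr DM 0 <-> exists m : M, x = LM_incl DM m).
Proof.
have char0 (n : nat) : n.+1%:R != 0 :> R[i] by rewrite pnatr_eq0.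
have [N HN] := gr_lower_bound V.
have [bm bm_span] := countable_dim_span hM.
have [fb [fb_gr fb_span]] := dvoa_countable_span V.
split; first exact: (countable_span_dim (LM_span char0 hDM HN bm_span fb_gr fb_span)).
split; first by apply: (LM_incl_inj char0 hDM HN bm_span fb_gr fb_span); case: hM => B; exists B.
exact: (LM_degree0 char0 hDM HN bm_span fb_gr fb_span).
Qed.
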